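(* Let $k$ be an algebraically closed field of characteristic $5$, let $\Gamma\subset\mathbb{P}^2$ be a $k$-Hermitian curve, and let $\mathcal{D}$ be the set of connected components of the graph $G$ on the set $\mathcal{Q}$ of non-singular conics totally tangent to $\Gamma$. Let $H$ be the graph with vertex set $\mathcal{D}$ in which distinct $D,D'$ are adjacent if and only if $T(D,D')=\alpha^{15}\gamma^{6}$. Let $D,D'\in\mathcal{D}$ be distinct. If $D$ and $D'$ are in the same connected component of $H$, then $T(D,D')$ is either $\gamma^{21}$ or $\alpha^{15}\gamma^{6}$. If $D$ and $D'$ are in different connected components of $H$, then $T(D,D')$ is either $\beta^{21}$ or $\alpha^{3}\gamma^{18}$.
   Context: Work over an algebraically closed field $k$ of characteristic $5$. A $k$-Hermitian curve is a projective plane curve $\Gamma\subset\mathbb{P}^2$ of degree $6$ that is projectively isomorphic (via $\mathrm{PGL}_3(k)$) to the Fermat curve $\Gamma_5: x^6+y^6+z^6=0$. $\mathcal{P}$ denotes the set of Weierstrass points of $\Gamma$; equivalently, the set of points $P\in\Gamma$ whose tangent line meets $\Gamma$ at $P$ with intersection multiplicity $6$ (for $\Gamma=\Gamma_5$, the $\mathbb{F}_{25}$-rational points). One has $|\mathcal{P}|=126$. A line of $\mathbb{P}^2$ is a special secant line of $\Gamma$ if it passes through two distinct points of $\mathcal{P}$. A non-singular conic $Q\subset\mathbb{P}^2$ is totally tangent to $\Gamma$ if $Q$ meets $\Gamma$ at six distinct points, each with intersection multiplicity $2$. $\mathcal{Q}$ denotes the set of all such conics; one has $|\mathcal{Q}|=3150$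 and $Q\cap\Gamma\subset\mathcal{P}$ for $Q\in\mathcal{Q}$. For $Q\in\mathcal{Q}$, $\mathcal{S}(Q)$ is the set of the $15$ special secant lines of $\Gamma$ passing through two distinct points of $Q\cap\Gamma$. $G$ is the graph with vertex set $\mathcal{Q}$ in which distinct $Q,Q'$ are adjacent if and only if $|Q\cap Q'|=4$ and $|\mathcal{S}(Q)\cap\mathcal{S}(Q')|=3$. $\mathcal{D}$ is the set of connected components of $G$ (there are $150$ of them); each $D\in\mathcal{D}$ is regarded as a subset of $\mathcal{Q}$, consisting of $21$ conics. For $Q\in\mathcal{Q}$ and $D'\in\mathcal{D}$ with $Q\notin D'$, the type $t(Q,D')\in\{\alpha,\beta,\gamma\}$ is defined by the values of $|Q\cap Q'\cap\Gamma|$ as $Q'$ runs over the $21$ conics of $D'$: $t(Q,D')=\alpha$ if the value is $2$ for $3$ conics and $0$ for $18$; $t(Q,D')=\beta$ if it is $2$ for $1$ conic, $1$ for $4$ conics and $0$ for $16$; $t(Q,D')=\gamma$ if it is $1$ for $6$ conics and $0$ for $15$. (One of these three cases always occurs.) For distinct $D,D'\in\mathcal{D}$, the type $T(D,D')$ is: $\beta^{21}$ if $t(Q,D')=\beta$ for all $Q\in D$; $\gamma^{21}$ if $t(Q,D')=\gamma$ for all $Q\in D$; $\alpha^{15}\gamma^{6}$ if $t(Q,D')=\alpha$ for $15$ conics $Q\in D$ and $\gamma$ for the other $6$; $\alpha^{3}\gamma^{18}$ if $t(Q,D')=\alpha$ for $3$ conics $Q\in D$ and $\gamma$ for the other $18$.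 (One of these four cases always occurs, and $T(D,D')=T(D',D)$.) *)

(* Defs.v *)
From HB Require Import structures.
From mathcomp Require Export all_boot all_order all_algebra fraction.
From mathcomp Require Export mathcomp_extra boolp classical_sets functions.
From mathcomp Require Export cardinality.
From mathcomp Require Export mpoly.
From Stdlib Require Export Relation_Operators.

Set Implicit Arguments.
Unset Strict Implicit.
Unset Printing Implicit Defensive.

Import GRing.Theory.
Local Open Scope ring_scope.
Local Open Scope classical_set_scope.
Local Open Scope card_scope.

(** * The projective plane *)

(* A point of P^2(k) is a line through the origin of k^3. *)
Definition point (k : fieldType) : Type :=
  {V : {vspace 'rV[k]_3} | \dim V == 1%N}.

(* Homogeneous coordinates of P, for one fixed choice of representative. They
   are only ever used to test the vanishing of forms, which does not depend on
   that choice. *)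
Definition coords (k : fieldType) (P : point k) : 'I_3 -> k :=
  fun i => vpick (val P) 0 i.

(* A plane curve is given by its equation, a ternary form. *)
Definition zeros (k : fieldType) (F : {mpoly k[3]}) : set (point k) :=
  [set P | F.@[coords P] = 0].

Definition line (k : fieldType) (L : set (point k)) : Prop :=
  exists l : {mpoly k[3]}, [/\ l \is 1.-homog, l != 0 & L = zeros l].

Definition nonsingular (k : fieldType) (F : {mpoly k[3]}) : Prop :=
  forall P : point k, zeros F P -> exists i : 'I_3, F^`M(i).@[coords P] != 0.

(* The tangent line of F at P; this is the zero form if P is singular. *)
Definition tangent_form (k : fieldType) (F : {mpoly k[3]}) (P : point k) :
    {mpoly k[3]} :=
  \sum_(i < 3) F^`M(i).@[coords P] *: 'X_i.

(** * Intersection multiplicities *)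

(* The local ring O_P of P^2 at P, inside the fraction field of k[x, y, z]. *)
Definition local_ring (k : fieldType) (P : point k) :
    set {fraction {mpoly k[3]}} :=
  [set x | exists (d : nat) (h u : {mpoly k[3]}),
     [/\ h \is d.-homog, u \is d.-homog, u.@[coords P] != 0
       & x = tofrac h / tofrac u]].

(* The ideal of O_P generated by the local equation F / s of the curve F = 0,
   where s is any form of the same degree with s(P) != 0. *)
Definition local_ideal (k : fieldType) (F : {mpoly k[3]}) (P : point k) :
    set {fraction {mpoly k[3]}} :=
  [set x | exists (d : nat) (a u : {mpoly k[3]}),
     [/\ F * a \is d.-homog, u \is d.-homog, u.@[coords P] != 0
       & x = tofrac (F * a) / tofrac u]].

(* i_P(F, G) = n, that is, dim_k O_P / (F, G) = n: the classes of b_0, ...,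
   b_(n-1) form a k-basis of the quotient. *)
Definition has_intersection_mult (k : fieldType) (F G : {mpoly k[3]})
    (P : point k) (n : nat) : Prop :=
  exists b : 'I_n -> {fraction {mpoly k[3]}},
    (forall i, local_ring P (b i)) /\
    (forall x, local_ring P x ->
       exists! c : 'rV[k]_n,
         exists y z, [/\ local_ideal F P y, local_ideal G P z
           & x - \sum_(i < n) tofrac (c 0 i)%:MP * b i = y + z]).

(** * Hermitian curves, special secant lines, totally tangent conics *)

Definition fermat_sextic (k : fieldType) : {mpoly k[3]} :=
  \sum_(i < 3) 'X_i ^+ 6.

Definition linear_subst (k : fieldType) (g : 'M[k]_3) (F : {mpoly k[3]}) :
    {mpoly k[3]} :=
  F \mPo [tuple \sum_(j < 3) g i j *: 'X_j | i < 3].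

Definition hermitian_curve (k : fieldType) (F : {mpoly k[3]}) : Prop :=
  exists (c : k) (g : 'M[k]_3),
    [/\ c != 0, g \in unitmx & F = c *: linear_subst g (fermat_sextic k)].

Definition weierstrass_points (k : fieldType) (F : {mpoly k[3]}) :
    set (point k) :=
  [set P | zeros F P /\ has_intersection_mult (tangent_form F P) F P 6].

Definition special_secant (k : fieldType) (F : {mpoly k[3]})
    (L : set (point k)) : Prop :=
  line L /\
  exists P P' : point k,
    [/\ P <> P', weierstrass_points F P, weierstrass_points F P', L P & L P'].

(* The conics themselves are handled as sets of points. *)
Definition totally_tangent_conics (k : fieldType) (F : {mpoly k[3]}) :
    set (set (point k)) :=
  [set Q | exists q : {mpoly k[3]},
     [/\ q \is 2.-homog, nonsingular q, Q = zeros q,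
         Q `&` zeros F #= `I_6
       & forall P, (Q `&` zeros F) P -> has_intersection_mult q F P 2]].

Definition secants_of (k : fieldType) (F : {mpoly k[3]}) (Q : set (point k)) :
    set (set (point k)) :=
  [set L | special_secant F L /\
     exists P P' : point k,
       [/\ P <> P', (Q `&` zeros F) P, (Q `&` zeros F) P', L P & L P']].

(** * Connected components of a graph *)

(* The vertex set is V; only the edges joining two elements of V count. *)
Definition connected_in (T : Type) (V : set T) (adj : T -> T -> Prop) :
    T -> T -> Prop :=
  clos_refl_sym_trans T (fun x y => [/\ V x, V y & adj x y]).

Definition components (T : Type) (V : set T) (adj : T -> T -> Prop) :
    set (set T) :=
  [set C | exists2 x, V x & C = [set y | connected_in V adj x y]].

Definition same_component (T : Type) (V : set T) (adj : T -> T -> Prop)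
    (x y : T) : Prop :=
  exists2 C, components V adj C & C x /\ C y.

(** * The graph G and the types t and T *)

Definition adjG (k : fieldType) (F : {mpoly k[3]}) (Q Q' : set (point k)) :
    Prop :=
  [/\ Q <> Q', Q `&` Q' #= `I_4
    & secants_of F Q `&` secants_of F Q' #= `I_3].

Definition componentsG (k : fieldType) (F : {mpoly k[3]}) :
    set (set (set (point k))) :=
  components (totally_tangent_conics F) (adjG F).

Inductive conic_type := alpha | beta | gamma.

(* The n-th entry is the number of conics Q' of D' such that
   |Q `&` Q' `&` Gamma| = n. *)
Definition value_counts (t : conic_type) : seq nat :=
  match t with
  | alpha => [:: 18; 0; 3]%N
  | beta => [:: 16; 4; 1]%N
  | gamma => [:: 15; 6; 0]%N
  end.

(* t(Q, D') = t; counting over all n makes every other value excluded. *)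
Definition has_conic_type (k : fieldType) (F : {mpoly k[3]})
    (Q : set (point k)) (D' : set (set (point k))) (t : conic_type) : Prop :=
  forall n : nat,
    [set Q' | D' Q' /\ Q `&` Q' `&` zeros F #= `I_n]
      #= `I_(nth 0%N (value_counts t) n).

Inductive component_type := beta21 | gamma21 | alpha15gamma6 | alpha3gamma18.

(* T(D, D') splits as alpha^m gamma^n. *)
Definition splits_alpha_gamma (k : fieldType) (F : {mpoly k[3]})
    (D D' : set (set (point k))) (m n : nat) : Prop :=
  [/\ [set Q | D Q /\ has_conic_type F Q D' alpha] #= `I_m,
      [set Q | D Q /\ has_conic_type F Q D' gamma] #= `I_n
    & forall Q, D Q ->
        has_conic_type F Q D' alpha \/ has_conic_type F Q D' gamma].

(* T(D, D') = t. *)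
Definition has_component_type (k : fieldType) (F : {mpoly k[3]})
    (D D' : set (set (point k))) (t : component_type) : Prop :=
  match t with
  | beta21 => forall Q, D Q -> has_conic_type F Q D' beta
  | gamma21 => forall Q, D Q -> has_conic_type F Q D' gamma
  | alpha15gamma6 => splits_alpha_gamma F D D' 15 6
  | alpha3gamma18 => splits_alpha_gamma F D D' 3 18
  end.

Definition adjH (k : fieldType) (F : {mpoly k[3]})
    (D D' : set (set (point k))) : Prop :=
  D <> D' /\ has_component_type F D D' alpha15gamma6.

(* Main.v *)
(** In a suitable basis (a frame) the equation of Gamma is
    [x z^5 - 2 y^6 + z x^5]. A totally tangent conic can be written
    [y^2 = x z] with two of its six tangency points at [(1, 0, 0)] and
    [(0, 0, 1)]; the restriction of the sextic to it is then a square whose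
    exponents have the form [i + 5 j], which forces it to be a multiple of
    [(t^5 + h t)^2], so that every such conic is the standard conic of a frame.
    Two frames differ by a unitary matrix, whose entries lie in F_25, and
    everything becomes a finite computation: the connected component of a conic
    in G consists of its 21 images under a Frobenius group, and modulo the
    stabilizer of a component only a short list of upper triangular unitary
    matrices [X] remains. If [X] carries the frame of [D] to that of [D'], then
    [T(D, D')] is [gamma^21] or [alpha^15 gamma^6] (or [D = D']) exactly when
    [det X ^ 2 = 1]. So the squared determinant of a frame is constant on the
    connected components of H; conversely, in the case [gamma^21] the vertices
    [D] and [D'] have a common neighbour in H. *)

(* Multiplicities are given as dimensions of quotients of local rings, which nothing below computes
   directly. They are read off parametrizations: if a conic or a line is traced by polynomials, its
   multiplicity with a sextic at the point t = 0 is the order at 0 of the restricted sextic, and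
   every point of interest is brought to t = 0 by a projectivity of the curve. The list of upper
   triangular matrices is short because 21 * 6 = 126: the conics of one component together pass
   through all the Weierstrass points, so the stabilizer of the component moves any of them to (0,
   0, 1), and a unitary matrix fixing a point also fixes the tangent there. The determinant has to
   be squared: a unitary scalar e satisfies e^6 = 1 and changes the frame but not the conic, while
   its determinant e^3 may be -1. The squared determinant is 1 on all the elements of the stabilizer
   that are used, so it is constant on the double cosets of X, and it suffices to inspect
   representatives. *)
From HB Require Import structures.
Require Import Defs.
From mathcomp Require Import ring lra zify.
Import GRing.Theory.
Set Implicit Arguments.
Unset Strict Implicit.
Unset Printing Implicit Defensive.
Local Open Scope ring_scope.
Local Open Scope classical_set_scope.
Local Open Scope card_scope.

(** * Forms restricted to rational curves *)

Section Forms.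
Variable k : fieldType.
Implicit Types (h q : {mpoly k[3]}) (v w : 'rV[k]_3) (B : 'M[k]_3).

Lemma dhomog_ind d (P : {mpoly k[3]} -> Prop) :
  P 0 -> (forall (c : k) m p, mdeg m = d -> P p -> P (c *: 'X_[m] + p)) ->
  forall p, p \is d.-homog -> P p.
Proof.
move=> P0 PS p /dhomogP hp; rewrite (mpolyE p).
elim: (msupp p) hp => [_|m s IHs hp]; first by rewrite big_nil.
rewrite big_cons; apply: PS; first by apply: hp; rewrite inE eqxx.
by apply: IHs => m' sm'; apply: hp; rewrite inE sm' orbT.
Qed.

(* [par a h] is the restriction [h(a(t))] of [h] to the curve traced by [a]. *)
Definition par (a : 'I_3 -> {poly k}) (h : {mpoly k[3]}) : {poly k} :=
  mmap polyC a h.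

HB.instance Definition _ a := GRing.RMorphism.copy (par a) (mmap polyC a).

Lemma parZ a (c : k) h : par a (c *: h) = c *: par a h.
Proof. by rewrite /par mmapZ mul_polyC. Qed.

Lemma parX a i : par a 'X_i = a i.
Proof. by rewrite /par mmapX mmap1U. Qed.

Lemma par_horner a h t : (par a h).[t] = h.@[fun i => (a i).[t]].
Proof.
rewrite /par /mmap mevalE horner_sum; apply: eq_bigr => m _.
rewrite hornerCM /mmap1 horner_prod; congr (_ * _).
by apply: eq_bigr => i _; rewrite horner_exp.
Qed.

(** The indices are transposed with respect to [linear_subst]: points are row vectors, and
    evaluation at [v] becomes evaluation at [v *m B]. *)
Definition subst B h : {mpoly k[3]} :=
  h \mPo [tuple \sum_(j < 3) B j i *: 'X_j | i < 3].

HB.instance Definition _ B := GRing.RMorphism.copy (subst B) (comp_mpoly _).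

Lemma substZ B (c : k) h : subst B (c *: h) = c *: subst B h.
Proof. exact: comp_mpolyZ. Qed.

Lemma substX B i : subst B 'X_i = \sum_(j < 3) B j i *: 'X_j.
Proof. by rewrite /subst comp_mpolyXU -tnth_nth tnth_mktuple. Qed.

Lemma rmorph_mpoly_ext (S : comNzRingType) (f g : {rmorphism {mpoly k[3]} -> S}) :
  (forall c, f c%:MP = g c%:MP) -> (forall i, f 'X_i = g 'X_i) -> f =1 g.
Proof.
move=> fgC fgX; elim/mpolyind=> [|c m p _ _ IHp]; first by rewrite !rmorph0.
rewrite !rmorphD IHp -mul_mpolyC !rmorphM fgC mpolyXE_id !rmorph_prod.
by congr (_ * _ + _); apply: eq_bigr => i _; rewrite !rmorphXn fgX.
Qed.

Lemma substC B c : subst B c%:MP = c%:MP.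
Proof. exact: comp_mpolyC. Qed.

Lemma substM B B' h : subst B (subst B' h) = subst (B *m B') h.
Proof.
pose f : {rmorphism {mpoly k[3]} -> {mpoly k[3]}} := (subst B \o subst B').
apply: (@rmorph_mpoly_ext _ f (subst (B *m B'))) => [c|i] /=.
  by rewrite !substC.
rewrite !substX (raddf_sum (subst B)) /=.
transitivity (\sum_(j < 3) \sum_(l < 3) B' j i *: (B l j *: 'X_l) : {mpoly k[3]}).
  by apply: eq_bigr => j _; rewrite substZ substX scaler_sumr.
rewrite exchange_big /=; apply: eq_bigr => j _.
rewrite mxE scaler_suml; apply: eq_bigr => l _.
by rewrite scalerA mulrC.
Qed.

Lemma subst1 h : subst 1%:M h = h.
Proof.
apply: (@rmorph_mpoly_ext _ (subst 1%:M) idfun) => [c|i] /=; first exact: substC.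
rewrite substX (bigD1 i) //= mxE eqxx scale1r big1 ?addr0 // => j /negbTE ji.
by rewrite mxE ji scale0r.
Qed.

Lemma subst_meval B h v : (subst B h).@[v 0] = h.@[(v *m B) 0].
Proof.
rewrite comp_mpoly_meval; apply: meval_eq => i; rewrite tnth_mktuple raddf_sum mxE.
by apply: eq_bigr => j _ /=; rewrite mevalZ mevalXU mulrC.
Qed.

Lemma subst_homog B d h : h \is d.-homog -> subst B h \is d.-homog.
Proof.
move: h; apply: dhomog_ind => [|c m p md IHp]; first by rewrite rmorph0 rpred0.
rewrite rmorphD /= substZ rpredD // rpredZ // mpolyXE_id rmorph_prod.
have X1 i e : (subst B 'X_i) ^+ e \is e.-homog.
  rewrite -{2}[e]mul1n; apply: dhomogMn; rewrite substX rpred_sum // => j _.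
  by rewrite rpredZ // dhomogX /= mdeg1.
rewrite -md mdegE !big_ord_recl !big_ord0.
by do 3 ![apply: dhomogM; first by rewrite rmorphXn; apply: X1]; apply: dhomog1.
Qed.

Definition apar (a : 'I_3 -> {poly k}) B : 'I_3 -> {poly k} :=
  fun i => \sum_(j < 3) B j i *: a j.

Lemma par_subst a B h : par a (subst B h) = par (apar a B) h.
Proof.
pose f : {rmorphism {mpoly k[3]} -> {poly k}} := (par a \o subst B).
apply: (@rmorph_mpoly_ext _ f (par (apar a B))) => [c|i] /=.
  by rewrite substC /par !mmapC.
rewrite substX raddf_sum parX; apply: eq_bigr => j _.
by rewrite /= parZ parX.
Qed.

Lemma meval_homogZ d h c v : h \is d.-homog -> h.@[(c *: v) 0] = c ^+ d * h.@[v 0].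
Proof.
move: h; apply: dhomog_ind => [|b m p md IHp]; first by rewrite !raddf0 mulr0.
rewrite !raddfD /= !mevalZ IHp mulrDr; congr (_ + _).
rewrite !mevalX mulrCA; congr (_ * _).
under eq_bigr => i _ do rewrite mxE exprMn.
by rewrite big_split /= prodrXr -md mdegE.
Qed.

(* The curve [q = 0] of degree [e] is traced by [t |-> a(t)]. *)
Definition traces (e : nat) (q : {mpoly k[3]}) (a : 'I_3 -> {poly k}) : Prop :=
  [/\ forall d h, h \is d.-homog -> (size (par a h) <= (e * d).+1)%N,
      forall d h, h \is d.-homog -> par a h = 0 -> exists C, h = q * C,
      par a q = 0
    & forall d (p : {poly k}), (size p <= (e * d).+1)%N ->
        exists2 h, h \is d.-homog & par a h = p].

(* Normal forms modulo [q]: a form is determined up to [(q)] by its restriction. *)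
Lemma tracesI e q a (N : nat -> nat -> {mpoly k[3]}) :
  par a q = 0 -> (forall i, size (a i) <= e.+1)%N ->
  (forall d j, j <= e * d -> N d j \is d.-homog /\ par a (N d j) = 'X^j)%N ->
  (forall m, exists C, 'X_[m] = q * C \/ exists2 j, (j <= e * mdeg m)%N &
      'X_[m] = q * C + N (mdeg m) j) ->
  traces e q a.
Proof.
move=> aq sa NP XP.
have S d h : h \is d.-homog -> (size (par a h) <= (e * d).+1)%N.
  move: h; apply: dhomog_ind => [|c m p md IHp]; first by rewrite rmorph0 size_poly0.
  rewrite rmorphD /= parZ (leq_trans (size_polyD _ _)) // geq_max IHp andbT.
  rewrite (leq_trans (size_scale_leq _ _)) // -md; case: (XP m) => C [->|[j jm ->]].
    by rewrite rmorphM /= aq mul0r size_poly0.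
  rewrite rmorphD rmorphM /= aq mul0r add0r.
  by have [_ ->] := NP _ _ jm; rewrite size_polyXn.
have NF d h : h \is d.-homog ->
    exists C, h = q * C + \sum_(j < (e * d).+1) (par a h)`_j *: N d j.
  move: h; apply: dhomog_ind => [|c m p md [C pE]].
    by exists 0; rewrite mulr0 add0r big1 // => j _; rewrite rmorph0 coef0 scale0r.
  rewrite rmorphD /= parZ.
  under eq_bigr => j _ do rewrite coefD scalerDl.
  rewrite big_split /=.
  case: (XP m) => C' [mE|[j jm mE]].
    exists (c *: C' + C); rewrite mulrDr -scalerAr -mE addrACA -pE; congr (_ + _).
    rewrite mE rmorphM /= aq mul0r scaler0 big1 ?addr0 // => j _.
    by rewrite coef0 scale0r.
  exists (c *: C' + C); rewrite mulrDr -scalerAr addrACA -pE; congr (_ + _).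
  rewrite mE rmorphD rmorphM /= aq mul0r add0r scalerDr; congr (_ + _).
  have [_ ->] := NP _ _ jm; rewrite -md.
  have jm' : (j < (e * mdeg m).+1)%N by [].
  rewrite (bigD1 (Ordinal jm')) //= coefZ coefXn eqxx mulr1 big1 ?addr0 // => i.
  rewrite -val_eqE /= => /negbTE ij.
  by rewrite coefZ coefXn ij mulr0 scale0r.
split=> // [d h hh h0|d p sp].
  have [C hE] := NF _ _ hh; exists C.
  rewrite {1}hE h0 big1 ?addr0 // => j _; by rewrite coef0 scale0r.
exists (\sum_(j < (e * d).+1) p`_j *: N d j).
  by apply: rpred_sum => j _; rewrite rpredZ //; case: (NP d j (leq_ord j)).
rewrite raddf_sum /= -[RHS](coefK p) poly_def (big_ord_widen _ (fun i => p`_i *: 'X^i) sp).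
rewrite [RHS]big_mkcond; apply: eq_bigr => j _.
have [_ NE] := NP d j (leq_ord j).
by rewrite parZ NE; case: ltnP => // /(nth_default 0) ->; rewrite scale0r.
Qed.

Lemma traces_subst e q a B : B \in unitmx ->
  traces e q a -> traces e (subst (invmx B) q) (apar a B).
Proof.
move=> uB [S0 K0 q0 R0]; split=> [d h hh|d h hh|| d p sp].
- by rewrite -par_subst S0 // subst_homog.
- rewrite -par_subst => h0.
  have [C hC] := K0 _ _ (subst_homog B hh) h0.
  exists (subst (invmx B) C); rewrite -[RHS]rmorphM -hC /= substM.
  by rewrite mulVmx // subst1.
- by rewrite -par_subst substM mulmxV // subst1.
- have [h hh <-] := R0 d p sp; exists (subst (invmx B) h); first exact: subst_homog.
  by rewrite -par_subst substM mulmxV // subst1.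
Qed.

End Forms.

Definition o0 : 'I_3 := @Ordinal 3 0 isT.
Definition o1 : 'I_3 := @Ordinal 3 1 isT.
Definition o2 : 'I_3 := @Ordinal 3 2 isT.

Lemma big_ord3 (R : Type) (idx : R) (op : Monoid.law idx) (F : 'I_3 -> R) :
  \big[op/idx]_(i < 3) F i = op (F o0) (op (F o1) (F o2)).
Proof.
rewrite !big_ord_recl big_ord0 Monoid.mulm1.
by congr (op (F _) (op (F _) (F _))); apply: val_inj.
Qed.

Lemma ord3P (P : 'I_3 -> Prop) : P o0 -> P o1 -> P o2 -> forall i, P i.
Proof.
move=> P0 P1 P2 [[|[|[|i]]] // ilt].
- by rewrite (_ : Ordinal ilt = o0) //; apply: val_inj.
- by rewrite (_ : Ordinal ilt = o1) //; apply: val_inj.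
- by rewrite (_ : Ordinal ilt = o2) //; apply: val_inj.
Qed.

(** * Parametrizations of the standard conic and of its tangent line *)

Section Standard.
Variable k : fieldType.

Definition qconic : {mpoly k[3]} := 'X_o1 ^+ 2 - 'X_o0 * 'X_o2.
(** The conic as (1, t, t^2); the point (0, 0, 1) is its t = infinity. *)
Definition aconic (i : 'I_3) : {poly k} := 'X^i.
(** The line x_0 = 0 as (0, t, 1), so that t = 0 is the point (0, 0, 1). *)
Definition aline (i : 'I_3) : {poly k} := if i == o1 then 'X else (i == o2)%:R.

Lemma mpolyX3 (m : 'X_{1..3}) :
  'X_[m] = 'X_o0 ^+ m o0 * ('X_o1 ^+ m o1 * 'X_o2 ^+ m o2) :> {mpoly k[3]}.
Proof. by rewrite mpolyXE_id big_ord3. Qed.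

Lemma homogX3 a b c d : (a + (b + c))%N = d ->
  'X_o0 ^+ a * ('X_o1 ^+ b * 'X_o2 ^+ c) \is [in k[3], d.-homog].
Proof.
have X1 i e : 'X_i ^+ e \is [in k[3], e.-homog].
  by rewrite -{2}[e]mul1n; apply: dhomogMn; rewrite dhomogX /= mdeg1.
by move=> <-; do 2 ![apply: dhomogM; first exact: X1].
Qed.

Lemma qconic_homog : qconic \is 2.-homog.
Proof.
rewrite /qconic rpredB //.
  by have /= := @homogX3 0 2 0 2 erefl; rewrite !expr0 mul1r mulr1.
by have /= := @homogX3 1 0 1 2 erefl; rewrite !expr0 mul1r.
Qed.

(** Modulo y^2 - x z every monomial reduces to one with y-exponent at most 1, and in degree d
    exactly one of these restricts to t^j, for each j from 0 to 2 d. *)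
Lemma traces_conic : traces 2 qconic aconic.
Proof.
pose N (d j : nat) : {mpoly k[3]} :=
  'X_o0 ^+ (d - uphalf j) * ('X_o1 ^+ odd j * 'X_o2 ^+ j./2).
have aq : par aconic qconic = 0.
  by rewrite /qconic rmorphB rmorphXn rmorphM /= !parX /aconic -exprM mul1r subrr.
apply: (tracesI (N := N)) => //.
- by move=> i; rewrite /aconic size_polyXn.
- move=> d j jd; split.
    by apply: homogX3; rewrite uphalf_half; lia.
  rewrite /N !rmorphM !rmorphXn /= !parX /aconic expr0 expr1n mul1r -!exprM -exprD.
  by congr ('X ^+ _); rewrite /o1 /o2 /=; lia.
move=> m; pose j := (m o1 + 2 * m o2)%N.
(* The sum is the quotient of (y^2)^n - (x z)^n by y^2 - x z, with n half the exponent of y. *)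
exists ('X_o0 ^+ m o0 * ('X_o1 ^+ odd (m o1) * 'X_o2 ^+ m o2) *
   \sum_(i < (m o1)./2) ('X_o1 ^+ 2) ^+ ((m o1)./2.-1 - i) * ('X_o0 * 'X_o2) ^+ i).
right; exists j; first by rewrite mdegE big_ord3 /j /=; lia.
rewrite mulrCA -subrXX mpolyX3 /N mdegE big_ord3 /=.
have -> : uphalf j = (uphalf (m o1) + m o2)%N by rewrite /j; lia.
have -> : odd j = odd (m o1) by rewrite /j; lia.
have -> : j./2 = ((m o1)./2 + m o2)%N by rewrite /j; lia.
have -> : (m o0 + (m o1 + m o2) - (uphalf (m o1) + m o2) = m o0 + (m o1)./2)%N by lia.
rewrite -[X in 'X_o1 ^+ X * 'X_o2 ^+ m o2](odd_double_half (m o1)) -mul2n.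
rewrite exprD (exprM _ 2) [('X_o0 * 'X_o2) ^+ _]exprMn (exprD _ (m o0)) (exprD 'X_o2).
ring.
Qed.

Lemma traces_line : traces 1 'X_o0 aline.
Proof.
pose N (d j : nat) : {mpoly k[3]} :=
  'X_o0 ^+ 0 * ('X_o1 ^+ j * 'X_o2 ^+ (d - j)).
apply: (tracesI (N := N)); first by rewrite parX.
- by apply: ord3P; rewrite /aline /= ?size_poly0 ?size_polyX ?size_poly1.
- move=> d j jd; split; first by apply: homogX3; lia.
  by rewrite /N !rmorphM !rmorphXn /= !parX /aline /= expr0 mul1r expr1n mulr1.
move=> m; rewrite mdegE big_ord3 mpolyX3 /N /=.
case: (m o0) => [|n].
  exists 0; right; exists (m o1); first by lia.
  by rewrite mulr0 !expr0 !mul1r add0r add0n addKn.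
by exists ('X_o0 ^+ n * ('X_o1 ^+ m o1 * 'X_o2 ^+ m o2)); left; rewrite exprS !mulrA.
Qed.

End Standard.

(** * Intersection multiplicities along a traced curve *)

Section Mult.
Variable k : fieldType.
Implicit Types (F q : {mpoly k[3]}) (P : point k).
Local Notation frac := {fraction {mpoly k[3]}}.

Definition scal (c : k) : frac := tofrac c%:MP.

Lemma scalD c d : scal (c + d) = scal c + scal d.
Proof. by rewrite /scal mpolyCD tofracD. Qed.

Lemma scalM c d : scal (c * d) = scal c * scal d.
Proof. by rewrite /scal mpolyCM tofracM. Qed.

Lemma scal0 : scal 0 = 0. Proof. by rewrite /scal mpolyC0 tofrac0. Qed.

Lemma scal1 : scal 1 = 1. Proof. by rewrite /scal mpolyC1 tofrac1. Qed.

Lemma scal_sum n (c : 'I_n -> k) : scal (\sum_i c i) = \sum_i scal (c i).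
Proof. by elim/big_rec2: _ => [|i x y _ <-]; rewrite ?scal0 ?scalD. Qed.

Lemma tofrac_neq0 (u : {mpoly k[3]}) P : u.@[coords P] != 0 -> tofrac u != 0.
Proof. by apply: contraNneq => /eqP; rewrite tofrac_eq0 => /eqP ->; rewrite meval0. Qed.

Lemma local_ideal_lin F P c x y :
  local_ideal F P x -> local_ideal F P y -> local_ideal F P (scal c * x + y).
Proof.
move=> [d [a [u [ha hu uP ->]]]] [d' [a' [u' [ha' hu' uP' ->]]]].
exists (d + d')%N, (c *: a * u' + a' * u), (u * u').
split.
- rewrite mulrDr !mulrA -scalerAr -scalerAl rpredD // ?rpredZ //.
    exact: dhomogM.
  by rewrite addnC; apply: dhomogM.
- exact: dhomogM.
- by rewrite mevalM mulf_neq0.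
have u0 := tofrac_neq0 uP; have u0' := tofrac_neq0 uP'.
rewrite mulrA addf_div; [|exact: u0|exact: u0'].
rewrite /scal -!tofracM -tofracD; congr (tofrac _ / tofrac _).
by rewrite -mul_mpolyC; ring.
Qed.

Lemma local_ideal0 F P : local_ideal F P 0.
Proof.
exists 0%N, 0, 1; rewrite mulr0 rpred0 dhomog1 meval1 oner_neq0 tofrac0 mul0r.
by split.
Qed.

Definition local_sum q F P (x : frac) :=
  exists y z, [/\ local_ideal q P y, local_ideal F P z & x = y + z].

Lemma local_sum_lin q F P c x y :
  local_sum q F P x -> local_sum q F P y -> local_sum q F P (scal c * x + y).
Proof.
move=> [a [b [qa Fb ->]]] [a' [b' [qa' Fb' ->]]].
exists (scal c * a + a'), (scal c * b + b').
by split; rewrite ?mulrDr 1?addrACA //; apply: local_ideal_lin.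
Qed.

Lemma local_sum0 q F P : local_sum q F P 0.
Proof. by exists 0, 0; split; rewrite ?addr0 //; apply: local_ideal0. Qed.

Lemma local_sum_sum q F P n (c : 'I_n -> k) (x : 'I_n -> frac) :
  (forall i, local_sum q F P (x i)) -> local_sum q F P (\sum_i scal (c i) * x i).
Proof.
move=> hx; elim/big_ind: _ => [|y z hy hz|i _]; first exact: local_sum0.
  by rewrite -[y]mul1r -scal1; apply: local_sum_lin.
by rewrite -[_ * _]addr0; apply: local_sum_lin => //; apply: local_sum0.
Qed.

(** Each family is expressed in the other modulo (q, F); by uniqueness of coordinates the two
    matrices have product 1, so the n x m one has a right inverse. *)
Lemma intersection_mult_le q F P n m :
  has_intersection_mult q F P n -> has_intersection_mult q F P m -> (n <= m)%N.
Proof.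
move=> [b [Ob bP]] [b' [Ob' b'P]].
have /fin_all_exists[C CP] i : exists c : 'rV[k]_m,
    local_sum q F P (b i - \sum_j scal (c 0 j) * b' j).
  by have [c [cP _]] := b'P _ (Ob i); exists c.
have /fin_all_exists[C' C'P] j : exists c : 'rV[k]_n,
    local_sum q F P (b' j - \sum_i scal (c 0 i) * b i).
  by have [c [cP _]] := bP _ (Ob' j); exists c.
pose M : 'M[k]_(n, m) := \matrix_(i, j) C i 0 j.
pose M' : 'M[k]_(m, n) := \matrix_(j, i) C' j 0 i.
suff MM' : M *m M' = 1%:M by apply: (mulmx1_min MM').
apply/row_matrixP => i.
have [c [_ cU]] := bP _ (Ob i).
rewrite -(cU (row i (M *m M'))) ?(cU (row i 1%:M)) //.
  have [y [z [hy hz E]]] := local_sum0 q F P; exists y, z; split=> //; rewrite -E.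
  rewrite (bigD1 i) //= big1 => [|j /negbTE ji]; last first.
    by rewrite !mxE eq_sym ji -[tofrac _]/(scal 0) scal0 mul0r.
  by rewrite !mxE eqxx -[tofrac _]/(scal 1) scal1 mul1r addr0 subrr.
have : local_sum q F P (scal 1 * (b i - \sum_j scal (C i 0 j) * b' j) +
   \sum_j scal (C i 0 j) * (b' j - \sum_l scal (C' j 0 l) * b l)).
  by apply: local_sum_lin => //; apply: local_sum_sum.
move=> [y [z [hy hz E]]]; exists y, z; split=> //; rewrite -E scal1 mul1r.
under [X in _ = _ + X]eq_bigr => j _ do rewrite mulrBr.
rewrite [X in _ = _ + X]big_split /= addrA subrK; congr (_ + _).
rewrite sumrN; congr (- _).
under [RHS]eq_bigr => j _ do rewrite mulr_sumr.
rewrite exchange_big /=; apply: eq_bigr => l _.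
rewrite !mxE -/(scal _) scal_sum mulr_suml; apply: eq_bigr => j _.
by rewrite !mxE scalM mulrA.
Qed.

Lemma intersection_mult_uniq q F P n m :
  has_intersection_mult q F P n -> has_intersection_mult q F P m -> n = m.
Proof. by move=> hn hm; apply/eqP; rewrite eqn_leq !(intersection_mult_le (q:=q) (F:=F) (P:=P)). Qed.

(** Division of p by the unit r of k[[t]], cut off at order n. *)
Lemma trunc_divp (p r : {poly k}) n : r.[0] != 0 ->
  exists c w : {poly k}, (size c <= n)%N /\ p = r * c + 'X^n * w.
Proof.
move=> r0; elim: n => [|n [c [w [sc pE]]]].
  by exists 0, p; rewrite size_poly0 mulr0 add0r mul1r.
pose a := w.[0] / r.[0].
have : root (w - a *: r) 0.
  by rewrite /root hornerD hornerN hornerZ divfK // subrr.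
move/factor_theorem => [w']; rewrite subr0 => wE.
exists (c + a *: 'X^n), w'; split.
  rewrite (leq_trans (size_polyD _ _)) // geq_max (leq_trans sc) //=.
  by rewrite (leq_trans (size_scale_leq _ _)) // size_polyXn.
rewrite pE -[w](subrK (a *: r)) wE exprSr -!mul_polyC.
ring.
Qed.

Lemma size_XnM_le (w : {poly k}) n : (size w <= size ('X^n * w)%R)%N.
Proof.
have [->|w0] := eqVneq w 0; first by rewrite mulr0.
by rewrite size_monicM ?monicXn // size_polyXn leq_addl.
Qed.

Section Traced.
Variables (e : nat) (q F : {mpoly k[3]}) (a : 'I_3 -> {poly k}) (dF : nat).
Variables (P : point k) (c0 : k) (n : nat) (g : {poly k}).
Hypotheses (e0 : (0 < e)%N) (tqa : traces e q a) (hF : F \is dF.-homog).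
Hypotheses (c00 : c0 != 0) (aP : forall i, (a i).[0] = c0 * coords P i).
Hypotheses (FE : par a F = 'X^n * g) (g0 : g.[0] != 0).

Lemma par0_coords d (h : {mpoly k[3]}) : h \is d.-homog ->
  (par a h).[0] = c0 ^+ d * h.@[coords P].
Proof.
move=> hh; rewrite -(meval_homogZ c0 (vpick (val P)) hh) par_horner.
by apply: meval_eq => i; rewrite mxE aP.
Qed.

Lemma par0_neq0 d (h : {mpoly k[3]}) : h \is d.-homog ->
  ((par a h).[0] != 0) = (h.@[coords P] != 0).
Proof. by move=> hh; rewrite (par0_coords hh) mulf_eq0 expf_eq0 (negbTE c00) andbF. Qed.

(* The fractions vanishing to order [n] along [a] at [t = 0]. *)
Let J (x : frac) := exists (N D : {mpoly k[3]}) (w : {poly k}),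
  [/\ (par a D).[0] != 0, par a N = 'X^n * w & x = tofrac N / tofrac D].

Let par0_frac (D : {mpoly k[3]}) : (par a D).[0] != 0 -> tofrac D != 0.
Proof.
by apply: contraNneq => /eqP; rewrite tofrac_eq0 => /eqP ->; rewrite rmorph0 horner0.
Qed.

Let JD x y : J x -> J y -> J (x + y).
Proof.
move=> [N [D [w [D0 NE ->]]]] [N' [D' [w' [D0' NE' ->]]]].
exists (N * D' + N' * D), (D * D'), (w * par a D' + w' * par a D); split.
- by rewrite rmorphM /= hornerM mulf_neq0.
- by rewrite rmorphD !rmorphM /= NE NE' mulrDr !mulrA.
- by rewrite addf_div ?par0_frac // tofracD !tofracM.
Qed.

Let JN x : J x -> J (- x).
Proof.
move=> [N [D [w [D0 NE ->]]]]; exists (- N), D, (- w).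
by rewrite rmorphN /= NE mulrN tofracN mulNr.
Qed.

Let J_local_sum x : local_sum q F P x -> J x.
Proof.
have [_ _ aq _] := tqa.
move=> [y [z [[d [b [u [hb hu uP ->]]]] [d' [b' [u' [hb' hu' uP' ->]]]] ->]]].
apply: JD.
  exists (q * b), u, 0; rewrite (par0_neq0 hu) uP rmorphM /= aq mul0r mulr0.
  by split.
exists (F * b'), u', (g * par a b').
by rewrite (par0_neq0 hu') uP' rmorphM /= FE mulrA.
Qed.

(** The linear forms [l0] and [l1] restrict to 1 and t, so the powers of l1 / l0 below n should be a
    basis of the quotient, as the powers of t are one of k[t] / (t^n). *)
Lemma traces_mult : has_intersection_mult q F P n.
Proof.
have [Sz K _ R] := tqa.
have [l0 hl0 l0E] : exists2 l, l \is 1.-homog & par a l = 1.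
  by apply: R; rewrite size_poly1.
have [l1 hl1 l1E] : exists2 l, l \is 1.-homog & par a l = 'X.
  by apply: R; rewrite size_polyX muln1.
have hl i : l0 ^+ i \is i.-homog /\ l1 ^+ i \is i.-homog.
  by split; rewrite -{2}[i]mul1n; apply: dhomogMn.
have l0i i : (par a (l0 ^+ i)).[0] != 0.
  by rewrite rmorphXn /= l0E expr1n hornerC oner_neq0.
pose lin (c : 'rV[k]_n) := \sum_(i < n) c 0 i *: (l1 ^+ i * l0 ^+ (n - i)).
have lin_homog c : lin c \is n.-homog.
  apply: rpred_sum => i _; rewrite rpredZ //.
  by have := dhomogM (hl i).2 (hl (n - i)%N).1; rewrite subnKC // ltnW.
have lin_par c : par a (lin c) = \poly_(i < n) (if insub i is Some j then c 0 j else 0).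
  rewrite /lin raddf_sum poly_def; apply: eq_bigr => i _ /=.
  by rewrite parZ rmorphM !rmorphXn /= l0E l1E expr1n mulr1 valK.
pose b (i : 'I_n) : frac := tofrac (l1 ^+ i) / tofrac (l0 ^+ i).
have bE (c : 'rV[k]_n) : \sum_(i < n) tofrac (c 0 i)%:MP * b i = tofrac (lin c) / tofrac (l0 ^+ n).
  rewrite /lin raddf_sum mulr_suml; apply: eq_bigr => i _ /=.
  rewrite -mul_mpolyC !tofracM -!mulrA; congr (_ * (_ * _)).
  have -> : l0 ^+ n = l0 ^+ (n - i) * l0 ^+ i by rewrite -exprD subnK // ltnW.
  by rewrite tofracM invfM mulrA mulfV ?mul1r // par0_frac.
exists b; split=> [i|x].
  exists (i : nat), (l1 ^+ i), (l0 ^+ i); split.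
  - exact: (hl i).2.
  - exact: (hl i).1.
  - by rewrite -(par0_neq0 (hl i).1).
  exact: erefl.
move=> [d [h [u [hh hu uP ->]]]].
have u0 : (par a u).[0] != 0 by rewrite (par0_neq0 hu).
have [p [w [sp pE]]] := trunc_divp (par a h) n u0.
pose c : 'rV[k]_n := \row_i p`_i.
have cE : par a (lin c) = p.
  rewrite lin_par; apply/polyP => i; rewrite coef_poly.
  case: ltnP => [ltin|/(leq_trans sp)/(nth_default 0)->//].
  by rewrite insubT mxE.
have cP : local_sum q F P (tofrac h / tofrac u - \sum_(i < n) tofrac (c 0 i)%:MP * b i).
  rewrite bE.
  pose h' := h * l0 ^+ n - u * lin c.
  have hh' : h' \is (d + n).-homog.
    exact: (rpredB (dhomogM hh (hl n).1) (dhomogM hu (lin_homog c))).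
  have h'E : par a h' = 'X^n * w.
    by rewrite rmorphB !rmorphM /= cE rmorphXn /= l0E expr1n mulr1 pE addrC addKr.
  (* [A] and [B] lift [w] and [g]. Then h' B - F A restricts to 0, so it is a multiple of q, and [B]
     does not vanish at P: this puts h' in the ideal (q, F) of the local ring. *)
  have [B hB BE] : exists2 B, B \is dF.-homog & par a B = g.
    apply: R; apply: leq_trans (Sz _ _ hF); rewrite FE; exact: size_XnM_le.
  have [A hA AE] : exists2 A, A \is (d + n).-homog & par a A = w.
    apply: R; apply: leq_trans (Sz _ _ hh'); rewrite h'E; exact: size_XnM_le.
  have hq : h' * B - F * A \is (d + n + dF).-homog.
    by apply: rpredB; [apply: dhomogM | rewrite addnC; apply: dhomogM].
  have [C CE] : exists C, h' * B - F * A = q * C.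
    apply: (K _ _ hq); rewrite rmorphB !rmorphM /= FE BE AE h'E.
    by rewrite -!mulrA [g * w]mulrC subrr.
  have hv : u * l0 ^+ n * B \is (d + n + dF).-homog by exact: (dhomogM (dhomogM hu (hl n).1) hB).
  have v0 : (par a (u * l0 ^+ n * B)).[0] != 0.
    by rewrite !rmorphM /= !hornerM BE !mulf_neq0.
  have vP : (u * l0 ^+ n * B).@[coords P] != 0 by rewrite -(par0_neq0 hv).
  exists (tofrac (q * C) / tofrac (u * l0 ^+ n * B)), (tofrac (F * A) / tofrac (u * l0 ^+ n * B)).
  split; first by exists (d + n + dF)%N, C, (u * l0 ^+ n * B); split=> //; rewrite -CE.
    by exists (d + n + dF)%N, A, (u * l0 ^+ n * B); split=> //; rewrite addnC; apply: dhomogM.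
  rewrite -mulrDl -tofracD -CE subrK.
  have B0 : tofrac B != 0 by apply: par0_frac; rewrite BE.
  rewrite !tofracM -mulf_div divff // mulr1 -mulNr addf_div ?par0_frac // -tofracN -!tofracM -tofracD.
  by rewrite mulNr [lin c * u]mulrC tofracM.
(* For uniqueness, the difference of two solutions vanishes to order n along the curve, whereas
   [lin (c' - c)] restricts to a polynomial of degree less than n. *)
exists c; split=> [|c' /J_local_sum /JN Jc']; first exact: cP.
have [N [D [w' [D0 NE E]]]] := JD (J_local_sum cP) Jc'.
have {}E : lin (c' - c) * D = N * l0 ^+ n.
  apply/eqP; rewrite -tofrac_eq !tofracM -eqr_div ?par0_frac // -E -bE.
  have -> (y s s' : frac) : y - s - (y - s') = s' - s by ring.
  rewrite -sumrB; apply/eqP/eq_bigr => i _.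
  by rewrite -mulrBl !mxE mpolyCB tofracB.
have {}E : par a (lin (c' - c)) * par a D = 'X^n * w'.
  by rewrite -NE -rmorphM /= E rmorphM rmorphXn /= l0E expr1n mulr1.
have : 'X^n %| par a (lin (c' - c)).
  rewrite -(@Gauss_dvdpl _ _ (par a D)) ?E ?dvdp_mulr //.
  by rewrite coprimep_expl // coprimep_sym -['X]subr0 coprimep_XsubC.
have [l0' _|l0'] := eqVneq (par a (lin (c' - c))) 0; last first.
  by move/(dvdp_leq l0'); rewrite size_polyXn lin_par ltnNge size_poly.
apply/esym/rowP => i; apply/eqP; rewrite -subr_eq0; apply/eqP.
have := congr1 (fun p : {poly k} => p`_i) l0'.
by rewrite lin_par coef_poly ltn_ord valK coef0 !mxE.
Qed.
End Traced.
End Mult.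

(** * Points and quadratic and Hermitian forms in coordinates *)

Section Points.
Variable k : fieldType.
Implicit Types (P : point k) (v w : 'rV[k]_3).

Definition rv P : 'rV[k]_3 := vpick (val P).

Lemma rv_neq0 P : rv P != 0.
Proof.
by rewrite /rv vpick0; apply/negP => /eqP P0; have := valP P; rewrite P0 dimv0.
Qed.

Lemma pt_subproof v : \dim <[if v == 0%R then delta_mx 0%R 0%R else v]>%VS == 1%N.
Proof.
rewrite dim_vline; case: ifP => [_|->//].
have -> // : delta_mx 0 0 != 0 :> 'rV[k]_3.
by apply/eqP => /rowP/(_ 0)/eqP; rewrite !mxE oner_eq0.
Qed.

(* The point of homogeneous coordinates [v]; a junk point if [v = 0]. *)
Definition pt v : point k :=
  exist (fun V : {vspace 'rV[k]_3} => \dim V == 1%N) _ (pt_subproof v).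

Lemma val_pt v : v != 0 -> val (pt v) = <[v]>%VS.
Proof. by rewrite /pt /= => /negbTE ->. Qed.

Lemma pt_rv P : pt (rv P) = P.
Proof.
apply: val_inj; rewrite val_pt ?rv_neq0 //; apply/eqP.
rewrite eqEdim dim_vline rv_neq0 (eqP (valP P)) andbT.
by rewrite -memvE memv_pick.
Qed.

Lemma rv_pt v : v != 0 -> exists2 c, c != 0 & rv (pt v) = c *: v.
Proof.
move=> v0; have := memv_pick (val (pt v)); rewrite {2}val_pt // -/(rv _).
move/vlineP => [c E]; exists c => //.
by apply: contraNneq (rv_neq0 (pt v)) => c0; rewrite E c0 scale0r.
Qed.

Lemma ptZ c v : c != 0 -> v != 0 -> pt (c *: v) = pt v.
Proof.
move=> c0 v0; apply: val_inj; rewrite !val_pt ?scaler_eq0 ?negb_or ?c0 //.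
by apply/eqP; rewrite eqEdim !dim_vline scaler_eq0 negb_or c0 v0 -memvE memvZ ?memv_line.
Qed.

Lemma pt_inj v w : v != 0 -> w != 0 -> pt v = pt w -> exists2 c, c != 0 & v = c *: w.
Proof.
move=> v0 w0 E; have [c c0 cE] := rv_pt v0; have [d d0 dE] := rv_pt w0.
exists (c^-1 * d); first by rewrite mulf_neq0 ?invr_eq0.
by rewrite -scalerA -dE -E cE scalerA mulVf // scale1r.
Qed.

Lemma coordsE P : coords P = (rv P) 0.
Proof. by []. Qed.

Lemma zeros_pt d (h : {mpoly k[3]}) v :
  h \is d.-homog -> v != 0 -> zeros h (pt v) <-> h.@[v 0] = 0.
Proof.
move=> hh v0; rewrite /zeros /= coordsE; have [c c0 ->] := rv_pt v0.
rewrite (meval_homogZ _ _ hh); split=> [/eqP|->]; last by rewrite mulr0.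
by rewrite mulf_eq0 expf_eq0 (negbTE c0) andbF => /eqP.
Qed.

Definition vec3 (a b c : k) : 'rV[k]_3 :=
  \row_i (if i == o0 then a else if i == o1 then b else c).

Lemma vec3E v : v = vec3 (v 0 o0) (v 0 o1) (v 0 o2).
Proof. by apply/rowP; apply: ord3P; rewrite mxE. Qed.

Lemma vec3_0 a b c : vec3 a b c 0 o0 = a. Proof. by rewrite mxE. Qed.
Lemma vec3_1 a b c : vec3 a b c 0 o1 = b. Proof. by rewrite mxE. Qed.
Lemma vec3_2 a b c : vec3 a b c 0 o2 = c. Proof. by rewrite mxE. Qed.

Lemma vec3_eq0 a b c : (vec3 a b c == 0) = [&& a == 0, b == 0 & c == 0].
Proof.
apply/eqP/and3P=> [/rowP E|[/eqP-> /eqP-> /eqP->]].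
  by split; apply/eqP; [move: (E o0)|move: (E o1)|move: (E o2)]; rewrite !mxE.
by apply/rowP; apply: ord3P; rewrite !mxE.
Qed.

Lemma scale_vec3 d a b c : d *: vec3 a b c = vec3 (d * a) (d * b) (d * c).
Proof. by apply/rowP; apply: ord3P; rewrite !mxE. Qed.

Definition mat3 (r0 r1 r2 : 'rV[k]_3) : 'M[k]_3 :=
  \matrix_(i, j) (if i == o0 then r0 0 j else if i == o1 then r1 0 j else r2 0 j).

Lemma row_mat3_0 r0 r1 r2 : row o0 (mat3 r0 r1 r2) = r0.
Proof. by apply/rowP => j; rewrite !mxE. Qed.
Lemma row_mat3_1 r0 r1 r2 : row o1 (mat3 r0 r1 r2) = r1.
Proof. by apply/rowP => j; rewrite !mxE. Qed.
Lemma row_mat3_2 r0 r1 r2 : row o2 (mat3 r0 r1 r2) = r2.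
Proof. by apply/rowP => j; rewrite !mxE. Qed.

Lemma mat3E (A : 'M[k]_3) : A = mat3 (row o0 A) (row o1 A) (row o2 A).
Proof. by apply/matrixP; apply: ord3P => j; rewrite !mxE. Qed.

Lemma mulmx3 (v : 'rV[k]_3) (A : 'M[k]_3) :
  v *m A = v 0 o0 *: row o0 A + v 0 o1 *: row o1 A + v 0 o2 *: row o2 A.
Proof. by apply/rowP => j; rewrite !mxE big_ord3 /= addrA. Qed.

Lemma mulmx3E (A B : 'M[k]_3) i j :
  (A *m B) i j = A i o0 * B o0 j + (A i o1 * B o1 j + A i o2 * B o2 j).
Proof. by rewrite mxE big_ord3. Qed.

End Points.

Section Char5.
Variable k : closedFieldType.
Hypothesis char_k : 5%N \in [pchar k].
Implicit Types (v w : 'rV[k]_3) (A B E H S X : 'M[k]_3).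

Lemma natr5 : (5%:R : k) = 0. Proof. exact: pcharf0. Qed.

Lemma two_neq0 : (2%:R : k) != 0.
Proof. by rewrite -(dvdn_pcharf char_k). Qed.

Definition frob : {rmorphism k -> k} := pFrobenius_aut char_k.
Lemma frobE x : frob x = x ^+ 5. Proof. by []. Qed.

Definition quadric S : {mpoly k[3]} := \sum_(i < 3) \sum_(j < 3) S i j *: ('X_i * 'X_j).
Definition hermitian H : {mpoly k[3]} := \sum_(i < 3) \sum_(j < 3) H i j *: ('X_i * 'X_j ^+ 5).

Lemma mpoly_char : 5%N \in [pchar {mpoly k[3]}].
Proof. by rewrite inE /= -mpolyC_nat natr5 mpolyC0 eqxx. Qed.

(** Fifth powers are additive, so the second factor of x_i x_j^5 transforms by the Frobenius of [B]
    and the form behaves like a sesquilinear one. *)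
Lemma subst_hermitian B H :
  subst B (hermitian H) = hermitian (B *m H *m (map_mx frob B)^T).
Proof.
pose Fr : {rmorphism {mpoly k[3]} -> {mpoly k[3]}} := pFrobenius_aut mpoly_char.
have FrZ (c : k) p : Fr (c *: p) = frob c *: Fr p.
  rewrite -!mul_mpolyC rmorphM /=; congr (_ * _).
  by rewrite /Fr /= !pFrobenius_autE rmorphXn.
have X5 j : subst B ('X_j ^+ 5) = \sum_l frob (B l j) *: 'X_l ^+ 5.
  rewrite rmorphXn /= substX -[LHS]/(Fr _) raddf_sum; apply: eq_bigr => l _.
  exact: FrZ.
have E i j : subst B (H i j *: ('X_i * 'X_j ^+ 5)) =
    \sum_l \sum_m (B l i * H i j * frob (B m j)) *: ('X_l * 'X_m ^+ 5).
  rewrite substZ rmorphM /= X5 substX mulr_suml scaler_sumr; apply: eq_bigr => l _.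
  rewrite mulr_sumr scaler_sumr; apply: eq_bigr => m _.
  by rewrite -scalerAl -scalerAr !scalerA; congr (_ *: _); ring.
rewrite /hermitian (raddf_sum (subst B)) /=.
transitivity (\sum_i \sum_j \sum_l \sum_m
    (B l i * H i j * frob (B m j)) *: ('X_l * 'X_m ^+ 5 : {mpoly k[3]})).
  by apply: eq_bigr => i _; rewrite (raddf_sum (subst B)) /=; apply: eq_bigr => j _; apply: E.
transitivity (\sum_i \sum_l \sum_m \sum_j
    (B l i * H i j * frob (B m j)) *: ('X_l * 'X_m ^+ 5 : {mpoly k[3]})).
  apply: eq_bigr => i _; rewrite exchange_big; apply: eq_bigr => l _.
  exact: exchange_big.
rewrite exchange_big; apply: eq_bigr => l _.
rewrite exchange_big; apply: eq_bigr => m _ /=.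
rewrite !mxE scaler_suml exchange_big /=; apply: eq_bigr => j _.
by rewrite !mxE mulr_suml scaler_suml.
Qed.

Lemma subst_quadric B S : subst B (quadric S) = quadric (B *m S *m B^T).
Proof.
have E i j : subst B (S i j *: ('X_i * 'X_j)) =
    \sum_l \sum_m (B l i * S i j * B m j) *: ('X_l * 'X_m).
  rewrite substZ rmorphM /= !substX mulr_suml scaler_sumr; apply: eq_bigr => l _.
  rewrite mulr_sumr scaler_sumr; apply: eq_bigr => m _.
  by rewrite -scalerAl -scalerAr !scalerA; congr (_ *: _); ring.
rewrite /quadric (raddf_sum (subst B)) /=.
transitivity (\sum_i \sum_j \sum_l \sum_m
    (B l i * S i j * B m j) *: ('X_l * 'X_m : {mpoly k[3]})).
  by apply: eq_bigr => i _; rewrite (raddf_sum (subst B)) /=; apply: eq_bigr => j _; apply: E.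
transitivity (\sum_i \sum_l \sum_m \sum_j
    (B l i * S i j * B m j) *: ('X_l * 'X_m : {mpoly k[3]})).
  apply: eq_bigr => i _; rewrite exchange_big; apply: eq_bigr => l _.
  exact: exchange_big.
rewrite exchange_big; apply: eq_bigr => l _.
rewrite exchange_big; apply: eq_bigr => m _ /=.
rewrite !mxE scaler_suml exchange_big /=; apply: eq_bigr => j _.
by rewrite !mxE mulr_suml scaler_suml.
Qed.

Lemma par_hermitian (a : 'I_3 -> {poly k}) H :
  par a (hermitian H) = \sum_i \sum_j H i j *: (a i * a j ^+ 5).
Proof.
rewrite (raddf_sum (par a)); apply: eq_bigr => i _.
rewrite (raddf_sum (par a)); apply: eq_bigr => j _ /=.
by rewrite parZ rmorphM rmorphXn /= !parX.
Qed.

Lemma meval_hermitian H v :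
  (hermitian H).@[v 0] = \sum_i \sum_j H i j * (v 0 i * v 0 j ^+ 5).
Proof.
rewrite raddf_sum; apply: eq_bigr => i _.
rewrite raddf_sum; apply: eq_bigr => j _ /=.
by rewrite mevalZ mevalM rmorphXn /= !mevalXU.
Qed.

Lemma meval_quadric S v :
  (quadric S).@[v 0] = \sum_i \sum_j S i j * (v 0 i * v 0 j).
Proof.
rewrite raddf_sum; apply: eq_bigr => i _.
rewrite raddf_sum; apply: eq_bigr => j _ /=.
by rewrite mevalZ mevalM !mevalXU.
Qed.

Lemma quadric_homog S : quadric S \is 2.-homog.
Proof.
rewrite !rpred_sum // => i _; rewrite rpred_sum // => j _; rewrite rpredZ //.
by apply: (@dhomogM _ _ _ 1 _ 1); rewrite dhomogX /= mdeg1.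
Qed.

Lemma hermitian_homog H : hermitian H \is 6.-homog.
Proof.
rewrite !rpred_sum // => i _; rewrite rpred_sum // => j _; rewrite rpredZ //.
apply: (@dhomogM _ _ _ 1 _ 5); first by rewrite dhomogX /= mdeg1.
by rewrite -[5%N]mul1n; apply: dhomogMn; rewrite dhomogX /= mdeg1.
Qed.

Lemma fermatE : fermat_sextic k = hermitian 1%:M.
Proof.
apply: eq_bigr => i _; rewrite (bigD1 i) //= big1 => [|j /negbTE ji].
  by rewrite mxE eqxx scale1r addr0 -exprS.
by rewrite mxE eq_sym ji scale0r.
Qed.

Definition gram E := E *m (map_mx frob E)^T.

(* Scaling [g] by a sixth root absorbs the constant factor. *)
Lemma hermitian_curveE F : hermitian_curve F ->
  exists2 g : 'M[k]_3, g \in unitmx & F = hermitian (gram g).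
Proof.
move=> [c [g [c0 ug ->]]].
have [x xE] := @solve_monicpoly k 6 (fun i => if i == 0%N then c else 0) isT.
have {}xE : x ^+ 6 = c.
  by rewrite xE big_ord_recl big1 => [|i _]; rewrite /= ?mul0r // expr0 mulr1 addr0.
have x0 : x != 0 by apply: contraNneq c0 => x0; rewrite -xE x0 expr0n.
exists (x *: g^T); first by rewrite unitmxZ ?unitmx_tr // unitfE.
have -> : linear_subst g (fermat_sextic k) = subst g^T (fermat_sextic k).
  rewrite /linear_subst /subst; congr (_ \mPo _); apply: eq_mktuple => i.
  by apply: eq_bigr => j _; rewrite mxE.
rewrite fermatE subst_hermitian mulmx1 -/(gram _).
rewrite /hermitian scaler_sumr; apply: eq_bigr => i _.
rewrite scaler_sumr; apply: eq_bigr => j _; rewrite scalerA; congr (_ *: _).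
rewrite -xE /gram map_mxZ /= -scalemxAl linearZ /= -scalemxAr scalerA.
by rewrite [RHS]mxE exprS.
Qed.

End Char5.

(** * Frames *)

Section Frames.
Variable k : closedFieldType.
Hypothesis char_k : 5%N \in [pchar k].
Implicit Types (v w : 'rV[k]_3) (A B E H S X : 'M[k]_3) (P : point k).
Local Notation frob := (frob char_k).
Local Notation gram := (gram char_k).

(** The entry -2 is chosen so that on (1, t, t^2) the form becomes t^10 - 2 t^6 + t^2 = (t^5 - t)^2:
    the tangency points are t in F_5 and t = infinity. *)
Definition H0 : 'M[k]_3 := mat3 (vec3 0 0 1) (vec3 0 (-2%:R) 0) (vec3 1 0 0).

(* [2 = -1/2], so that [quadric Cq = x_1^2 - x_0 x_2]. *)
Definition Cq : 'M[k]_3 := mat3 (vec3 0 0 2%:R) (vec3 0 1 0) (vec3 2%:R 0 0).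

(** On the points (1, s, s^2) of the conic, [wmat] acts as s -> 1 / s and [tmat t] below as s -> s +
    t. *)
Definition wmat : 'M[k]_3 := mat3 (vec3 0 0 1) (vec3 0 1 0) (vec3 1 0 0).

Definition tmat (t : k) : 'M[k]_3 :=
  mat3 (vec3 1 t (t ^+ 2)) (vec3 0 1 (2%:R * t)) (vec3 0 0 1).

Definition dmat (a b c : k) : 'M[k]_3 := mat3 (vec3 a 0 0) (vec3 0 b 0) (vec3 0 0 c).

Definition is_unitary X := X *m H0 *m (map_mx frob X)^T = H0.

Definition qsim X := exists2 c, c != 0 & X *m Cq *m X^T = c *: Cq.

(* The conic [y^2 = x z] in the basis formed by the rows of [B]. *)
Definition conic B : set (point k) := zeros (subst (invmx B) (qconic k)).

Lemma mul5r (x : k) : 5%:R * x = 0.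
Proof. by rewrite natr5 // mul0r. Qed.

(** Makes [ring], which ignores the characteristic, usable for identities modulo 5: z is the
    difference of the two sides divided by 5 over the integers. *)
Lemma eq_mod5 (x y z : k) : x - y = 5%:R * z -> x = y.
Proof. by move=> E; apply/eqP; rewrite -subr_eq0 E mul5r. Qed.

Lemma qconicE : qconic k = quadric Cq.
Proof.
rewrite /qconic /quadric !big_ord3 /=.
rewrite !mxE /= !scale0r !scale1r !add0r !addr0 -expr2 addrCA; congr (_ + _).
have e : (2%:R + 2%:R : k) = -1.
  by apply/eqP; rewrite -subr_eq0 opprK -natrD natr1 natr5.
by rewrite ['X_o2 * _]mulrC -scalerDl e scaleN1r.
Qed.

Lemma qconic_eval v : (qconic k).@[v 0] = v 0 o1 ^+ 2 - v 0 o0 * v 0 o2.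
Proof. by rewrite /qconic mevalB !expr2 !mevalM !mevalXU. Qed.

Lemma det_mat3 (a b c d e f g h i : k) :
  \det (mat3 (vec3 a b c) (vec3 d e f) (vec3 g h i)) =
  a * (e * i - f * h) - b * (d * i - f * g) + c * (d * h - e * g).
Proof.
rewrite (expand_det_row _ o0) big_ord3 /= /cofactor.
have det2 (A : 'M[k]_2) : \det A = A 0 0 * A 1 1 - A 0 1 * A 1 0.
  rewrite (expand_det_row _ 0) !big_ord_recl big_ord0 /cofactor !det_mx11 !mxE /=.
  rewrite addr0 expr0 mul1r expr1 mulN1r mulrN.
  by congr (A _ _ * A _ _ - A _ _ * A _ _); apply: val_inj.
rewrite !det2 !mxE /=; ring.
Qed.

Lemma mulmx_mat3 (a b c d e f g h i x y z : k) :
  vec3 x y z *m mat3 (vec3 a b c) (vec3 d e f) (vec3 g h i) =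
  vec3 (x * a + y * d + z * g) (x * b + y * e + z * h) (x * c + y * f + z * i).
Proof.
by apply/rowP; apply: ord3P; rewrite !mxE big_ord3 !mxE /= addrA.
Qed.

Lemma mat3_mul (r0 r1 r2 : 'rV[k]_3) A :
  mat3 r0 r1 r2 *m A = mat3 (r0 *m A) (r1 *m A) (r2 *m A).
Proof. by apply/matrixP; apply: ord3P => j; rewrite !mxE; apply: eq_bigr => l _; rewrite !mxE. Qed.

Lemma tr_mat3 (a b c d e f g h i : k) :
  (mat3 (vec3 a b c) (vec3 d e f) (vec3 g h i))^T =
  mat3 (vec3 a d g) (vec3 b e h) (vec3 c f i).
Proof. by apply/matrixP; apply: ord3P; apply: ord3P; rewrite !mxE. Qed.

Lemma map_mat3 (fm : k -> k) (a b c d e f g h i : k) :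
  map_mx fm (mat3 (vec3 a b c) (vec3 d e f) (vec3 g h i)) =
  mat3 (vec3 (fm a) (fm b) (fm c)) (vec3 (fm d) (fm e) (fm f)) (vec3 (fm g) (fm h) (fm i)).
Proof. by apply/matrixP; apply: ord3P; apply: ord3P; rewrite !mxE. Qed.

Lemma scale_mat3 (s : k) (r0 r1 r2 : 'rV[k]_3) :
  s *: mat3 r0 r1 r2 = mat3 (s *: r0) (s *: r1) (s *: r2).
Proof. by apply/matrixP; apply: ord3P => j; rewrite !mxE. Qed.

Lemma mat3_congr (a b c d e f g h i a' b' c' d' e' f' g' h' i' : k) :
  [/\ a = a', b = b' & c = c'] -> [/\ d = d', e = e' & f = f'] ->
  [/\ g = g', h = h' & i = i'] ->
  mat3 (vec3 a b c) (vec3 d e f) (vec3 g h i) =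
  mat3 (vec3 a' b' c') (vec3 d' e' f') (vec3 g' h' i').
Proof. by move=> [-> -> ->] [-> -> ->] [-> -> ->]. Qed.

Definition mat3S := (mat3_mul, mulmx_mat3, tr_mat3, map_mat3, scale_mat3, scale_vec3).

Lemma unit_H0 : H0 \in unitmx.
Proof.
rewrite unitmxE det_mat3 unitfE.
have -> : forall x : k, 0 * (- x * 0 - 0 * 0) - 0 * (0 * 0 - 0 * 1) +
    1 * (0 * 0 - - x * 1) = x by move=> x; ring.
exact: two_neq0.
Qed.

Lemma unit_Cq : Cq \in unitmx.
Proof.
rewrite unitmxE det_mat3 unitfE.
have -> : forall x : k, 0 * (1 * 0 - 0 * 0) - 0 * (0 * 0 - 0 * x) +
    x * (0 * 0 - 1 * x) = - (x * x) by move=> x; ring.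
by rewrite oppr_eq0 mulf_neq0 // two_neq0.
Qed.

Lemma unitary_unit X : is_unitary X -> X \in unitmx.
Proof.
move=> uX; have := unit_H0; rewrite -uX !unitmx_mul => /andP[/andP[]] //.
Qed.

Lemma unitaryM X Y : is_unitary X -> is_unitary Y -> is_unitary (X *m Y).
Proof.
move=> uX uY; rewrite /is_unitary map_mxM trmx_mul !mulmxA.
by rewrite -(mulmxA X) -(mulmxA X) uY.
Qed.

Lemma qsim_unit X : qsim X -> X \in unitmx.
Proof.
move=> [c c0 E]; have : c *: Cq \in unitmx by rewrite unitmxZ ?unit_Cq ?unitfE.
by rewrite -E !unitmx_mul => /andP[/andP[]].
Qed.

Lemma unitary_wmat : is_unitary wmat.
Proof. by rewrite /is_unitary /H0 /wmat !mat3S /=; apply: mat3_congr; split; rewrite ?rmorph0 ?rmorph1; ring. Qed.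

Lemma qsim_wmat : qsim wmat.
Proof.
exists 1; first exact: oner_neq0.
by rewrite /Cq /wmat !mat3S; apply: mat3_congr; split; ring.
Qed.

Lemma unitary_tmat t : t ^+ 5 = t -> is_unitary (tmat t).
Proof.
move=> t5; rewrite /is_unitary /H0 /tmat !mat3S /= ?(rmorphXn, rmorphM) /= ?rmorph_nat ?rmorph0 ?rmorph1 !frobE t5.
by apply: mat3_congr; split; ring.
Qed.

Lemma qsim_tmat t : qsim (tmat t).
Proof.
exists 1; first exact: oner_neq0.
rewrite /Cq /tmat !mat3S; apply: mat3_congr; split; try ring.
- by apply: (@eq_mod5 _ _ (t ^+ 2)); ring.
- by apply: (@eq_mod5 _ _ t); ring.
- by apply: (@eq_mod5 _ _ t); ring.
Qed.

Lemma qsim_dmat a b c : b != 0 -> a * c = b ^+ 2 -> qsim (dmat a b c).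
Proof.
move=> b0 E; exists (b ^+ 2); first by rewrite expf_neq0.
have E' : c * a = b ^+ 2 by rewrite mulrC.
rewrite /Cq /dmat !mat3S; apply: mat3_congr; split; try ring.
- by rewrite -E; ring.
- by rewrite -E; ring.
Qed.

Lemma qsimM X Y : qsim X -> qsim Y -> qsim (X *m Y).
Proof.
move=> [c c0 cE] [d d0 dE]; exists (d * c); first by rewrite mulf_neq0.
rewrite trmx_mul !mulmxA -(mulmxA X) -(mulmxA X) dE.
by rewrite -scalemxAr -scalemxAl cE scalerA.
Qed.

Lemma qsimV X : qsim X -> qsim (invmx X).
Proof.
move=> qX; have uX := qsim_unit qX; have [c c0 cE] := qX.
exists c^-1; first by rewrite invr_eq0.
have : invmx X *m (X *m Cq *m X^T) *m (invmx X)^T = Cq.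
  rewrite -!mulmxA -trmx_mul mulVmx // trmx1 mulmx1 mulKmx //.
rewrite cE -scalemxAr -scalemxAl => {2}<-.
by rewrite scalerA mulVf // scale1r.
Qed.

Lemma quadricZ c S : quadric (c *: S) = c *: quadric S.
Proof.
rewrite /quadric scaler_sumr; apply: eq_bigr => i _; rewrite scaler_sumr.
by apply: eq_bigr => j _; rewrite mxE scalerA.
Qed.

Lemma traces_scale c e q (a : 'I_3 -> {poly k}) : c != 0 -> traces e q a -> traces e (c *: q) a.
Proof.
move=> c0 [S0 K0 q0 R0]; split=> // [d h hh /(K0 _ _ hh) [C ->]|].
  by exists (c^-1 *: C); rewrite -scalerAl -scalerAr scalerA mulfV // scale1r.
by rewrite parZ q0 scaler0.
Qed.

Lemma qsim_eval X v : qsim X ->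
  (qconic k).@[(v *m X) 0] = 0 <-> (qconic k).@[v 0] = 0.
Proof.
move=> [c c0 cE]; rewrite -subst_meval qconicE subst_quadric cE !meval_quadric.
have -> : \sum_i \sum_j (c *: Cq) i j * (v 0 i * v 0 j) =
    c * \sum_i \sum_j Cq i j * (v 0 i * v 0 j).
  rewrite mulr_sumr; apply: eq_bigr => i _; rewrite mulr_sumr.
  by apply: eq_bigr => j _; rewrite [(c *: Cq) i j]mxE -mulrA.
by split=> [/eqP|->]; rewrite ?mulr0 // mulf_eq0 (negbTE c0) => /eqP.
Qed.

Lemma conicE B P : B \in unitmx ->
  conic B P <-> (qconic k).@[(rv P *m invmx B) 0] = 0.
Proof. by move=> uB; rewrite /conic /zeros /= coordsE subst_meval. Qed.

Lemma conic_qsim B X : B \in unitmx -> qsim X -> conic (X *m B) = conic B.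
Proof.
move=> uB qX; have uX := qsim_unit qX.
have uXB : X *m B \in unitmx by rewrite unitmx_mul uX.
apply/seteqP; split=> P; rewrite !conicE // => H.
  have -> : invmx B = invmx (X *m B) *m X.
    by rewrite -[LHS]mul1mx -(mulVmx uXB) -!mulmxA mulmxV // mulmx1.
  by rewrite mulmxA qsim_eval.
move: H; have -> : invmx B = invmx (X *m B) *m X.
  by rewrite -[LHS]mul1mx -(mulVmx uXB) -!mulmxA mulmxV // mulmx1.
by rewrite mulmxA qsim_eval.
Qed.

Lemma conic_pt B v : B \in unitmx -> v != 0 ->
  conic B (pt (v *m B)) <-> v 0 o1 ^+ 2 = v 0 o0 * v 0 o2.
Proof.
move=> uB v0; have vB0 : v *m B != 0.
  by apply: contraNneq v0 => /(congr1 (mulmx^~ (invmx B))); rewrite mulmxK // mul0mx => ->.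
rewrite /conic (@zeros_pt _ 2) // ?subst_homog ?qconic_homog //.
rewrite subst_meval mulmxK // qconic_eval.
by split=> [/eqP|->]; rewrite ?subrr // subr_eq0 => /eqP.
Qed.

Lemma mulmx_unit_neq0 B v : B \in unitmx -> v != 0 -> v *m B != 0.
Proof.
move=> uB; apply: contraNneq => /(congr1 (mulmx^~ (invmx B))).
by rewrite mulmxK // mul0mx => ->.
Qed.

Lemma pt_frame B P : B \in unitmx -> exists2 v, v != 0 & P = pt (v *m B).
Proof.
move=> uB; exists (rv P *m invmx B); last by rewrite mulmxKV // pt_rv.
by rewrite mulmx_unit_neq0 ?unitmx_inv ?rv_neq0.
Qed.

Section Frame.
Variable G : 'M[k]_3.
Let F := hermitian G.

(* In the basis formed by the rows of [B] the curve is [x z^5 - 2 y^6 + z x^5 = 0]. *)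
Definition is_frame B := B *m G *m (map_mx frob B)^T = H0.

Lemma frame_unit B : is_frame B -> B \in unitmx.
Proof.
by move=> fB; have := unit_H0; rewrite -fB !unitmx_mul => /andP[/andP[]].
Qed.

Lemma frameM X B : is_unitary X -> is_frame B -> is_frame (X *m B).
Proof.
move=> uX fB; rewrite /is_frame map_mxM trmx_mul !mulmxA.
by rewrite -(mulmxA X) -(mulmxA X) fB.
Qed.

Lemma frame_subst B : is_frame B -> subst B F = hermitian H0.
Proof. by move=> fB; rewrite (subst_hermitian char_k) fB. Qed.

Lemma H0_sum (S : lmodType k) (f : 'I_3 -> 'I_3 -> S) :
  \sum_i \sum_j H0 i j *: f i j = f o0 o2 - 2%:R *: f o1 o1 + f o2 o0.
Proof.
by rewrite !big_ord3 /= !mxE /= !scale0r !scale1r !addr0 !add0r scaleNr addrA.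
Qed.

Lemma herm_pt B v : is_frame B -> v != 0 ->
  zeros F (pt (v *m B)) <->
  v 0 o0 * v 0 o2 ^+ 5 - 2%:R * v 0 o1 ^+ 6 + v 0 o2 * v 0 o0 ^+ 5 = 0.
Proof.
move=> fB v0; have uB := frame_unit fB.
rewrite (@zeros_pt _ 6) ?hermitian_homog ?mulmx_unit_neq0 //.
rewrite -subst_meval frame_subst // meval_hermitian.
have -> : \sum_i \sum_j H0 i j * (v 0 i * v 0 j ^+ 5) =
    v 0 o0 * v 0 o2 ^+ 5 - 2%:R * v 0 o1 ^+ 6 + v 0 o2 * v 0 o0 ^+ 5; last by [].
rewrite (@H0_sum k^o (fun i j => v 0 i * v 0 j ^+ 5)).
by rewrite -exprS.
Qed.

Lemma traces_mult_pt e q (a : 'I_3 -> {poly k}) dF (F' : {mpoly k[3]}) v n g :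
  (0 < e)%N -> traces e q a -> F' \is dF.-homog -> v != 0 ->
  (forall i, (a i).[0] = v 0 i) -> par a F' = 'X^n * g -> g.[0] != 0 ->
  has_intersection_mult q F' (pt v) n.
Proof.
move=> e0 tr hF v0 av Fa g0; have [c c0 cE] := rv_pt v0.
apply: (traces_mult (c0 := c^-1) e0 tr hF _ _ Fa g0); first by rewrite invr_eq0.
by move=> i; rewrite coordsE cE mxE mulKf.
Qed.

Lemma apar0 (a : 'I_3 -> {poly k}) B v : (forall i, (a i).[0] = v 0 i) ->
  forall i, (apar a B i).[0] = (v *m B) 0 i.
Proof.
move=> av i; rewrite /apar horner_sum mxE; apply: eq_bigr => j _.
by rewrite hornerZ av mulrC.
Qed.

Lemma subst_qsim B X : B \in unitmx -> qsim X -> exists2 c, c != 0 &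
  subst (invmx B) (qconic k) = c *: subst (invmx (X *m B)) (qconic k).
Proof.
move=> uB qX; have uXB : X *m B \in unitmx by rewrite unitmx_mul qsim_unit.
have [c c0 cE] := qX; exists c => //.
have -> : invmx B = invmx (X *m B) *m X.
  by rewrite -[LHS]mul1mx -(mulVmx uXB) -!mulmxA mulmxV // mulmx1.
by rewrite -substM qconicE (subst_quadric X) cE quadricZ substZ.
Qed.

(** The point (0, 0, 1) is at t = infinity; [wmat] brings it to t = 0, where the restriction t^2
    (t^4 - 1)^2 has order 2. *)
Lemma frame_conic_mult B c : is_frame B -> c != 0 ->
  has_intersection_mult (c *: subst (invmx B) (qconic k)) F (pt (vec3 0 0 1 *m B)) 2.
Proof.
move=> fB0 c0; have uB0 := frame_unit fB0.
have fB := frameM unitary_wmat fB0; have uB := frame_unit fB.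
have e0B : vec3 0 0 1 *m B = vec3 1 0 0 *m (wmat *m B).
  by rewrite mulmxA /wmat !mat3S; congr (vec3 _ _ _ *m _); ring.
have [d d0 dE] := subst_qsim uB0 qsim_wmat.
rewrite dE scalerA.
have {c0 d0} cd0 : c * d != 0 by rewrite mulf_neq0.
rewrite e0B.
apply: (@traces_mult_pt 2 _ (apar (aconic k) (wmat *m B)) 6 _ _ _ (('X^4 - 1) ^+ 2)) => //.
- by apply: traces_scale => //; apply: traces_subst => //; apply: traces_conic.
- exact: hermitian_homog.
- by apply: mulmx_unit_neq0 => //; rewrite vec3_eq0 oner_eq0.
- apply: apar0; apply: ord3P; rewrite mxE /aconic /= ?expr0 ?hornerC // ?expr1 ?hornerX //.
  by rewrite hornerXn expr0n.
- rewrite -par_subst frame_subst // par_hermitian (@H0_sum _ (fun i j => aconic k i * aconic k j ^+ 5)).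
  by rewrite /aconic /= -mul_polyC polyC_natr; ring.
by rewrite horner_exp !hornerE expr0n /= sub0r sqrrN expr1n oner_neq0.
Qed.

Lemma mderiv_exp5 (p : {mpoly k[3]}) l : (p ^+ 5)^`M(l) = 0.
Proof.
have z5 : 5%:R = 0 :> {mpoly k[3]} by apply: pcharf0; apply: mpoly_char.
transitivity (5%:R * (p ^+ 4 * p^`M(l))); last by rewrite z5 mul0r.
rewrite !exprS expr0 mulr1 !mderivM; ring.
Qed.

Lemma mderivXU i l : ('X_i : {mpoly k[3]})^`M(l) = (i == l)%:R.
Proof.
rewrite mderivX mnm1E; case: eqP => [->|_]; last by rewrite scale0r.
by rewrite scale1r -[X in (X - _)%MM]add0m addmK mpolyX0.
Qed.

Lemma hermitian_deriv H l : (hermitian H)^`M(l) = \sum_(j < 3) H l j *: 'X_j ^+ 5.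
Proof.
rewrite raddf_sum (bigD1 l) //= [X in _ + X]big1 => [|i /negbTE il]; rewrite ?addr0 raddf_sum.
  apply: eq_bigr => j _ /=.
  by rewrite mderivZ mderivM mderiv_exp5 mulr0 addr0 mderivXU eqxx mul1r.
rewrite big1 // => j _ /=.
by rewrite mderivZ mderivM mderiv_exp5 mulr0 addr0 mderivXU il mul0r scaler0.
Qed.

(** In characteristic 5 only the factor x_i of x_i x_j^5 contributes to the derivatives, so the
    tangent form at u is x G frob(u)^T. In a frame this is given by the last column of [H0], that
    is, by x_0. *)
Lemma tangent_frame B : is_frame B -> exists2 c, c != 0 &
  tangent_form F (pt (vec3 0 0 1 *m B)) = subst (invmx B) (c *: 'X_o0).
Proof.
move=> fB; have uB := frame_unit fB.
have u0 : vec3 0 0 1 *m B != 0 by rewrite mulmx_unit_neq0 // vec3_eq0 oner_eq0 !andbF.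
have [c c0 cE] := rv_pt u0.
exists (c ^+ 5); first by rewrite expf_neq0.
rewrite -[tangent_form _ _]subst1 -(mulVmx uB) -substM; congr (subst _ _).
rewrite /tangent_form coordsE cE (raddf_sum (subst B)) /=.
transitivity (\sum_i \sum_j (B j i * \sum_l G i l * frob (c * B o2 l)) *: ('X_j : {mpoly k[3]})).
  apply: eq_bigr => i _; rewrite substZ substX scaler_sumr; apply: eq_bigr => j _.
  rewrite scalerA mulrC; congr (_ * _ *: _).
  rewrite hermitian_deriv raddf_sum; apply: eq_bigr => l _ /=.
  rewrite mevalZ rmorphXn /= mevalXU frobE; congr (_ * _ ^+ 5).
  by rewrite mulmx3 !mxE /= !mul0r !add0r mul1r.
rewrite exchange_big /=.
transitivity (\sum_j (c ^+ 5 * H0 j o2) *: ('X_j : {mpoly k[3]})).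
  apply: eq_bigr => j _; rewrite -scaler_suml; congr (_ *: _).
  rewrite -fB mxE mulr_sumr; under [RHS]eq_bigr => l _ do rewrite mxE mulr_suml mulr_sumr.
  rewrite exchange_big; apply: eq_bigr => i _; rewrite mulr_sumr; apply: eq_bigr => l _.
  by rewrite !mxE !frobE; ring.
by rewrite big_ord3 /= !mxE /= !mulr0 !scale0r !addr0 mulr1.
Qed.

(** On the tangent line, traced by (0, t, 1), the sextic restricts to -2 t^6. *)
Lemma frame_weierstrass B : is_frame B -> weierstrass_points F (pt (vec3 0 0 1 *m B)).
Proof.
move=> fB; have uB := frame_unit fB.
have e2 : vec3 0 0 1 != 0 :> 'rV[k]_3 by rewrite vec3_eq0 oner_eq0 !andbF.
split; first by rewrite herm_pt // !mxE /= !expr0n /=; ring.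
have [c c0 ->] := tangent_frame fB.
apply: (@traces_mult_pt 1 _ (apar (aline k) B) 6 _ _ _ (- 2%:R)%:P) => //.
- by apply: traces_subst => //; apply: traces_scale => //; apply: traces_line.
- exact: hermitian_homog.
- exact: mulmx_unit_neq0.
- by apply: apar0; apply: ord3P; rewrite mxE /aline /= ?hornerC ?hornerX.
- rewrite -par_subst frame_subst // par_hermitian (@H0_sum _ (fun i j => aline k i * aline k j ^+ 5)).
  by rewrite /aline /= -mul_polyC polyC_natr polyCN polyC_natr; ring.
by rewrite hornerC oppr_eq0 two_neq0.
Qed.

Definition smat (t : k) := wmat *m tmat t.

Lemma e2_smat t : vec3 0 0 1 *m smat t = vec3 1 t (t ^+ 2).
Proof. by rewrite /smat mulmxA /wmat /tmat !mat3S; congr vec3; ring. Qed.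

Lemma frame_points B P : is_frame B -> (conic B `&` zeros F) P <->
  P = pt (vec3 0 0 1 *m B) \/ exists2 t, t ^+ 5 = t & P = pt (vec3 1 t (t ^+ 2) *m B).
Proof.
move=> fB; have uB := frame_unit fB; split; last first.
  move=> [->|[t t5 ->]]; split.
  - by rewrite conic_pt ?vec3_eq0 ?oner_eq0 ?andbF // !mxE /= expr0n mul0r.
  - by rewrite herm_pt ?vec3_eq0 ?oner_eq0 ?andbF // !mxE /= !expr0n /=; ring.
  - by rewrite conic_pt ?vec3_eq0 ?oner_eq0 ?andbF // !mxE /= mul1r.
  rewrite herm_pt ?vec3_eq0 ?oner_eq0 ?andbF // !mxE /= expr1n.
  by rewrite -exprM mulnC exprM t5 [t ^+ 6]exprS t5; ring.
have [v v0 ->] := pt_frame P uB; rewrite (vec3E v) in v0 *.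
move: (v 0 o0) (v 0 o1) (v 0 o2) v0 => x y z v0 [].
rewrite conic_pt // herm_pt // !mxE /=.
have [x0|x0] := eqVneq x 0.
  rewrite x0 mul0r => /eqP; rewrite expf_eq0 /= => /eqP y0 _; left.
  move: v0; rewrite x0 y0 vec3_eq0 !eqxx /= => z0.
  have -> : vec3 0 0 z = z *: vec3 0 0 1 by rewrite scale_vec3; congr vec3; ring.
  by rewrite -scalemxAl ptZ // mulmx_unit_neq0 // vec3_eq0 oner_eq0 !andbF.
move=> yxz E; right; pose t := y / x.
have yE : y = x * t by rewrite /t mulrC divfK.
have zE : z = x * t ^+ 2.
  by apply: (mulfI x0); rewrite -yxz yE; ring.
have vE : vec3 x y z = x *: vec3 1 t (t ^+ 2) by rewrite scale_vec3 mulr1 -yE -zE.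
exists t; last by rewrite vE -scalemxAl ptZ // mulmx_unit_neq0 // vec3_eq0 oner_eq0.
have : (t ^+ 5 - t) ^+ 2 = 0.
  apply: (mulfI (expf_neq0 6 x0)); rewrite mulr0 -[RHS]E yE zE; ring.
by move/eqP; rewrite expf_eq0 subr_eq0 => /eqP.
Qed.

Lemma fixed_frob (t : k) : t ^+ 5 = t <-> exists2 n : nat, (n < 5)%N & t = n%:R.
Proof.
split=> [t5|[n _ ->]]; last first.
  by rewrite -[LHS]/(frob _) rmorph_nat.
have : t * (t - 1) * (t - 2%:R) * (t - 3%:R) * (t - 4%:R) = 0.
  transitivity (t ^+ 5 - t); last by rewrite t5 subrr.
  by apply: (@eq_mod5 _ _ (- 2%:R * t ^+ 4 + 7%:R * t ^+ 3 - 10%:R * t ^+ 2 + 5%:R * t)); ring.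
move/eqP; rewrite !mulf_eq0 -!orbA !subr_eq0 => /or4P[/eqP|/eqP|/eqP|/orP[/eqP|/eqP]] ->.
- by exists 0%N.
- by exists 1%N.
- by exists 2%N.
- by exists 3%N.
- by exists 4%N.
Qed.

End Frame.
End Frames.
Arguments H0 {k}.

Lemma card_ge2 (T : Type) (A : set T) n : (1 < n)%N -> A #= `I_n ->
  exists x y, [/\ A x, A y & x <> y].
Proof.
move=> n1 An; have [[x Ax]|A0] := pselect (exists x, A x); last first.
  have A_0 : A = set0 by apply/seteqP; split=> // x Ax; case: A0; exists x.
  move: An; rewrite A_0 card_eq_sym card_eq0 => /eqP/seteqP[/(_ 0%N)/(_ (ltnW n1))].
  by [].
have [[y Ay xy]|Ax1] := pselect (exists2 y, A y & x <> y); first by exists x, y.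
have A_x : A = [set x].
  apply/seteqP; split=> [y Ay|y ->//]; apply: contrapT => yx.
  by apply: Ax1; exists y => // xy; apply: yx.
move: An; rewrite A_x card_eq_sym => /card_eq_trans /(_ (card_set1)) /card_eq_II n1'.
by rewrite n1' in n1.
Qed.

(** * The six tangency points of a frame, and sextics with square restriction *)

Section TotallyTangent.
Variable k : closedFieldType.
Hypothesis char_k : 5%N \in [pchar k].
Implicit Types (v w : 'rV[k]_3) (A B E H S X M : 'M[k]_3) (P : point k).
Local Notation frob := (frob char_k).

Lemma quadricD S S' : quadric (S + S') = quadric S + quadric S'.
Proof.
rewrite /quadric -big_split; apply: eq_bigr => i _; rewrite -big_split.
by apply: eq_bigr => j _ /=; rewrite mxE scalerDl.
Qed.

Lemma quadric_delta i j : quadric (delta_mx i j) = 'X_i * 'X_j :> {mpoly k[3]}.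
Proof.
rewrite /quadric (bigD1 i) //= [X in _ + X]big1 => [|l /negbTE li]; last first.
  by apply: big1 => m _; rewrite mxE li scale0r.
rewrite addr0 (bigD1 j) //= big1 => [|l /negbTE lj]; last by rewrite mxE lj andbF scale0r.
by rewrite mxE !eqxx scale1r addr0.
Qed.

Lemma homog2_quadric (q : {mpoly k[3]}) : q \is 2.-homog ->
  exists2 S, S^T = S & q = quadric S.
Proof.
have two := two_neq0 char_k.
move: q; apply: dhomog_ind => [|c m p md [S ST ->]].
  exists 0; first by rewrite trmx0.
  by rewrite /quadric big1 // => i _; rewrite big1 // => j _; rewrite mxE scale0r.
have [i [j ->]] : exists i j, m = (U_(i) + U_(j))%MM.
  have [i mi] : exists i, (0 < m i)%N.
    apply/existsP; apply: contraT; rewrite negb_exists => /forallP m0.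
    by move: md; rewrite mdegE big1 // => i _; apply/eqP; rewrite -leqn0 leqNgt.
  have mE : m = (U_(i) + (m - U_(i)))%MM.
    by rewrite addmC submK //; apply/mnm_lepP => l; rewrite mnm1E; case: eqP => // <-.
  have : mdeg (m - U_(i))%MM == 1%N by move: md; rewrite {1}mE mdegD mdeg1 add1n => -[->].
  by move/mdeg1P => [j /eqP jE]; exists i, j; rewrite -jE.
exists ((c / 2%:R) *: (delta_mx i j + delta_mx j i) + S).
  by rewrite linearD linearZ /= linearD /= !trmx_delta ST [delta_mx j i + _]addrC.
rewrite quadricD quadricZ quadricD !quadric_delta mpolyXD ['X_j * _]mulrC.
by rewrite -mulr2n -scaler_nat scalerA divfK.
Qed.

Lemma meval_quadric_mx S v : (quadric S).@[v 0] = (v *m S *m v^T) 0 0.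
Proof.
rewrite meval_quadric mxE exchange_big; apply: eq_bigr => j _ /=.
rewrite !mxE mulr_suml; apply: eq_bigr => i _; ring.
Qed.

Lemma quadric_deriv S l v : S^T = S -> (quadric S)^`M(l).@[v 0] = 2%:R * (v *m S) 0 l.
Proof.
move=> ST; rewrite /quadric (raddf_sum (mderiv l)) /= raddf_sum mulr_natl mulr2n.
have SE i j : S i j = S j i by rewrite -{1}ST mxE.
transitivity (\sum_i \sum_j (S i j * ((i == l)%:R * v 0 j) + S i j * (v 0 i * (j == l)%:R))).
  apply: eq_bigr => i _ /=; rewrite (raddf_sum (mderiv l)) raddf_sum; apply: eq_bigr => j _ /=.
  by rewrite mderivZ mderivM !mderivXU mevalZ mevalD !mevalM !mevalXU !rmorph_nat mulrDr.
under eq_bigr => i _ do rewrite big_split.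
rewrite big_split /=; congr (_ + _); rewrite mxE.
  rewrite (bigD1 l) //= [X in _ + X]big1 ?addr0 => [|i /negbTE il].
    by apply: eq_bigr => j _; rewrite eqxx mul1r SE mulrC.
  by apply: big1 => j _; rewrite il mul0r mulr0.
apply: eq_bigr => i _; rewrite (bigD1 l) //= big1 => [|j /negbTE jl].
  by rewrite eqxx mulr1 addr0 mulrC.
by rewrite jl !mulr0.
Qed.

Lemma nonsingular_quadric S : S^T = S -> nonsingular (quadric S) <-> S \in unitmx.
Proof.
move=> ST; split=> [ns|uS P].
  rewrite unitmxE unitfE; apply/negP => /det0P[v v0 vS].
  have [c c0 cE] := rv_pt v0.
  have vS' : rv (pt v) *m S = 0 by rewrite cE -scalemxAl vS scaler0.
  have [|i] := ns (pt v); first by rewrite /zeros /= coordsE meval_quadric_mx vS' mul0mx mxE.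
  by rewrite coordsE quadric_deriv // vS' mxE mulr0 eqxx.
move=> _; rewrite coordsE; have : rv P *m S != 0 by rewrite mulmx_unit_neq0 ?rv_neq0.
move/rV0Pn => [i vi]; exists i.
by rewrite quadric_deriv // mulf_neq0 ?two_neq0.
Qed.

(** The tangency points are indexed by the projective line over F_5: n < 5 is the parameter, and 5
    stands for infinity. *)
Definition nvec (n : nat) : 'rV[k]_3 := if (n < 5)%N then vec3 1 n%:R (n%:R ^+ 2) else vec3 0 0 1.

Lemma nvec_neq0 n : nvec n != 0.
Proof. by rewrite /nvec; case: ifP; rewrite vec3_eq0 oner_eq0 ?andbF. Qed.

Lemma natr_inj5 (n m : nat) : (n < 5)%N -> (m < 5)%N -> (n%:R : k) = m%:R -> n = m.
Proof.
wlog: n m / (m <= n)%N => [H n5 m5 E|mn n5 m5 /eqP].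
  by case: (leqP m n) => [mn|/ltnW mn]; [apply: H | apply/esym/H].
rewrite -subr_eq0 -natrB // -(dvdn_pcharf char_k) => /dvdnP[j jE].
by case: j jE => [|j] jE; lia.
Qed.

Lemma nvec_inj c n m : (n < 6)%N -> (m < 6)%N -> nvec n = c *: nvec m -> n = m.
Proof.
move=> n6 m6; rewrite /nvec; case: ifP => n5; case: ifP => m5; rewrite scale_vec3.
- move=> E; have := congr1 (fun v : 'rV[k]_3 => v 0 o0) E; rewrite !vec3_0 mulr1 => c1.
  have := congr1 (fun v : 'rV[k]_3 => v 0 o1) E; rewrite !vec3_1 -c1 mul1r.
  exact: natr_inj5.
- move=> /(congr1 (fun v : 'rV[k]_3 => v 0 o0)); rewrite !vec3_0 mulr0 => /eqP.
  by rewrite oner_eq0.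
- move=> E; have := congr1 (fun v : 'rV[k]_3 => v 0 o0) E; rewrite !vec3_0 mulr1 => c0.
  have := congr1 (fun v : 'rV[k]_3 => v 0 o2) E; rewrite !vec3_2 -c0 mul0r => /eqP.
  by rewrite oner_eq0.
by lia.
Qed.

Section Herm.
Variable G : 'M[k]_3.
Let F := hermitian G.
Local Notation frame := (is_frame char_k G).

Lemma frame_nvec B P : frame B -> (conic B `&` zeros F) P <->
  exists2 n, (n < 6)%N & P = pt (nvec n *m B).
Proof.
move=> fB; rewrite (frame_points (char_k := char_k)) //; split.
  move=> [->|[t /(fixed_frob char_k)[n n5 ->] ->]]; first by exists 5%N.
  by exists n; rewrite ?(leq_trans n5) // /nvec n5.
move=> [n n6 ->]; rewrite /nvec; case: ifP => n5; last by left.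
by right; exists n%:R => //; apply/(fixed_frob char_k); exists n.
Qed.

Lemma nvec_pt_inj B n m : frame B -> (n < 6)%N -> (m < 6)%N ->
  pt (nvec n *m B) = pt (nvec m *m B) -> n = m.
Proof.
move=> fB n6 m6; have uB := frame_unit fB.
move/pt_inj; rewrite !mulmx_unit_neq0 ?nvec_neq0 // => /(_ isT isT)[c c0].
rewrite scalemxAl => /(congr1 (mulmx^~ (invmx B))); rewrite !mulmxK //.
exact: nvec_inj.
Qed.

(* A projectivity preserving the conic moves any of the six points to [(0, 0, 1)]. *)
Lemma nvec_smat n : exists X, [/\ is_unitary char_k X, qsim X & nvec n = vec3 0 0 1 *m X].
Proof.
rewrite /nvec; case: ifP => n5.
  exists (smat n%:R); split; rewrite ?e2_smat //.
    by apply: unitaryM; [apply: unitary_wmat|apply: unitary_tmat; apply/(fixed_frob char_k); exists n].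
  by apply: qsimM; [apply: qsim_wmat|apply: qsim_tmat].
exists 1%:M; split; rewrite ?mulmx1 //.
  by rewrite /is_unitary map_mx1 trmx1 mul1mx mulmx1.
by exists 1; rewrite ?oner_neq0 // trmx1 mul1mx mulmx1 scale1r.
Qed.

Lemma frame_point_weierstrass B P : frame B -> (conic B `&` zeros F) P ->
  weierstrass_points F P.
Proof.
move=> fB /(frame_nvec _ fB)[n _ ->]; have [X [uX qX ->]] := nvec_smat n.
by rewrite -mulmxA; apply/(@frame_weierstrass _ char_k)/frameM.
Qed.

Lemma frame_card B : frame B -> conic B `&` zeros F #= `I_6.
Proof.
move=> fB; have -> : conic B `&` zeros F = (fun n => pt (nvec n *m B)) @` `I_6.
  apply/seteqP; split=> P; first by move/(frame_nvec _ fB) => [n n6 ->]; exists n.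
  by move=> [n n6 <-]; apply/(frame_nvec _ fB); exists n.
apply: inj_card_eq => n m; rewrite !inE; exact: nvec_pt_inj.
Qed.

Lemma frame_totally_tangent B : frame B -> totally_tangent_conics F (conic B).
Proof.
move=> fB; have uB := frame_unit fB.
exists (subst (invmx B) (qconic k)); split=> //.
- exact: subst_homog (qconic_homog _).
- rewrite (qconicE char_k) (subst_quadric (invmx B)); apply/nonsingular_quadric.
    rewrite !trmx_mul trmxK mulmxA; congr (_ *m _ *m _).
    by rewrite /Cq tr_mat3.
  by rewrite !unitmx_mul unitmx_tr !unitmx_inv uB unit_Cq.
- exact: frame_card.
move=> P /(frame_nvec _ fB)[n _ ->]; have [X [uX qX ->]] := nvec_smat n.
have fXB := frameM uX fB; have uXB := frame_unit fXB.
have [c c0 ->] := subst_qsim char_k uB qX.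
by rewrite -mulmxA; apply: (@frame_conic_mult _ char_k).
Qed.

End Herm.

(** In the splitting of f every root is listed exactly twice, so the product over the list without
    repetitions is a square root up to the leading coefficient. *)
Lemma double_roots_square (f : {poly k}) : f != 0 ->
  (forall r, root f r -> exists2 g, f = ('X - r%:P) ^+ 2 * g & ~~ root g r) ->
  exists h, [/\ h \is monic, f = lead_coef f *: h ^+ 2 & root f =1 root h].
Proof.
move=> f0 fr; have [s sE] := closed_field_poly_normal f.
have lf0 : lead_coef f != 0 by rewrite lead_coef_eq0.
have rE z : root f z = (z \in s) by rewrite sE rootZ // root_prod_XsubC.
have uE : perm_eq s (undup s ++ undup s).
  apply/allP => z _ /=; rewrite count_cat (count_uniq_mem z (undup_uniq s)) mem_undup.
  have -> : count_mem z s = mup z f.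
    by rewrite {1}sE -mul_polyC mupMr ?rootC // mu_prod_XsubC.
  rewrite -rE; case: (boolP (root f z)) => [/fr[g -> gz]|fz]; last by rewrite mupNroot.
  by rewrite mupMl // mup_XsubCX eqxx.
exists (\prod_(z <- undup s) ('X - z%:P)); split.
- exact: monic_prod_XsubC.
- by rewrite {1}sE (perm_big _ uE) big_cat /= expr2.
by move=> z; rewrite rE root_prod_XsubC mem_undup.
Qed.

Lemma hermitian_coef H n : (par (@aconic k) (hermitian H))`_n =
  \sum_(i < 3) \sum_(j < 3) H i j *+ (n == i + 5 * j)%N.
Proof.
rewrite par_hermitian coef_sum; apply: eq_bigr => i _.
rewrite coef_sum; apply: eq_bigr => j _.
by rewrite coefZ /aconic -exprM -exprD coefXn mulr_natr mulnC.
Qed.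

(* The exponents [i + 5 j] leave gaps at 3, 4, 8 and 9, which kills the middle
   coefficients of a square root. *)
Lemma square_hermitian H (f := par (@aconic k) (hermitian H)) :
  H o1 o2 = 0 -> H o2 o2 = 0 -> H o0 o2 != 0 -> root f 0 ->
  (forall r, root f r -> exists2 g, f = ('X - r%:P) ^+ 2 * g & ~~ root g r) ->
  exists c a, [/\ c != 0, a != 0 &
    H = mat3 (vec3 0 0 c) (vec3 0 (2%:R * c * a) 0) (vec3 (c * a ^+ 2) 0 0)].
Proof.
move=> H12 H22 H02 f00 fr; have two := two_neq0 char_k.
have fE n : f`_n = \sum_(i < 3) \sum_(j < 3) H i j *+ (n == i + 5 * j)%N by exact: hermitian_coef.
have f10 : f`_10 = H o0 o2 by rewrite fE !big_ord3 /= !mulr0n !addr0 !add0r.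
have sf : size f = 11.
  apply/eqP; rewrite eqn_leq; apply/andP; split.
    apply/leq_sizeP => n n11; rewrite fE; apply: big1 => i _; apply: big1 => j _.
    case: eqP => // nE; rewrite mulr1n.
    have : (i == o1) && (j == o2) \/ (i == o2) && (j == o2).
      move: nE; case: i => [[|[|[|i]]] iP] //; case: j => [[|[|[|j]]] jP] //= nE; try lia; by [left|right].
    by case=> /andP[/eqP-> /eqP->].
  by rewrite ltnNge; apply: contraNN H02 => /leq_sizeP/(_ _ (leqnn _)); rewrite f10 => ->.
have f0 : f != 0 by rewrite -size_poly_eq0 sf.
have [h [hm hE hr]] := double_roots_square f0 fr.
have lc : lead_coef f = H o0 o2 by rewrite lead_coefE sf.
have sh : size h = 6.
  move: sf; rewrite hE size_scale ?lc // expr2 size_monicM ?monic_neq0 //.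
  by case: (size h) => [|n] /=; lia.
have h5 : h`_5 = 1 by move/monicP: hm; rewrite lead_coefE sh.
have h0 : h`_0 = 0 by rewrite -horner_coef0; apply/eqP; rewrite -[_ == 0]/(root h 0) -hr.
have cE n : f`_n = H o0 o2 * \sum_(i < n.+1) h`_i * h`_(n - i).
  by rewrite {1}hE lc coefZ expr2 coefM.
have hl n : (5 < n)%N -> h`_n = 0 by move=> n5; rewrite nth_default ?sh.
have mulc x : H o0 o2 * x = 0 -> x = 0 by move/eqP; rewrite mulf_eq0 (negbTE H02) => /eqP.
have mul2 (x : k) : x + x = 0 -> x = 0.
  by move/eqP; rewrite -mulr2n -mulr_natl mulf_eq0 (negbTE two) => /eqP.
have f9 : f`_9 = 0 by rewrite fE !big_ord3 /= !mulr0n !addr0.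
have h4 : h`_4 = 0.
  move: f9; rewrite cE => /mulc; rewrite !big_ord_recr big_ord0 /=
    !subSS !subn0 (hl 6%N) // (hl 7%N) // (hl 8%N) // ?(hl 9%N) // h0 h5.
  by rewrite !(mulr0, mul0r, addr0, add0r, mulr1, mul1r) => /mul2.
have f8 : f`_8 = 0 by rewrite fE !big_ord3 /= !mulr0n !addr0.
have h3 : h`_3 = 0.
  move: f8; rewrite cE => /mulc; rewrite !big_ord_recr big_ord0 /=
    !subSS !subn0 (hl 6%N) // (hl 7%N) // (hl 8%N) // ?(hl 9%N) // h0 h5 h4.
  by rewrite !(mulr0, mul0r, addr0, add0r, mulr1, mul1r) => /mul2.
have f2 : f`_2 = H o0 o2 * h`_1 ^+ 2.
  rewrite cE; congr (_ * _); rewrite !big_ord_recr big_ord0 /= !subSS !subn0 h0.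
  by rewrite !(mulr0, mul0r, addr0, add0r) expr2.
(* The order of f at 0 is exactly 2, so h has a simple zero there. *)
have h1 : h`_1 != 0.
  have [g gE g0] := fr _ f00; apply: contraNneq g0 => h1.
  have : f`_2 = 0 by rewrite f2 h1 expr0n mulr0.
  by rewrite gE subr0 coefXnM /= -horner_coef0 => /eqP.
have f3 : f`_3 = 0 by rewrite fE !big_ord3 /= !mulr0n !addr0.
have h2 : h`_2 = 0.
  move: f3; rewrite cE => /mulc; rewrite !big_ord_recr big_ord0 /= !subSS !subn0 h0 h3.
  rewrite !(mulr0, mul0r, addr0, add0r) [h`_2 * _]mulrC => /mul2/eqP.
  by rewrite mulf_eq0 (negbTE h1) => /eqP.
exists (H o0 o2), h`_1; split=> //.
rewrite [LHS]mat3E; congr mat3; apply/rowP; apply: ord3P; rewrite !mxE //=.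
- have := cE 0%N; rewrite fE !big_ord3 /= !mulr0n ?mulr1n !addr0 ?add0r => ->.
  rewrite !big_ord_recr big_ord0 /= ?subSS ?subn0 h0 ?h5 ?h4 ?h3 ?h2.
  by rewrite !(mulr0, mul0r, addr0, add0r, mulr1, mul1r).
- have := cE 5%N; rewrite fE !big_ord3 /= !mulr0n ?mulr1n !addr0 ?add0r => ->.
  rewrite !big_ord_recr big_ord0 /= ?subSS ?subn0 h0 ?h5 ?h4 ?h3 ?h2.
  by rewrite !(mulr0, mul0r, addr0, add0r, mulr1, mul1r).
- have := cE 1%N; rewrite fE !big_ord3 /= !mulr0n ?mulr1n !addr0 ?add0r => ->.
  rewrite !big_ord_recr big_ord0 /= ?subSS ?subn0 h0 ?h5 ?h4 ?h3 ?h2.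
  by rewrite !(mulr0, mul0r, addr0, add0r, mulr1, mul1r).
- have := cE 6%N; rewrite fE !big_ord3 /= !mulr0n ?mulr1n !addr0 ?add0r => ->.
  rewrite !big_ord_recr big_ord0 /= ?subSS ?subn0 (hl 6%N) // h0 ?h5 ?h4 ?h3 ?h2.
  by rewrite !(mulr0, mul0r, addr0, add0r, mulr1, mul1r); ring.
- have := cE 2%N; rewrite fE !big_ord3 /= !mulr0n ?mulr1n !addr0 ?add0r => ->.
  rewrite /= ?subSS ?subn0 h0 ?h5 ?h4 ?h3 ?h2.
  by rewrite !(mulr0, mul0r, addr0, add0r, mulr1, mul1r) expr2.
- have := cE 7%N; rewrite fE !big_ord3 /= !mulr0n ?mulr1n !addr0 ?add0r => ->.
  rewrite !big_ord_recr big_ord0 /= ?subSS ?subn0 (hl 6%N) // (hl 7%N) // h0 ?h5 ?h4 ?h3 ?h2.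
  by rewrite !(mulr0, mul0r, addr0, add0r, mulr1, mul1r).
Qed.

End TotallyTangent.

(** * Totally tangent conics are the standard conics of frames *)

Section Classification.
Variable k : closedFieldType.
Hypothesis char_k : 5%N \in [pchar k].
Implicit Types (v w : 'rV[k]_3) (A B E H S X M : 'M[k]_3) (P : point k).
Local Notation frob := (frob char_k).

Lemma row_free_points P P' : P <> P' -> row_free (col_mx (rv P) (rv P')).
Proof.
move=> PP'; rewrite -kermx_eq0; apply/eqP/row_matrixP => i; rewrite row0.
move: (row i _) (row_sub i (kermx (col_mx (rv P) (rv P')))) => u /sub_kermxP.
rewrite -[u]hsubmxK mul_row_col.
move: (lsubmx u) (rsubmx u) => a b.
rewrite [a]mx11_scalar [b]mx11_scalar !mul_scalar_mx.
move: (a 0 0) (b 0 0) => {}a {}b E.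
have a0 : a = 0.
  apply/eqP; apply: contraT => a0; case: PP'.
  have PE : rv P = (- b / a) *: rv P'.
    apply: (scalerI a0); rewrite scalerA mulrC divfK // scaleNr.
    by apply/eqP; rewrite -addr_eq0 E.
  have b0 : - b / a != 0.
    by apply: contraNneq (rv_neq0 P) => b0; rewrite PE b0 scale0r.
  by rewrite -[P]pt_rv PE ptZ ?rv_neq0 // pt_rv.
have b0 : b = 0.
  move/eqP: E; rewrite a0 scale0r add0r scaler_eq0 (negbTE (rv_neq0 _)) orbF.
  by move/eqP.
by rewrite a0 b0 !raddf0 row_mx0.
Qed.

Lemma bilin_entry S v w : (v *m S *m w^T) 0 0 = 0 -> v *m S *m w^T = 0.
Proof. by move=> E; rewrite [LHS]mx11_scalar E raddf0. Qed.

(* Two points of a non-singular conic are not conjugate; together with the pole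
   of the line joining them they give coordinates where the conic is
   [x_1^2 = x_0 x_2]. *)
Lemma conic_coordinates S P P' : S^T = S -> S \in unitmx -> P <> P' ->
  zeros (quadric S) P -> zeros (quadric S) P' ->
  exists M, exists c, [/\ M \in unitmx, c != 0, M *m S *m M^T = c *: Cq k,
    P = pt (vec3 1 0 0 *m M) & P' = pt (vec3 0 0 1 *m M)].
Proof.
move=> ST uS PP' QP QP'; pose R := col_mx (rv P) (rv P').
have two := two_neq0 char_k.
have rR : \rank R = 2 by apply/eqP; apply: (row_free_points PP').
have [v [v0 vR]] : exists v : 'rV[k]_3, v != 0 /\ v *m (S *m R^T) = 0.
  have K0 : kermx (S *m R^T) != 0.
    rewrite kermx_eq0 /row_free; apply/eqP => E.
    by have := rank_leq_col (S *m R^T); rewrite E.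
  exists (nz_row (kermx (S *m R^T))); split; first by rewrite nz_row_eq0.
  by apply/sub_kermxP; apply: nz_row_sub.
pose p := rv P; pose p' := rv P'.
have Sc u w : (u *m S *m w^T) 0 0 = (w *m S *m u^T) 0 0.
  have -> : w *m S *m u^T = (u *m S *m w^T)^T by rewrite !trmx_mul trmxK ST mulmxA.
  by rewrite [RHS]mxE.
have pp : (p *m S *m p^T) 0 0 = 0 by move: QP; rewrite /zeros /= coordsE meval_quadric_mx.
have p'p' : (p' *m S *m p'^T) 0 0 = 0 by move: QP'; rewrite /zeros /= coordsE meval_quadric_mx.
have [vp vp'] : (v *m S *m p^T) 0 0 = 0 /\ (v *m S *m p'^T) 0 0 = 0.
  move: vR; rewrite /R tr_col_mx mul_mx_row mul_mx_row !mulmxA.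
  by rewrite -[0]row_mx0 => /eq_row_mx[-> ->]; rewrite !mxE.
pose b := (p *m S *m p'^T) 0 0.
(* Otherwise the plane spanned by P and P' would be totally isotropic, and two matrices of rank 2
   with product 0 cannot meet in dimension 3. *)
have b0 : b != 0.
  apply/negP => /eqP b0.
  have : R *m (S *m R^T) = 0.
    rewrite /R tr_col_mx mul_mx_row mul_col_row.
    rewrite !mulmxA (bilin_entry pp) (bilin_entry b0) (bilin_entry p'p').
    have /bilin_entry-> : (p' *m S *m p^T) 0 0 = 0 by rewrite Sc.
    by rewrite /block_mx !row_mx0 col_mx0.
  move/mulmx0_rank_max; rewrite rR.
  have -> : \rank (S *m R^T) = 2 by rewrite -mxrank_tr trmx_mul trmxK mxrankMfree ?rR // row_free_unit unitmx_tr.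
  by [].
pose c := (v *m S *m v^T) 0 0.
pose M0 := mat3 p v p'.
have M0E : M0 *m S *m M0^T = mat3 (vec3 0 0 b) (vec3 0 c 0) (vec3 b 0 0).
  apply/matrixP => i j.
  have -> : (M0 *m S *m M0^T) i j = (row i M0 *m S *m (row j M0)^T) 0 0.
    rewrite tr_row -row_mul [LHS]mxE [RHS]mxE; apply: eq_bigr => l _.
    by rewrite [row i _ 0 l]mxE [col j _ l 0]mxE.
  move: i j; apply: ord3P; apply: ord3P; rewrite /M0 ?(row_mat3_0, row_mat3_1, row_mat3_2) [RHS]mxE /=
    [RHS]mxE /= //; try by rewrite Sc.
have uM0 : M0 \in unitmx.
  rewrite unitmxE unitfE; apply/negP => /det0P[u u0 uM].
  have := congr1 (fun x => x *m (S *m M0^T)) uM.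
  rewrite mul0mx -mulmxA (mulmxA M0) M0E [u]vec3E mulmx_mat3 => /eqP.
  rewrite vec3_eq0 !(mulr0, addr0, add0r) !mulf_eq0 (negbTE b0) !orbF => /and3P[/eqP z0 _ /eqP x0].
  move: uM; rewrite mulmx3 x0 z0 !scale0r add0r addr0 /M0 row_mat3_1 => /eqP.
  rewrite scaler_eq0 (negbTE v0) orbF => /eqP y0.
  by move: u0; rewrite [u]vec3E x0 y0 z0 vec3_eq0 eqxx.
have c0 : c != 0.
  have : M0 *m S *m M0^T \in unitmx by rewrite !unitmx_mul unitmx_tr uM0 uS.
  rewrite M0E unitmxE det_mat3 unitfE; apply: contraNneq => ->; apply/eqP; ring.
(* Scaling the first vector by 2 c / b turns the corner entries b into 2 c, which are those of
   [c *: Cq]. *)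
have ab0 : 2%:R * c / b != 0 by rewrite !mulf_neq0 ?invr_eq0.
have uD : dmat (2%:R * c / b) 1 1 \in unitmx.
  rewrite unitmxE det_mat3 unitfE; apply: contraNneq ab0 => E; apply/eqP; rewrite -[RHS]E; ring.
exists (dmat (2%:R * c / b) 1 1 *m M0), c; split=> //.
- by rewrite unitmx_mul uD.
- rewrite trmx_mul !mulmxA -(mulmxA _ M0) -(mulmxA _ _ M0^T) M0E.
  rewrite /dmat /Cq !mat3S; apply: mat3_congr; split; try ring.
    by rewrite !(mulr0, mul0r, addr0, add0r, mulr1, mul1r) divfK // mulrC.
  by rewrite !(mulr0, mul0r, addr0, add0r, mulr1, mul1r) mulrC divfK // mulrC.
- rewrite mulmxA /dmat mulmx_mat3 mulmx3 !mxE /= !(mulr0, mul0r, addr0, add0r, mul1r) !scale0r !addr0.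
  by rewrite /M0 row_mat3_0 ptZ ?rv_neq0 // pt_rv.
rewrite mulmxA /dmat mulmx_mat3 mulmx3 !mxE /= !(mulr0, mul0r, addr0, add0r, mul1r) !scale0r !add0r scale1r.
by rewrite /M0 row_mat3_2 pt_rv.
Qed.

Section Herm.
Variable G : 'M[k]_3.
Hypothesis uG : G \in unitmx.
Let F := hermitian G.
Variables (S : 'M[k]_3).
Hypothesis tangentS : forall P, zeros (quadric S) P -> zeros F P ->
  has_intersection_mult (quadric S) F P 2.

Let gramM M := M *m G *m (map_mx frob M)^T.

Lemma double_zero M c : M \in unitmx -> c != 0 -> M *m S *m M^T = c *: Cq k ->
  root (par (@aconic k) (hermitian (gramM M))) 0 ->
  exists2 g, par (@aconic k) (hermitian (gramM M)) = 'X^2 * g & ~~ root g 0.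
Proof.
(* The exponents i + 5 j are pairwise distinct, so the coefficients of f are the entries of the
   invertible matrix [gramM M], and f is not 0. *)
move=> uM c0 cE; set f := par _ _ => f0.
have fN0 : f != 0.
  apply/negP => /eqP fz.
  have : gramM M \in unitmx.
    rewrite /gramM !unitmx_mul uM uG unitmx_tr.
    by rewrite map_unitmx.
  suff -> : gramM M = 0 by rewrite unitmxE det0 unitr0.
  have H n : \sum_(i < 3) \sum_(j < 3) gramM M i j *+ (n == i + 5 * j)%N = 0.
    by rewrite -hermitian_coef -/f fz coef0.
  apply/matrixP => i j; rewrite [RHS]mxE -(H (i + 5 * j)%N) (bigD1 i) //= (bigD1 j) //= eqxx mulr1n.
  rewrite big1 => [|l lj]; last first.
    by rewrite eqn_add2l eqn_mul2l /= (inj_eq val_inj) eq_sym (negbTE lj).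
  rewrite addr0 big1 ?addr0 // => l li; apply: big1 => m _.
  suff /negbTE -> : (i + 5 * j != l + 5 * m)%N by [].
  by move: li; rewrite -(inj_eq val_inj) /=; case: i l j m => [i Hi] [l Hl] [j Hj] [m Hm] /=; lia.
have [n [g g0 fE]] : exists n, exists2 g, ~~ root g 0 & f = 'X^n * g.
  have [n [g gE fE]] := multiplicity_XsubC f 0; exists n, g.
    by move: gE; rewrite fN0.
  by rewrite fE subr0 mulrC.
have hn : has_intersection_mult (quadric S) F (pt (vec3 1 0 0 *m M)) n.
  have qE : quadric S = c *: subst (invmx M) (qconic k).
    rewrite -substZ (qconicE char_k) -quadricZ -cE -subst_quadric substM mulVmx //.
    by rewrite subst1.
  rewrite qE.
  apply: (@traces_mult_pt _ 2 _ (apar (aconic k) M) 6 _ _ _ g) => //.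
  - by apply: traces_scale => //; apply: traces_subst => //; apply: traces_conic.
  - exact: hermitian_homog.
  - by apply: mulmx_unit_neq0 => //; rewrite vec3_eq0 oner_eq0.
  - apply: apar0; apply: ord3P; rewrite mxE /aconic /= ?expr0 ?hornerC // ?expr1 ?hornerX //.
    by rewrite hornerXn expr0n.
  - by rewrite -par_subst (subst_hermitian char_k).
exists g => //; suff -> : 2%N = n by [].
apply: (intersection_mult_uniq (tangentS _ _) hn).
- rewrite (@zeros_pt _ 2) ?quadric_homog ?mulmx_unit_neq0 // ?vec3_eq0 ?oner_eq0 //.
  rewrite -subst_meval subst_quadric cE quadricZ mevalZ -(qconicE char_k) qconic_eval !mxE /=.
  by rewrite expr0n mulr0 subrr mulr0.
rewrite (@zeros_pt _ 6) ?hermitian_homog ?mulmx_unit_neq0 // ?vec3_eq0 ?oner_eq0 //.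
rewrite -subst_meval (subst_hermitian char_k) -/(gramM M).
transitivity f.[0]; last exact/eqP.
rewrite par_horner; apply: meval_eq; apply: ord3P;
  by rewrite mxE /aconic /= ?expr0 ?hornerC // ?expr1 ?hornerX // ?hornerXn ?expr0n.
Qed.

End Herm.
End Classification.

Section TotallyTangentFrames.
Variable k : closedFieldType.
Hypothesis char_k : 5%N \in [pchar k].
Implicit Types (v w : 'rV[k]_3) (A B E H S X M : 'M[k]_3) (P : point k).
Local Notation frob := (frob char_k).

Lemma par_tmat r h : par (@aconic k) (subst (tmat r) h) = par (@aconic k) h \Po ('X + r%:P).
Proof.
pose f : {rmorphism {mpoly k[3]} -> {poly k}} := (par (@aconic k) \o subst (tmat r)).
pose g : {rmorphism {mpoly k[3]} -> {poly k}} := (comp_poly ('X + r%:P) \o par (@aconic k)).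
apply: (@rmorph_mpoly_ext _ _ f g) => [c|i] /=.
  by rewrite substC /par !mmapC comp_polyC.
rewrite par_subst !parX /apar big_ord3 /aconic /= expr0 expr1 comp_Xn_poly.
move: i; apply: ord3P; rewrite !mxE /= ?scale0r ?scale1r ?expr0 ?expr1 ?addr0 ?add0r.
- by [].
- by rewrite -mul_polyC mulr1 addrC.
by rewrite -!mul_polyC !rmorphM /= polyC_natr; ring.
Qed.

Lemma nth_root n (x : k) : (0 < n)%N -> exists y, y ^+ n = x.
Proof.
move=> n0; have [y yE] := @solve_monicpoly k n (fun i => if i == 0%N then x else 0) n0.
exists y; rewrite yE; case: n n0 {yE} => // n _.
by rewrite big_ord_recl big1 => [|i _]; rewrite /= ?mul0r // expr0 mulr1 addr0.
Qed.

Section Herm.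
Variable G : 'M[k]_3.
Hypothesis uG : G \in unitmx.
Let F := hermitian G.
Let gramM M := M *m G *m (map_mx frob M)^T.

Lemma gramMM X M : gramM (X *m M) = X *m gramM M *m (map_mx frob X)^T.
Proof. by rewrite /gramM map_mxM trmx_mul !mulmxA. Qed.

Lemma par_gram0 M : M \in unitmx ->
  root (par (@aconic k) (hermitian (gramM M))) 0 <-> zeros F (pt (vec3 1 0 0 *m M)).
Proof.
move=> uM; rewrite (@zeros_pt _ 6) ?hermitian_homog ?mulmx_unit_neq0 // ?vec3_eq0 ?oner_eq0 //.
rewrite -subst_meval (subst_hermitian char_k) -/(gramM M).
have -> : (hermitian (gramM M)).@[vec3 1 0 0 0] = (par (@aconic k) (hermitian (gramM M))).[0].
  rewrite par_horner; apply: meval_eq; apply: ord3P;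
    by rewrite mxE /aconic /= ?expr0 ?hornerC // ?expr1 ?hornerX // ?hornerXn ?expr0n.
by split=> /eqP.
Qed.

Lemma qsim_conj X M S c : c != 0 -> M *m S *m M^T = c *: Cq k -> qsim X ->
  exists2 d, d != 0 & (X *m M) *m S *m (X *m M)^T = d *: Cq k.
Proof.
move=> c0 cE [d d0 dE]; exists (c * d); first by rewrite mulf_neq0.
rewrite trmx_mul !mulmxA -(mulmxA X) -(mulmxA X) cE.
by rewrite -scalemxAr -scalemxAl dE scalerA.
Qed.

Lemma totally_tangent_frame Q : totally_tangent_conics F Q ->
  exists2 B, is_frame char_k G B & Q = conic B.
Proof.
move=> [q [hq ns -> QF mult]].
have [S ST qE] := homog2_quadric char_k hq; rewrite {}qE in hq ns QF mult *.
have uS : S \in unitmx by apply/(nonsingular_quadric char_k).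
have tangentS P : zeros (quadric S) P -> zeros F P ->
    has_intersection_mult (quadric S) F P 2 by move=> QP FP; apply: mult.
have [P [P' [[QP FP] [QP' FP'] PP']]] := card_ge2 (isT : 1 < 6)%N QF.
have [M [c [uM c0 cE PE P'E]]] := conic_coordinates char_k ST uS PP' QP QP'.
pose H := gramM M; pose f := par (@aconic k) (hermitian H).
have f00 : root f 0 by apply/par_gram0 => //; rewrite -PE.
(* Every finite root is moved to 0 by a translation of the parameter. *)
have f_roots r : root f r -> exists2 g, f = ('X - r%:P) ^+ 2 * g & ~~ root g r.
  move=> fr; have [d d0 dE] := qsim_conj c0 cE (qsim_tmat char_k r).
  have uM' : tmat r *m M \in unitmx by rewrite unitmx_mul (qsim_unit char_k) ?uM //; apply: qsim_tmat.
  have fE : par (@aconic k) (hermitian (gramM (tmat r *m M))) = f \Po ('X + r%:P).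
    by rewrite gramMM -(subst_hermitian char_k) par_tmat.
  have [|g gE g0] := double_zero (char_k := char_k) uG tangentS uM' d0 dE.
    by rewrite -/(gramM _) fE /root horner_comp !hornerE.
  exists (g \Po ('X - r%:P)); last by rewrite /root horner_comp !hornerE subrr.
  rewrite -/(gramM _) fE in gE.
  have <- : (f \Po ('X + r%:P)) \Po ('X - r%:P) = f.
    by rewrite -comp_polyA comp_polyD comp_polyX comp_polyC subrK comp_polyXr.
  by rewrite gE comp_polyM comp_Xn_poly.
(* The same at t = infinity, moved to 0 by [wmat]: order exactly 2 there kills the coefficients of
   t^11 and t^12 in f and leaves a nonzero one at t^10. *)
have [H12 H22 H02] : [/\ H o1 o2 = 0, H o2 o2 = 0 & H o0 o2 != 0].
  have [d d0 dE] := qsim_conj c0 cE (qsim_wmat k).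
  have uM' : wmat k *m M \in unitmx by rewrite unitmx_mul (qsim_unit char_k) ?uM //; apply: qsim_wmat.
  have [|g gE g0] := double_zero (char_k := char_k) uG tangentS uM' d0 dE.
    apply/par_gram0 => //; rewrite mulmxA.
    have -> : vec3 1 0 0 *m wmat k = vec3 0 0 1 by rewrite /wmat !mat3S; congr vec3; ring.
    by rewrite -P'E.
  rewrite -/(gramM _) gramMM -/H in gE.
  have HE n : ('X^2 * g)`_n = \sum_(i < 3) \sum_(j < 3)
      (wmat k *m H *m (map_mx frob (wmat k))^T) i j *+ (n == i + 5 * j)%N.
    by rewrite -gE hermitian_coef.
  have wE i j : (wmat k *m H *m (map_mx frob (wmat k))^T) i j = H (rev_ord i) (rev_ord j).
    have wA A u (v : 'I_3) : (wmat k *m A) u v = A (rev_ord u) v.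
      rewrite mulmx3E; move: u; apply: ord3P; rewrite !mxE /= !(mul0r, mul1r, add0r, addr0);
        by congr (A _ v); apply: val_inj.
    have -> : map_mx frob (wmat k) = wmat k by rewrite /wmat map_mat3 !rmorph0 !rmorph1.
    by rewrite -mulmxA wA -[_ *m _]trmxK trmx_mul trmxK mxE wA mxE.
  have e20 : rev_ord o0 = o2 by apply: val_inj.
  have e11 : rev_ord o1 = o1 by apply: val_inj.
  have e02 : rev_ord o2 = o0 by apply: val_inj.
  split.
  - have := HE 1%N; rewrite !big_ord3 !wE e20 e11 e02 /= coefXnM /= !mulr0n !addr0 !add0r mulr1n.
    by [].
  - have := HE 0%N; rewrite !big_ord3 !wE e20 e11 e02 /= coefXnM /= !mulr0n !addr0 mulr1n.
    by [].
  have := HE 2%N; rewrite !big_ord3 !wE e20 e11 e02 /= coefXnM /= !mulr0n !addr0 !add0r mulr1n.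
  by move=> <-; rewrite -horner_coef0.
have [d [a [d0 a0 HE]]] := square_hermitian char_k H12 H22 H02 f00 f_roots.
(* The substitution t -> l t with l^4 = -a turns t^5 + a t into a multiple of t^5 - t, and m then
   normalizes the remaining scalar. *)
have [l lE] := @nth_root 4 (- a) isT.
have l0 : l != 0 by apply: contraNneq a0 => l0; rewrite -oppr_eq0 -lE l0 expr0n.
have [m mE] := @nth_root 6 (d * l ^+ 10)^-1 isT.
have m0 : m != 0.
  apply: contraNneq d0 => m0; move: mE; rewrite m0 expr0n => /esym/eqP.
  by rewrite invr_eq0 mulf_eq0 expf_eq0 (negbTE l0) andbF orbF.
have qD : qsim (dmat m (m * l) (m * l ^+ 2)) by apply: qsim_dmat; rewrite ?mulf_neq0 //; ring.
exists (dmat m (m * l) (m * l ^+ 2) *m M); last first.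
  rewrite (conic_qsim char_k) // /conic.
  have -> : quadric S = c *: subst (invmx M) (qconic k).
    rewrite -substZ (qconicE char_k) -quadricZ -cE -subst_quadric substM mulVmx //.
    by rewrite subst1.
  apply/seteqP; split=> R; rewrite /zeros /= mevalZ; last by move=> ->; rewrite mulr0.
  by move/eqP; rewrite mulf_eq0 (negbTE c0) => /eqP.
have aE : a = - l ^+ 4 by rewrite lE opprK.
have m6 : m ^+ 6 * (d * l ^+ 10) = 1.
  by rewrite mE mulVf // mulf_neq0 // expf_neq0.
rewrite /is_frame -/(gramM _) gramMM -/H HE /H0 /dmat !mat3S !frobE.
have l4 : l ^+ 4 != 0 by rewrite expf_neq0.
apply: mat3_congr; split; rewrite !(mulr0, mul0r, addr0, add0r, mulr1, mul1r) ?expr0n /= ?mulr0 ?addr0 //.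
- by rewrite -m6; ring.
- by apply: (mulfI l4); rewrite aE -[- 2%:R]mulr1 -m6; ring.
by rewrite -m6 aE; ring.
Qed.

End Herm.
End TotallyTangentFrames.

(** * A computable copy of F_25 *)

Inductive f5 := F0 | F1 | F2 | F3 | F4.

Definition nat_of_f5 x : nat :=
  match x with F0 => 0 | F1 => 1 | F2 => 2 | F3 => 3 | F4 => 4 end.
Definition suc5 x := match x with F0 => F1 | F1 => F2 | F2 => F3 | F3 => F4 | F4 => F0 end.
Definition pre5 x := match x with F0 => F4 | F1 => F0 | F2 => F1 | F3 => F2 | F4 => F3 end.
Definition opp5 x := match x with F0 => F0 | F1 => F4 | F2 => F3 | F3 => F2 | F4 => F1 end.
Definition dbl5 x := match x with F0 => F0 | F1 => F2 | F2 => F4 | F3 => F1 | F4 => F3 end.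
Definition inv5 x := match x with F0 => F0 | F1 => F1 | F2 => F3 | F3 => F2 | F4 => F4 end.
Definition add5 x y :=
  match x with
  | F0 => y | F1 => suc5 y | F2 => suc5 (suc5 y) | F3 => pre5 (pre5 y) | F4 => pre5 y
  end.
Definition mul5 x y :=
  match x with
  | F0 => F0 | F1 => y | F2 => dbl5 y | F3 => opp5 (dbl5 y) | F4 => opp5 y
  end.
Definition eq5 x y :=
  match x, y with
  | F0, F0 | F1, F1 | F2, F2 | F3, F3 | F4, F4 => true
  | _, _ => false
  end.
Definition all5 := [:: F0; F1; F2; F3; F4].

(* [E a b] stands for [a + b r] with [r^2 = 2], a non-square modulo 5. *)
Inductive f25 := E (a b : f5).

Definition z25 := E F0 F0.
Definition u25 := E F1 F0.
Definition add25 x y := let: E a b := x in let: E c d := y in E (add5 a c) (add5 b d).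
Definition opp25 x := let: E a b := x in E (opp5 a) (opp5 b).
Definition sub25 x y := add25 x (opp25 y).
Definition mul25 x y :=
  let: E a b := x in let: E c d := y in
  E (add5 (mul5 a c) (dbl5 (mul5 b d))) (add5 (mul5 a d) (mul5 b c)).
Definition conj25 x := let: E a b := x in E a (opp5 b).
Definition inv25 x :=
  let: E a b := x in
  let n := inv5 (add5 (mul5 a a) (opp5 (dbl5 (mul5 b b)))) in
  E (mul5 a n) (opp5 (mul5 b n)).
Definition eq25 x y := let: E a b := x in let: E c d := y in eq5 a c && eq5 b d.
Definition two25 := E F2 F0.
Definition all25 := [seq E a b | a <- all5, b <- all5].
Arguments all25 : simpl never.

Inductive v25 := V (x y z : f25).
Inductive m25 := M (p q r : v25).

Definition vadd u v :=
  let: V a b c := u in let: V d e f := v in V (add25 a d) (add25 b e) (add25 c f).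
Definition vscale s u := let: V a b c := u in V (mul25 s a) (mul25 s b) (mul25 s c).
Definition vmul u A :=
  let: V a b c := u in let: M p q r := A in
  vadd (vscale a p) (vadd (vscale b q) (vscale c r)).
Definition mmul A B := let: M p q r := A in M (vmul p B) (vmul q B) (vmul r B).

(* The inverse [H0 conj(A)^T H0^-1] of a unitary matrix [A]. *)
Definition minv A :=
  let: M (V a b c) (V d e f) (V g h i) := A in
  M (V (conj25 i) (mul25 two25 (conj25 f)) (conj25 c))
    (V (opp25 (mul25 two25 (conj25 h))) (conj25 e) (opp25 (mul25 two25 (conj25 b))))
    (V (conj25 g) (mul25 two25 (conj25 d)) (conj25 a)).

Definition veq u v :=
  let: V a b c := u in let: V d e f := v in [&& eq25 a d, eq25 b e & eq25 c f].
Definition meq A B :=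
  let: M p q r := A in let: M p' q' r' := B in [&& veq p p', veq q q' & veq r r'].
Definition id25 := M (V u25 z25 z25) (V z25 u25 z25) (V z25 z25 u25).
Definition isU A := meq (mmul A (minv A)) id25.

Definition qc25 u := let: V a b c := u in sub25 (mul25 b b) (mul25 a c).
Definition polar25 u v :=
  let: V a b c := u in let: V d e f := v in
  sub25 (mul25 two25 (mul25 b e)) (add25 (mul25 a f) (mul25 c d)).
Definition is0 x := eq25 x z25.
Definition qs25 A :=
  let: M p q r := A in
  [&& is0 (qc25 p), is0 (qc25 r), is0 (polar25 p q), is0 (polar25 q r),
      is0 (add25 (polar25 p r) (qc25 q)) & ~~ is0 (qc25 q)].
Definition cross25 u v :=
  let: V a b c := u in let: V d e f := v in
  V (sub25 (mul25 b f) (mul25 c e)) (sub25 (mul25 c d) (mul25 a f)) (sub25 (mul25 a e) (mul25 b d)).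
Definition dot25 u v :=
  let: V a b c := u in let: V d e f := v in
  add25 (mul25 a d) (add25 (mul25 b e) (mul25 c f)).
Definition det25 A := let: M p q r := A in dot25 p (cross25 q r).

Definition base25 := [:: V u25 z25 z25; V u25 u25 u25; V u25 (E F2 F0) (E F4 F0);
  V u25 (E F3 F0) (E F4 F0); V u25 (E F4 F0) u25; V z25 z25 u25].

Lemma eq5P x y : reflect (x = y) (eq5 x y).
Proof. by case: x; case: y; constructor. Qed.

Lemma eq25P x y : reflect (x = y) (eq25 x y).
Proof.
case: x y => [a b] [c d] /=; apply: (iffP andP) => [[/eq5P-> /eq5P->//]|[-> ->]].
by split; apply/eq5P.
Qed.

Lemma veqP u v : veq u v -> u = v.
Proof. by case: u v => [a b c] [d e f] /and3P[/eq25P-> /eq25P-> /eq25P->]. Qed.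

Lemma meqP A B : meq A B -> A = B.
Proof. by case: A B => [a b c] [d e f] /and3P[/veqP-> /veqP-> /veqP->]. Qed.

HB.instance Definition _ := hasDecEq.Build f25 eq25P.

Lemma all25P (p : pred f25) : all p all25 -> forall x, p x.
Proof. by move/allP=> H [a b]; apply: H; case: a; case: b. Qed.

(** * Embedding of the copy of F_25 into k *)

Section Embedding.
Variable k : closedFieldType.
Hypothesis char_k : 5%N \in [pchar k].
Variable r : k.
Hypothesis r2 : r ^+ 2 = 2%:R.
Local Notation frob := (frob char_k).

Definition emb5 (x : f5) : k := (nat_of_f5 x)%:R.
Definition embed (x : f25) : k := let: E a b := x in emb5 a + emb5 b * r.

Lemma emb5_mod n : (n%:R : k) = (n %% 5)%:R.
Proof. by rewrite {1}(divn_eq n 5) natrD natrM natr5 // mulr0 add0r. Qed.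

Lemma emb5D x y : emb5 (add5 x y) = emb5 x + emb5 y.
Proof. by rewrite /emb5 -natrD [RHS]emb5_mod; case: x; case: y. Qed.

Lemma emb5M x y : emb5 (mul5 x y) = emb5 x * emb5 y.
Proof. by rewrite /emb5 -natrM [RHS]emb5_mod; case: x; case: y. Qed.

Lemma emb5N x : emb5 (opp5 x) = - emb5 x.
Proof.
apply/eqP; rewrite -addr_eq0 -emb5D.
by apply/eqP; case: x.
Qed.

Lemma emb5_dbl x : emb5 (dbl5 x) = 2%:R * emb5 x.
Proof. by rewrite /emb5 -natrM [RHS]emb5_mod; case: x. Qed.

Lemma emb5_eq0 x : emb5 x = 0 -> x = F0.
Proof.
move/eqP; rewrite /emb5 -(dvdn_pcharf char_k).
by case: x.
Qed.

Lemma emb_add x y : embed (add25 x y) = embed x + embed y.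
Proof. by case: x y => [a b] [c d] /=; rewrite !emb5D; ring. Qed.

Lemma emb_mul x y : embed (mul25 x y) = embed x * embed y.
Proof.
case: x y => [a b] [c d] /=; rewrite !emb5D emb5_dbl !emb5M.
by rewrite -r2; ring.
Qed.

Lemma emb_opp x : embed (opp25 x) = - embed x.
Proof. by case: x => [a b] /=; rewrite !emb5N; ring. Qed.

Lemma emb_sub x y : embed (sub25 x y) = embed x - embed y.
Proof. by rewrite emb_add emb_opp. Qed.

Lemma emb0 : embed z25 = 0. Proof. by rewrite /= /emb5 mul0r addr0. Qed.
Lemma emb1 : embed u25 = 1. Proof. by rewrite /= /emb5 mul0r addr0. Qed.
Lemma emb_two : embed two25 = 2%:R. Proof. by rewrite /= /emb5 mul0r addr0. Qed.

Lemma emb5_frob x : frob (emb5 x) = emb5 x.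
Proof. by rewrite /emb5 rmorph_nat. Qed.

Lemma frob_r : frob r = - r.
Proof.
rewrite frobE; have -> : r ^+ 5 = r ^+ 2 * r ^+ 2 * r by ring.
by rewrite r2; apply: (@eq_mod5 _ char_k _ _ r); ring.
Qed.

Lemma emb_conj x : embed (conj25 x) = frob (embed x).
Proof.
case: x => [a b] /=; rewrite rmorphD rmorphM /= !emb5_frob frob_r emb5N; ring.
Qed.

(** The norm x^2 - 2 y^2 vanishes only at 0, since 2 is not a square modulo 5. *)
Lemma r_notin (x y : f5) : emb5 x + emb5 y * r = 0 -> x = F0 /\ y = F0.
Proof.
move=> E0; have E1 : emb5 x = - (emb5 y * r) by apply/eqP; rewrite -addr_eq0 E0.
have : emb5 (add5 (mul5 x x) (opp5 (dbl5 (mul5 y y)))) = 0.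
  by rewrite emb5D emb5N emb5_dbl !emb5M E1 -r2; ring.
by move/emb5_eq0; case: x {E0 E1}; case: y.
Qed.

Lemma emb_eq0 x : embed x = 0 -> x = z25.
Proof. by case: x => [a b] /= /r_notin[-> ->]. Qed.

Lemma emb_inj x y : embed x = embed y -> x = y.
Proof.
move=> xy; have : embed (sub25 x y) = 0 by rewrite emb_sub xy subrr.
move/emb_eq0; case: x y {xy} => [a b] [c d] /= [].
by case: a; case: c => //= _; case: b; case: d.
Qed.

Lemma is0P x : reflect (embed x = 0) (is0 x).
Proof.
apply: (iffP (eq25P _ _)) => [->|/emb_eq0 //]; exact: emb0.
Qed.

Lemma emb_inv x : embed x != 0 -> embed (inv25 x) = (embed x)^-1.
Proof.
move=> x0; apply: (mulfI x0); rewrite mulfV // -emb_mul -emb1; congr embed.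
move: x0; case: x => [a b]; case: a; case: b => // /eqP []; exact: emb0.
Qed.

(** The 25 elements of the image already exhaust the roots of t^25 - t. *)
Lemma fixed_emb (x : k) : x ^+ 25 = x -> exists y, x = embed y.
Proof.
move=> x25; pose p : {poly k} := 'X^25 - 'X.
have sp : size p = 26.
  by rewrite /p size_addl ?size_polyXn // size_opp size_polyX.
have p0 : p != 0 by rewrite -size_poly_eq0 sp.
have rootp z : root p z = (z ^+ 25 == z) by rewrite /root hornerD hornerN hornerXn hornerX subr_eq0.
have emb25 y : embed y ^+ 25 = embed y.
  rewrite (exprM _ 5 5) -!frobE -!emb_conj; congr embed.
  by case: y => [a b]; case: b.
have [/mapP[y _ ->]|xs] := boolP (x \in [seq embed y | y <- all25]); first by exists y.
have us : uniq [seq embed y | y <- all25] by rewrite (map_inj_uniq emb_inj).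
have uxs : uniq (x :: [seq embed y | y <- all25]) by rewrite cons_uniq xs.
have rs : all (root p) (x :: [seq embed y | y <- all25]).
  apply/allP => z; rewrite in_cons => /predU1P[->|/mapP[y _ ->]].
    by rewrite rootp x25.
  by rewrite rootp emb25.
by have := max_poly_roots p0 rs uxs; rewrite sp.
Qed.

End Embedding.

(** * Matrices over F_25 and unitary matrices *)

Section EmbedMatrices.
Variable k : closedFieldType.
Hypothesis char_k : 5%N \in [pchar k].
Variable r : k.
Hypothesis r2 : r ^+ 2 = 2%:R.
Local Notation frob := (frob char_k).
Local Notation emb := (embed r).
Local Notation unitary := (is_unitary char_k).
Local Notation Cq := (Cq k).

Definition emb_vec (u : v25) : 'rV[k]_3 := let: V a b c := u in vec3 (emb a) (emb b) (emb c).
Definition emb_mat (A : m25) : 'M[k]_3 := let: M p q s := A in mat3 (emb_vec p) (emb_vec q) (emb_vec s).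

Lemma embV_add u v : emb_vec (vadd u v) = emb_vec u + emb_vec v.
Proof.
case: u v => [a b c] [d e f] /=; rewrite !(emb_add char_k).
by apply/rowP; apply: ord3P; rewrite !mxE.
Qed.

Lemma embV_scale s u : emb_vec (vscale s u) = emb s *: emb_vec u.
Proof. by case: u => [a b c]; rewrite /vscale /emb_vec !(emb_mul char_k r2) scale_vec3. Qed.

Lemma embV_mul u A : emb_vec (vmul u A) = emb_vec u *m emb_mat A.
Proof.
case: u A => [a b c] [p q s]; rewrite /vmul !embV_add !embV_scale mulmx3.
by rewrite /emb_vec /emb_mat !vec3_0 vec3_1 vec3_2 row_mat3_0 row_mat3_1 row_mat3_2 addrA.
Qed.

Lemma embM_mul A B : emb_mat (mmul A B) = emb_mat A *m emb_mat B.
Proof. by case: A => [p q s]; rewrite {1}/emb_mat /mmul !embV_mul /emb_mat mat3_mul. Qed.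

Lemma embM_id : emb_mat id25 = 1%:M.
Proof.
rewrite /id25 /emb_mat /emb_vec !emb0 !emb1; apply/matrixP; apply: ord3P; apply: ord3P;
  by rewrite !mxE.
Qed.

Lemma embV_inj u v : emb_vec u = emb_vec v -> u = v.
Proof.
case: u v => [a b c] [d e f] /rowP H.
have := H o0; have := H o1; have := H o2; rewrite !mxE /=.
by move=> /(emb_inj char_k r2)-> /(emb_inj char_k r2)-> /(emb_inj char_k r2)->.
Qed.

Lemma embM_inj A B : emb_mat A = emb_mat B -> A = B.
Proof.
case: A B => [p q s] [p' q' s'] H.
have /embV_inj-> : emb_vec p = emb_vec p'.
  by have := congr1 (row o0) H; rewrite /emb_mat !row_mat3_0.
have /embV_inj-> : emb_vec q = emb_vec q'.
  by have := congr1 (row o1) H; rewrite /emb_mat !row_mat3_1.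
have /embV_inj-> // : emb_vec s = emb_vec s'.
by have := congr1 (row o2) H; rewrite /emb_mat !row_mat3_2.
Qed.

Lemma embV_eq0 u : (emb_vec u == 0) = veq u (V z25 z25 z25).
Proof.
case: u => [a b c]; rewrite vec3_eq0 /=.
have E x : (emb x == 0) = eq25 x z25 by apply/eqP/(is0P char_k r2).
by rewrite !E.
Qed.

Definition H0inv : 'M[k]_3 := mat3 (vec3 0 0 1) (vec3 0 2%:R 0) (vec3 1 0 0).

Lemma H0_inv : H0 *m H0inv = 1%:M.
Proof.
rewrite /H0 /H0inv !mat3S -embM_id /id25 /emb_mat /emb_vec !emb0 !emb1; apply: mat3_congr; split; try ring.
by apply: (@eq_mod5 _ char_k _ _ (- 1)); ring.
Qed.

Lemma embM_minv A : emb_mat (minv A) = H0 *m (map_mx frob (emb_mat A))^T *m H0inv.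
Proof.
case: A => [[a b c] [d e f] [g h i]]; rewrite /minv /emb_mat /emb_vec.
rewrite /H0 /H0inv !mat3S ?(emb_opp char_k) ?(emb_mul char_k r2) !(emb_conj char_k) // emb_two.
apply: mat3_congr; split; try ring.
by apply: (@eq_mod5 _ char_k _ _ (frob (emb e))); ring.
Qed.

Lemma isUP A : isU A -> unitary (emb_mat A).
Proof.
move/meqP/(congr1 emb_mat); rewrite embM_mul embM_minv embM_id !mulmxA => E.
by rewrite /unitary -[LHS]mulmx1 -(mulmx1C H0_inv) mulmxA E mul1mx.
Qed.

Lemma unitary_mul_minv A : unitary (emb_mat A) -> emb_mat A *m emb_mat (minv A) = 1%:M.
Proof. by move=> uA; rewrite embM_minv !mulmxA uA H0_inv. Qed.

Lemma unitary_isU A : unitary (emb_mat A) -> isU A.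
Proof.
move=> uA; have -> : isU A = meq id25 id25; last by [].
rewrite /isU; congr meq; apply: embM_inj.
by rewrite embM_mul unitary_mul_minv // embM_id.
Qed.

Lemma embM_minvE A : isU A -> emb_mat (minv A) = invmx (emb_mat A).
Proof.
move=> uA; have uA' := unitary_unit (isUP uA).
by rewrite -[LHS](mulKmx uA') (unitary_mul_minv (isUP uA)) mulmx1.
Qed.

Lemma isU_mul A B : isU A -> isU B -> isU (mmul A B).
Proof.
by move=> uA uB; apply: unitary_isU; rewrite embM_mul; apply: unitaryM; apply: isUP.
Qed.

Lemma unitaryV X : unitary X -> unitary (invmx X).
Proof.
move=> uX; have uX' := unitary_unit uX.
rewrite /unitary -{1}uX map_invmx trmx_inv !mulmxA mulVmx // mul1mx -mulmxA mulmxV ?mulmx1 //.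
by rewrite unitmx_tr map_unitmx.
Qed.

Lemma isU_minv A : isU A -> isU (minv A).
Proof.
by move=> uA; apply: unitary_isU; rewrite embM_minvE //; apply/unitaryV/isUP.
Qed.

(* A unitary matrix is fixed by the square of the Frobenius. *)
Lemma unitary_emb X : unitary X -> exists2 A, isU A & X = emb_mat A.
Proof.
move=> uX; have uX' := unitary_unit uX.
have fH : map_mx frob H0 = H0.
  by rewrite /H0 map_mat3 !rmorph0 !rmorph1 rmorphN rmorph_nat.
have H0T : (H0 : 'M[k]_3)^T = H0 by rewrite /H0 tr_mat3.
pose Y := map_mx frob X.
have YH : Y *m H0 \in unitmx by rewrite unitmx_mul map_unitmx uX' unit_H0.
(* Applying the Frobenius to the unitarity relation gives Y H0 Frob(Y)^T = H0, transposing it gives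
   Y H0 X^T = H0, and [Y *m H0] is invertible. *)
have Xff : map_mx frob Y = X.
  apply/trmx_inj/(can_inj (mulKmx YH)).
  transitivity (H0 : 'M[k]_3); first by rewrite -[in RHS]fH -[in RHS]uX !map_mxM map_trmx fH.
  by rewrite -[LHS]H0T -[in LHS]uX !trmx_mul trmxK H0T mulmxA.
have [A XA] : exists A, X = emb_mat A.
  have ent i j : exists x, X i j = emb x.
    apply: (fixed_emb char_k r2); rewrite (exprM _ 5 5) -[_ ^+ 5]/(frob _) -[X i j ^+ 5]/(frob _).
    by rewrite -[in RHS]Xff !mxE.
  have [a00 e00] := ent o0 o0; have [a01 e01] := ent o0 o1; have [a02 e02] := ent o0 o2.
  have [a10 e10] := ent o1 o0; have [a11 e11] := ent o1 o1; have [a12 e12] := ent o1 o2.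
  have [a20 e20] := ent o2 o0; have [a21 e21] := ent o2 o1; have [a22 e22] := ent o2 o2.
  exists (M (V a00 a01 a02) (V a10 a11 a12) (V a20 a21 a22)).
  rewrite /emb_mat /emb_vec -e00 -e01 -e02 -e10 -e11 -e12 -e20 -e21 -e22.
  by apply/matrixP; apply: ord3P; apply: ord3P; rewrite !mxE.
by exists A => //; apply: unitary_isU; rewrite -XA.
Qed.

End EmbedMatrices.

(** * Tables *)

Section Tables.
Local Open Scope nat_scope.

(** [tau25], [dl25] and [w25] act on the parameter of the standard conic by s -> s + 1, s -> 2 s and
    s -> 1 / s; these generate PGL_2(F_5). *)
Definition tau25 := M (V u25 u25 u25) (V z25 u25 two25) (V z25 z25 u25).
Definition dl25 := M (V (E F3 F0) z25 z25) (V z25 u25 z25) (V z25 z25 two25).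
Definition w25 := M (V z25 z25 u25) (V z25 u25 z25) (V u25 z25 z25).

(* Modulo scalars, [y25] and [x25] generate a Frobenius group of order 21 acting
   regularly on the conics of one component. *)
Definition x25 := M (V (E F2 F0) z25 (E F0 F2)) (V u25 u25 (E F0 F1))
  (V (E F2 F2) (E F4 F0) (E F2 F2)).
Definition y25 := M (V (E F0 F1) z25 (E F4 F0)) (V (E F0 F4) (E F4 F0) u25)
  (V (E F1 F4) (E F3 F0) (E F1 F4)).
Definition mpow A n := iter n (mmul A) id25.
(** The order of the list matters: position 7 j + i holds y^j x^i. *)
Definition D25 := Eval vm_compute in
  [seq mmul (mpow y25 j) (mpow x25 i) | j <- iota 0 3, i <- iota 0 7].
(** The default [id25] keeps [Dn n] unitary, and in the stabilizer, for every n. *)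
Definition Dn n := nth id25 D25 n.

Definition on25 A u := is0 (qc25 (vmul u (minv A))).
Definition iso25 u := let: V a b c := u in
  is0 (add25 (sub25 (mul25 a (conj25 c)) (mul25 two25 (mul25 b (conj25 b)))) (mul25 c (conj25 a))).

(** For each conic of the component, with frame [A], the frame [A a] differs from some [B] of the
    list by a similitude of the standard conic. *)
Definition stab25 a :=
  all (fun A => has (fun B => qs25 (mmul (mmul A a) (minv B))) D25) D25.
Definition gens25 := [:: tau25; dl25; w25; x25; y25].

Definition points25 := Eval vm_compute in [seq [seq vmul u A | u <- base25] | A <- D25].
(** Entry (i, j) counts the tangency points of the i-th conic of D lying on the j-th conic of D';
    these are all the points common to both conics and to the sextic. *)
Definition incidences X :=
  let invs := [seq minv (mmul B X) | B <- D25] in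
  [seq [seq count (fun P => is0 (qc25 (vmul P Bi))) pts | Bi <- invs] | pts <- points25].

Definition rowtype (s : seq nat) : option conic_type :=
  let n0 := count_mem 0 s in let n1 := count_mem 1 s in let n2 := count_mem 2 s in
  if [&& n0 == 18, n1 == 0 & n2 == 3] then Some alpha
  else if [&& n0 == 16, n1 == 4 & n2 == 1] then Some beta
  else if [&& n0 == 15, n1 == 6 & n2 == 0] then Some gamma else None.
Definition is_type (t u : option conic_type) :=
  match t, u with
  | Some alpha, Some alpha | Some beta, Some beta | Some gamma, Some gamma => true
  | _, _ => false
  end.
Definition comptype X : option component_type :=
  let ts := [seq rowtype s | s <- incidences X] in
  if all (is_type (Some beta)) ts then Some beta21
  else if all (is_type (Some gamma)) ts then Some gamma21
  else if all (fun t => is_type (Some alpha) t || is_type (Some gamma) t) ts then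
    let na := count (is_type (Some alpha)) ts in
    let ng := count (is_type (Some gamma)) ts in
    if (na == 15) && (ng == 6) then Some alpha15gamma6
    else if (na == 3) && (ng == 18) then Some alpha3gamma18 else None
  else None.

(* The upper triangular unitary matrix with first row [(a, d, g)] and middle
   entry 1. *)
Definition rep25 a d g :=
  M (V a d g) (V z25 u25 (conj25 (mul25 (mul25 two25 d) (inv25 a)))) (V z25 z25 (conj25 (inv25 a))).
(** Representatives of F_25^* modulo F_5^*: left multiplication by [dl25] multiplies a by 3, a
    generator of F_5^*. *)
Definition ra25 := [:: u25; E F0 F1; E F1 F1; E F2 F1; E F3 F1; E F4 F1].
(** Multiplying by [tau25] on the left adds 1 to d, on the right it adds a. Unless a = 1, the
    elements 1 and a span F_25 over F_5, and d can be made 0. *)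
Definition rd25 a := if eq25 a u25 then [seq E F0 b | b <- all5] else [:: z25].
Definition lines25 := Eval vm_compute in
  [seq cross25 (nth (V z25 z25 z25) base25 i) (nth (V z25 z25 z25) base25 j) |
     i <- iota 0 5, j <- iota i.+1 (5 - i)].

(** These are the secants common to the standard conic and its image under A: one of the 15 lines
    belongs to the image as soon as it carries two of its tangency points. *)
Definition nsec25 A :=
  let pts := [seq vmul u A | u <- base25] in
  count (fun l => 1 < count (fun P => is0 (dot25 P l)) pts) lines25.
(* The coefficients of the quartic in [t] that vanishes where the point
   [(1, t, t^2)] of the standard conic lies on its image under [A]. *)
Definition quartic25 A :=
  let: M p q s := minv A in
  (qc25 p, polar25 p q, add25 (qc25 q) (polar25 p s), polar25 q s, qc25 s).
(* The quartic of [A] has fewer than four roots (a root at infinity being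
   counted), as it is [c (t^2 + a t + b)^2] or has degree 2. *)
Definition bad25 A :=
  let: (f0, f1, f2, f3, f4) := quartic25 A in
  [&& is0 f4, is0 f3 & ~~ is0 f2] ||
  let a := mul25 f3 (inv25 (mul25 two25 f4)) in
  let b := mul25 (sub25 (mul25 f2 (inv25 f4)) (mul25 a a)) (inv25 two25) in
  [&& ~~ is0 f4, eq25 f3 (mul25 two25 (mul25 f4 a)),
      eq25 f2 (mul25 f4 (add25 (mul25 a a) (mul25 two25 b))),
      eq25 f1 (mul25 two25 (mul25 f4 (mul25 a b))) & eq25 f0 (mul25 f4 (mul25 b b))].
Definition nonadj25 A := (nsec25 A != 3) || bad25 A.
(** The quartic is then f (t^4 + 2 d t^2 + 1) with d^2 = 2, that is, f ((t^2 + d)^2 - 1), which has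
    four distinct finite roots. *)
Definition good25 A :=
  let: (f0, f1, f2, f3, f4) := quartic25 A in
  let rf := mul25 (E F0 F2) f0 in
  [&& nsec25 A == 3, is0 f1, is0 f3, eq25 f0 f4, ~~ is0 f4 & eq25 f2 rf || eq25 f2 (opp25 rf)].

Definition sqdet1 A := eq25 (mul25 (det25 A) (det25 A)) u25.
Definition is_a15 T := if T is Some alpha15gamma6 then true else false.
Definition is_g21 T := if T is Some gamma21 then true else false.
Definition is_other T :=
  match T with Some beta21 | Some alpha3gamma18 => true | _ => false end.
(* If [T(D, D') = gamma^21], then one of these matrices carries [D] to a common
   neighbour of [D] and [D']. *)
Definition nbrs25 := [:: rep25 u25 z25 (E F0 F1); rep25 u25 z25 (E F0 F4); rep25 (E F0 F1) z25 z25;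
  rep25 (E F0 F1) (E F0 F1) (E F0 F1); rep25 (E F0 F1) (E F0 F2) (E F0 F4);
  rep25 (E F0 F1) (E F0 F3) (E F0 F4); rep25 (E F0 F1) (E F0 F4) (E F0 F1)].
Definition rep_ok A :=
  if meq A id25 then true else
  all (fun B => nonadj25 (mmul B A)) D25 &&
  let T := comptype A in
  if sqdet1 A then
    is_a15 T || (is_g21 T && has (fun c => is_a15 (comptype (mmul A (minv c)))) nbrs25)
  else is_other T.

Lemma check_stab : all (fun a => [&& isU a, sqdet1 a, stab25 a & stab25 (minv a)]) gens25.
Proof. by vm_compute. Qed.
(** Every isotropic point lies on one of the 21 conics, which is what makes the triangular reduction
    possible. *)
Lemma check_cover : all (fun b => all (fun c => iso25 (V u25 b c) ==>
  has (fun A => on25 A (V u25 b c)) D25) all25) all25.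
Proof. by vm_compute. Qed.
(** A tangency point of the i-th conic lies on no other conic of the component, so the 21 conics are
    distinct. *)
Lemma check_distinct : all (fun i => all (fun j => (i == j) ||
  ~~ on25 (Dn j) (vmul (V z25 z25 u25) (Dn i))) (iota 0 21)) (iota 0 21).
Proof. by vm_compute. Qed.
Lemma check_reps : all (fun a => all (fun d => all (fun g =>
  isU (rep25 a d g) ==> rep_ok (rep25 a d g)) all25) (rd25 a)) ra25.
Proof. by vm_compute. Qed.
Lemma check_nbrs : all (fun c => isU c && is_a15 (comptype c)) nbrs25.
Proof. by vm_compute. Qed.
Lemma check_adj : good25 x25 && good25 y25.
Proof. by vm_compute. Qed.
Lemma check_ra : all (fun a => is0 a || has (fun i => has (eq25 (iter i (mul25 (E F3 F0)) a)) ra25) (iota 0 4)) all25.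
Proof. by vm_compute. Qed.
Lemma check_rd : all (fun a => all (fun d => has (fun i => has (fun j =>
   has (eq25 (iter j (add25 a) (iter i (add25 u25) d))) (rd25 a)) (iota 0 5)) (iota 0 5)) all25) ra25.
Proof. by vm_compute. Qed.
Lemma check_Dn : all (fun n => meq (Dn n) (mmul (mpow y25 (n %/ 7)) (mpow x25 (n %% 7)))) (iota 0 21).
Proof. by vm_compute. Qed.

End Tables.

(** * From the tables to the types t and T *)

Lemma card_uniq_seq (T : eqType) (x0 : T) (s : seq T) : uniq s -> [set` s] #= `I_(size s).
Proof.
move=> us; have -> : [set` s] = nth x0 s @` `I_(size s).
  apply/seteqP; split=> x /=; first by move=> xs; exists (index x s); rewrite ?nth_index // /= index_mem.
  by move=> [n ns <-]; apply: mem_nth.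
by apply: inj_card_eq => n m; rewrite !inE /= => ns ms /eqP; rewrite nth_uniq // => /eqP.
Qed.

Lemma card_image_count (T : Type) (f : nat -> T) N (p : pred nat) :
  (forall n m, (n < N)%N -> (m < N)%N -> f n = f m -> n = m) ->
  [set y | exists n, [/\ (n < N)%N, p n & y = f n]] #= `I_(count p (iota 0 N)).
Proof.
move=> fI; have -> : [set y | exists n, [/\ (n < N)%N, p n & y = f n]] =
    f @` [set` filter p (iota 0 N)].
  apply/seteqP; split=> y /=.
    by move=> [n [nN pn ->]]; exists n; rewrite ?mem_filter ?mem_iota ?pn.
  by move=> [n + <-]; rewrite mem_filter mem_iota add0n => /andP[pn nN]; exists n.
rewrite -size_filter; apply: (card_eq_trans (B := [set` filter p (iota 0 N)])).
  apply: inj_card_eq => n m; rewrite !inE /= !mem_filter !mem_iota !add0n.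
  by move=> /andP[_ nN] /andP[_ mN]; apply: fI.
by apply: (card_uniq_seq 0%N); rewrite filter_uniq ?iota_uniq.
Qed.

Lemma card_I_uniq (T : Type) (A : set T) n m : A #= `I_n -> A #= `I_m -> n = m.
Proof. by move=> An Am; apply/card_eq_II/(card_eq_trans _ Am); rewrite card_eq_sym. Qed.

Section Connect.
Variable k : closedFieldType.
Hypothesis char_k : 5%N \in [pchar k].
Variable r : k.
Hypothesis r2 : r ^+ 2 = 2%:R.
Variable G : 'M[k]_3.
Let F := hermitian G.
Local Notation emb := (embed r).
Local Notation embV := (emb_vec r).
Local Notation embM := (emb_mat r).
Local Notation unitary := (is_unitary char_k).
Local Notation frame := (is_frame char_k G).
Implicit Types (B : 'M[k]_3) (A X : m25).

Lemma qc25P u : is0 (qc25 u) <-> embV u 0 o1 ^+ 2 = embV u 0 o0 * embV u 0 o2.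
Proof.
case: u => [a b c]; rewrite /emb_vec vec3_0 vec3_1 vec3_2 /qc25.
split=> [/(is0P char_k r2)|E]; last apply/(is0P char_k r2);
  rewrite (emb_sub char_k) !(emb_mul char_k r2) -expr2.
  by move/eqP; rewrite subr_eq0 => /eqP.
by rewrite E subrr.
Qed.

Lemma frame_embM A B : isU A -> frame B -> frame (embM A *m B).
Proof. by move=> uA; apply: frameM; apply: (isUP char_k r2). Qed.

Lemma on25P A u B : isU A -> frame B -> embV u != 0 ->
  conic (embM A *m B) (pt (embV u *m B)) <-> on25 A u.
Proof.
move=> uA fB u0; have fAB := frame_embM uA fB.
have uM := unitary_unit (isUP char_k r2 uA).
have vE : embV (vmul u (minv A)) = embV u *m invmx (embM A).
  by rewrite (embV_mul char_k r2) (embM_minvE char_k r2).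
have -> : embV u *m B = embV (vmul u (minv A)) *m (embM A *m B).
  by rewrite vE mulmxA mulmxKV.
rewrite conic_pt ?(frame_unit fAB) //; first by rewrite /on25 qc25P.
by rewrite vE mulmx_unit_neq0 ?unitmx_inv.
Qed.

Lemma base25E n : (n < 6)%N -> embV (nth (V z25 z25 z25) base25 n) = nvec k n.
Proof.
have sq m : (m%:R ^+ 2 : k) = (m * m %% 5)%:R by rewrite expr2 -natrM -emb5_mod.
by case: n => [|[|[|[|[|[|n]]]]]] //= _; rewrite /emb_vec /embed /emb5 /nvec /= ?sq /= !mul0r !addr0.
Qed.

Lemma Dn_isU n : isU (Dn n).
Proof.
have H : all isU D25 by [].
have [n21|n21] := ltnP n (size D25); first exact: (all_nthP id25 H).
by rewrite /Dn nth_default.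
Qed.

(** [componentG_DD] identifies this set with the connected component of [conic B] in G. *)
Definition DD B : set (set (point k)) :=
  [set Q | exists2 n, (n < 21)%N & Q = conic (embM (Dn n) *m B)].

Lemma DD_inj B n m : frame B -> (n < 21)%N -> (m < 21)%N ->
  conic (embM (Dn n) *m B) = conic (embM (Dn m) *m B) -> n = m.
Proof.
move=> fB n21 m21 E.
have /allP/(_ n) := check_distinct; rewrite mem_iota n21 => /(_ isT).
move/allP/(_ m); rewrite mem_iota m21 => /(_ isT)/orP[/eqP//|].
have e2 : V z25 z25 u25 = nth (V z25 z25 z25) base25 5 by [].
have e0 : embV (V z25 z25 u25) != 0 by rewrite e2 base25E ?nvec_neq0.
have uDn := unitary_unit (isUP char_k r2 (Dn_isU n)).
case/negP; apply/(on25P (Dn_isU m) fB).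
  by rewrite (embV_mul char_k r2) mulmx_unit_neq0.
rewrite -E (embV_mul char_k r2) -mulmxA.
have : (conic (embM (Dn n) *m B) `&` zeros F) (pt (embV (V z25 z25 u25) *m (embM (Dn n) *m B))).
  apply/(frame_nvec (char_k := char_k) _ (frame_embM (Dn_isU n) fB)).
  by exists 5%N; [|rewrite e2 base25E].
by case.
Qed.

Definition cnt X i j := count (fun u => on25 (mmul (Dn j) X) (vmul u (Dn i))) base25.

Lemma incidencesE X : incidences X = mkseq (fun i => mkseq (cnt X i) 21) 21.
Proof.
have D : D25 = mkseq Dn 21 by [].
have P : points25 = mkseq (fun i => [seq vmul u (Dn i) | u <- base25]) 21 by [].
rewrite /incidences P D /mkseq -!map_comp; apply: eq_map => i.
rewrite /comp -map_comp; apply: eq_map => j.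
by rewrite /comp /cnt [LHS]count_map.
Qed.

Lemma cnt_card X B i j : isU X -> frame B ->
  conic (embM (Dn i) *m B) `&` conic (embM (Dn j) *m (embM X *m B)) `&` zeros F #= `I_(cnt X i j).
Proof.
move=> uX fB; have fi := frame_embM (Dn_isU i) fB.
have uDX : isU (mmul (Dn j) X) by apply: (isU_mul char_k r2) => //; apply: Dn_isU.
have uDi := unitary_unit (isUP char_k r2 (Dn_isU i)).
pose v0 := V z25 z25 z25.
pose p t := on25 (mmul (Dn j) X) (vmul (nth v0 base25 t) (Dn i)).
have -> : cnt X i j = count p (iota 0 6).
  have bE : base25 = mkseq (nth v0 base25) 6 by [].
  by rewrite /cnt {1}bE /mkseq count_map.
have vE t : (t < 6)%N -> embV (vmul (nth v0 base25 t) (Dn i)) *m B = nvec k t *m (embM (Dn i) *m B).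
  by move=> t6; rewrite (embV_mul char_k r2) base25E // mulmxA.
have pE t : (t < 6)%N -> p t <-> conic (embM (Dn j) *m (embM X *m B)) (pt (nvec k t *m (embM (Dn i) *m B))).
  move=> t6; rewrite mulmxA -(embM_mul char_k r2) -vE //; apply: iff_sym; apply: on25P => //.
  by rewrite (embV_mul char_k r2) mulmx_unit_neq0 // base25E // nvec_neq0.
have := @card_image_count _ (fun t => pt (nvec k t *m (embM (Dn i) *m B))) 6 p
  (fun n m n6 m6 => nvec_pt_inj fi n6 m6).
congr (is_true (_ #= _)); apply/seteqP; split=> P /=.
  move=> [t [t6 pt_t ->]]; have [h1 h2] : (conic (embM (Dn i) *m B) `&` zeros F) (pt (nvec k t *m (embM (Dn i) *m B))).
    by apply/(frame_nvec (char_k := char_k) _ fi); exists t.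
  by split; [split; [exact: h1|exact/pE]|exact: h2].
move=> [[h1 h2] h3]; have /(frame_nvec (char_k := char_k) _ fi)[t t6 PE] :
    (conic (embM (Dn i) *m B) `&` zeros F) P by [].
by exists t; split; [exact: t6|apply/(pE t t6); rewrite -PE|exact: PE].
Qed.

(** The counts of 0, 1 and 2 prescribed by a type add up to 21, the length of the row, so no other
    value occurs. *)
Lemma rowtype_count s t n : size s = 21 -> rowtype s = Some t ->
  count_mem n s = nth 0%N (value_counts t) n.
Proof.
move=> s21; rewrite /rowtype.
have split3 a b c : a + b + c = 21 -> count_mem 0%N s = a -> count_mem 1%N s = b ->
    count_mem 2 s = c -> (2 < n)%N -> count_mem n s = 0%N.
  move=> abc c0 c1 c2 n2.
  have : (count_mem 0%N s + count_mem 1%N s + count_mem 2 s + count_mem n s <= size s)%N.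
    elim: s {s21 c0 c1 c2} => //= x s IHs.
    have : ((x == 0) + (x == 1) + (x == 2) + (x == n) <= 1)%N.
      by case: x => [|[|[|x]]] //=; case: eqP => //; lia.
    lia.
  by rewrite c0 c1 c2 s21; lia.
have fin a b c : a + b + c = 21 -> count_mem 0%N s = a -> count_mem 1%N s = b ->
    count_mem 2 s = c -> count_mem n s = nth 0%N [:: a; b; c] n.
  move=> abc c0 c1 c2; have := split3 a b c abc c0 c1 c2.
  by case: n {split3} => [|[|[|n]]] //= -> //; rewrite nth_nil.
case: and3P => [[/eqP c0 /eqP c1 /eqP c2] [<-]|_]; first exact: fin.
case: and3P => [[/eqP c0 /eqP c1 /eqP c2] [<-]|_]; first exact: fin.
by case: and3P => [[/eqP c0 /eqP c1 /eqP c2] [<-]|_] //; exact: fin.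
Qed.

Lemma conic_typeP X B i t : isU X -> frame B -> (i < 21)%N ->
  rowtype (nth [::] (incidences X) i) = Some t ->
  has_conic_type F (conic (embM (Dn i) *m B)) (DD (embM X *m B)) t.
Proof.
move=> uX fB i21; rewrite incidencesE nth_mkseq // => rt n.
have fXB := frame_embM uX fB.
rewrite -(rowtype_count n _ rt) ?size_mkseq // count_map.
have := @card_image_count _ (fun j => conic (embM (Dn j) *m (embM X *m B))) 21
  (fun j => cnt X i j == n) (fun n m n6 m6 => DD_inj fXB n6 m6).
congr (is_true (_ #= _)); apply/seteqP; split=> Q /=.
  move=> [j [j21 /eqP cj ->]]; split; first by exists j.
  by rewrite -cj; apply: cnt_card.
move=> [[j j21 ->] cn]; exists j; split=> //; apply/eqP.
exact: (card_I_uniq (cnt_card i j uX fB) cn).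
Qed.

(** The numbers 18, 16 and 15 of conics sharing no point of the sextic with Q already separate the
    three types. *)
Lemma conic_type_uniq Q D t t' : has_conic_type F Q D t -> has_conic_type F Q D t' -> t = t'.
Proof.
move=> /(_ 0%N) H /(_ 0%N) H'; have := card_I_uniq H H'.
by case: t {H}; case: t' {H'}.
Qed.

Lemma is_typeP t u : is_type (Some t) u -> u = Some t.
Proof. by case: t; case: u => [[]|]. Qed.

Lemma component_typeP X B T : isU X -> frame B -> comptype X = Some T ->
  has_component_type F (DD B) (DD (embM X *m B)) T.
Proof.
move=> uX fB; rewrite /comptype; set ts := [seq rowtype s | s <- incidences X].
have sts : size ts = 21 by rewrite size_map incidencesE size_mkseq.
have tsE i : (i < 21)%N -> nth None ts i = rowtype (nth [::] (incidences X) i).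
  by move=> i21; rewrite (nth_map [::]) ?incidencesE ?size_mkseq.
have rowP t i : (i < 21)%N -> is_type (Some t) (nth None ts i) ->
    has_conic_type F (conic (embM (Dn i) *m B)) (DD (embM X *m B)) t.
  by move=> i21 /is_typeP; rewrite tsE //; apply: conic_typeP.
have tsP t i : (i < 21)%N -> has_conic_type F (conic (embM (Dn i) *m B)) (DD (embM X *m B)) t ->
    nth None ts i <> None -> is_type (Some t) (nth None ts i).
  move=> i21 ht; case E: (nth None ts i) => [u|] // _.
  have hu : has_conic_type F (conic (embM (Dn i) *m B)) (DD (embM X *m B)) u.
    by apply: rowP => //; rewrite E; case: u {E}.
  by rewrite (conic_type_uniq hu ht); case: t {ht hu}.
have all_ts (p : pred (option conic_type)) i : all p ts -> (i < 21)%N -> p (nth None ts i).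
  by move=> /(all_nthP None) H i21; apply: H; rewrite sts.
have cardP t : all (fun u => is_type (Some alpha) u || is_type (Some gamma) u) ts ->
    [set Q | DD B Q /\ has_conic_type F Q (DD (embM X *m B)) t] #= `I_(count (is_type (Some t)) ts).
  move=> ats.
  have -> : count (is_type (Some t)) ts = count (fun i => is_type (Some t) (nth None ts i)) (iota 0 21).
    have {1}-> : ts = mkseq (nth None ts) 21 by rewrite -{1}(mkseq_nth None ts) sts.
    by rewrite /mkseq count_map.
  have := @card_image_count _ (fun j => conic (embM (Dn j) *m B)) 21
    (fun i => is_type (Some t) (nth None ts i)) (fun n m n6 m6 => DD_inj fB n6 m6).
  congr (is_true (_ #= _)); apply/seteqP; split=> Q /=.
    by move=> [j [j21 tj ->]]; split; [exists j | apply: rowP].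
  move=> [[j j21 ->] tj]; exists j; split=> //; apply: tsP => //.
  by have := all_ts _ _ ats j21; case: (nth None ts j).
have orP' : all (fun u => is_type (Some alpha) u || is_type (Some gamma) u) ts ->
    forall Q, DD B Q -> has_conic_type F Q (DD (embM X *m B)) alpha \/
      has_conic_type F Q (DD (embM X *m B)) gamma.
  move=> ats Q [j j21 ->].
  by have /orP[?|?] := all_ts _ _ ats j21; [left|right]; apply: rowP.
case: ifP => [ats [<-] Q [j j21 ->]|_]; first by apply: rowP => //; apply: all_ts.
case: ifP => [ats [<-] Q [j j21 ->]|_]; first by apply: rowP => //; apply: all_ts.
case: ifP => // ats.
case: ifP => [/andP[/eqP na /eqP ng] [<-]|_].
  by split; [have := cardP alpha ats; rewrite na|have := cardP gamma ats; rewrite ng|apply: orP'].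

case: ifP => [/andP[/eqP na /eqP ng] [<-]|_] //.
by split; [have := cardP alpha ats; rewrite na|have := cardP gamma ats; rewrite ng|apply: orP'].
Qed.

End Connect.

(** * Special secant lines *)

Definition pairs25 := [seq (i, j) | i <- iota 0 5, j <- iota i.+1 (5 - i)].
Definition bn n := nth (V z25 z25 z25) base25 n.
Definition ln n := nth (V z25 z25 z25) lines25 n.
Definition hit A e u := is0 (dot25 (vmul (bn u) A) (ln e)).

(** Any two of the 15 lines are told apart by one of the six points, hence they are pairwise
    distinct. *)
Lemma check_lines : all (fun e => let: (i, j) := nth (0, 0) pairs25 e in
  [&& ~~ veq (ln e) (V z25 z25 z25), veq (ln e) (cross25 (bn i) (bn j)), i < 6, j < 6 &
   all (fun e' => (e == e') || has (fun u => hit id25 e u != hit id25 e' u) (iota 0 6)) (iota 0 15)])%N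
  (iota 0 15).
Proof. by vm_compute. Qed.

Lemma pairs25P i j : (i < j)%N -> (j < 6)%N ->
  exists2 e, (e < 15)%N & nth (0%N, 0%N) pairs25 e = (i, j).
Proof.
move=> ij j6; have ijP : (i, j) \in pairs25.
  by apply/allpairsPdep; exists i, j; rewrite !mem_iota; split=> //; lia.
by exists (index (i, j) pairs25); rewrite ?nth_index // -[15%N]/(size pairs25) index_mem.
Qed.

Lemma count_gt1P N (p : pred nat) :
  reflect (exists u v, [/\ (u < N)%N, (v < N)%N, u <> v, p u & p v]) (1 < count p (iota 0 N))%N.
Proof.
rewrite -size_filter; apply: (iffP idP) => [s2|[u [v [uN vN uv pu pv]]]].
  have us : uniq (filter p (iota 0 N)) by rewrite filter_uniq ?iota_uniq.
  have sP n : (n < size (filter p (iota 0 N)))%N ->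
      p (nth 0%N (filter p (iota 0 N)) n) /\ (nth 0%N (filter p (iota 0 N)) n < N)%N.
    by move/(mem_nth 0%N); rewrite mem_filter mem_iota add0n => /andP[-> /andP[_ ->]].
  exists (nth 0%N (filter p (iota 0 N)) 0), (nth 0%N (filter p (iota 0 N)) 1).
  have [p0 n0] := sP _ (ltnW s2); have [p1 n1] := sP _ s2; split=> //.
  by apply/eqP; rewrite nth_uniq // ltnW.
apply: (@leq_trans (size [:: u; v])) => //; apply: uniq_leq_size.
  by rewrite /= andbT inE; apply/eqP.
by move=> x; rewrite !inE mem_filter mem_iota => /orP[/eqP->|/eqP->]; rewrite ?pu ?pv ?uN ?vN.
Qed.

Section Lines.
Variable k : fieldType.
Implicit Types (u v w d : 'rV[k]_3) (B : 'M[k]_3).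

Definition dot u v := u 0 o0 * v 0 o0 + (u 0 o1 * v 0 o1 + u 0 o2 * v 0 o2).
Definition cross u v := vec3 (u 0 o1 * v 0 o2 - u 0 o2 * v 0 o1)
  (u 0 o2 * v 0 o0 - u 0 o0 * v 0 o2) (u 0 o0 * v 0 o1 - u 0 o1 * v 0 o0).
Definition linform d : {mpoly k[3]} := \sum_(i < 3) d 0 i *: 'X_i.
Definition lset B d : set (point k) := zeros (subst (invmx B) (linform d)).

Lemma linform_homog d : linform d \is 1.-homog.
Proof. by rewrite rpred_sum // => i _; rewrite rpredZ // dhomogX /= mdeg1. Qed.

Lemma meval_linform d v : (linform d).@[v 0] = dot v d.
Proof.
rewrite /linform raddf_sum big_ord3 /= !mevalZ !mevalXU /dot.
by rewrite ![d 0 _ * _]mulrC.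
Qed.

Lemma homog1_linform (l : {mpoly k[3]}) : l \is 1.-homog -> exists d, l = linform d.
Proof.
move: l; apply: dhomog_ind => [|c m p /eqP/mdeg1P[i /eqP->] [d ->]].
  by exists 0; rewrite /linform big1 // => i _; rewrite mxE scale0r.
exists (c *: delta_mx 0 i + d); rewrite /linform.
under [RHS]eq_bigr => j _ do rewrite !mxE scalerDl.
rewrite big_split /=; congr (_ + _); rewrite (bigD1 i) //= big1 => [|j /negbTE ji].
  by rewrite !eqxx mulr1 addr0.
by rewrite ji ?andbF mulr0 scale0r.
Qed.

(** The 2 x 2 minors of d and u x v are the coordinates of d x (u x v) = (d.v) u - (d.u) v up to
    sign, and both dot products vanish. *)
Lemma cross_unique u v d : cross u v != 0 -> d != 0 -> dot u d = 0 -> dot v d = 0 ->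
  exists2 c, c != 0 & d = c *: cross u v.
Proof.
move=> n0 d0 ud vd; set n := cross u v.
have E i j : d 0 i * n 0 j = d 0 j * n 0 i.
  apply/eqP; rewrite -subr_eq0; apply/eqP; move: i j; apply: ord3P; apply: ord3P;
    rewrite /n !mxE /= ?subrr //.
  - by transitivity (u 0 o2 * dot v d - v 0 o2 * dot u d); [rewrite /dot; ring|rewrite ud vd !mulr0 subrr].
  - by transitivity (v 0 o1 * dot u d - u 0 o1 * dot v d); [rewrite /dot; ring|rewrite ud vd !mulr0 subrr].
  - by transitivity (v 0 o2 * dot u d - u 0 o2 * dot v d); [rewrite /dot; ring|rewrite ud vd !mulr0 subrr].
  - by transitivity (u 0 o0 * dot v d - v 0 o0 * dot u d); [rewrite /dot; ring|rewrite ud vd !mulr0 subrr].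
  - by transitivity (u 0 o1 * dot v d - v 0 o1 * dot u d); [rewrite /dot; ring|rewrite ud vd !mulr0 subrr].
  - by transitivity (v 0 o0 * dot u d - u 0 o0 * dot v d); [rewrite /dot; ring|rewrite ud vd !mulr0 subrr].
have /rV0Pn[i ni] := n0.
have dE : d = (d 0 i / n 0 i) *: n.
  by apply/rowP => j; rewrite mxE mulrAC E mulfK.
by exists (d 0 i / n 0 i) => //; apply: contraNneq d0 => c0; rewrite dE c0 scale0r.
Qed.

Lemma crossvv u : cross u u = 0.
Proof. by apply/eqP; rewrite /cross vec3_eq0; apply/and3P; split; apply/eqP; ring. Qed.

Lemma lset_pt B d v : B \in unitmx -> v != 0 -> lset B d (pt (v *m B)) <-> dot v d = 0.
Proof.
move=> uB v0; have h1 := subst_homog (invmx B) (linform_homog d).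
have vB : v *m B != 0 by apply: contraNneq v0 => /(congr1 (mulmx^~ (invmx B))); rewrite mulmxK // mul0mx => ->.
rewrite /lset (zeros_pt h1 vB).
by rewrite subst_meval mulmxK // meval_linform.
Qed.

Lemma lset_line B d : B \in unitmx -> d != 0 -> line (lset B d).
Proof.
move=> uB d0; exists (subst (invmx B) (linform d)); split=> //.
  exact: subst_homog (linform_homog d).
apply: contraNneq d0 => E; have : linform d = 0.
  by rewrite -[LHS]subst1 -(mulmxV uB) -substM E rmorph0.
move=> l0; apply/eqP/rowP => i; rewrite [RHS]mxE.
have := meval_linform d (delta_mx 0 i); rewrite l0 meval0 => /esym.
rewrite /dot !mxE; move: i {l0}; apply: ord3P; rewrite /= ?mul1r ?mul0r ?addr0 ?add0r //.
Qed.

Lemma line_lset B L u v : B \in unitmx -> line L -> u != 0 -> v != 0 -> cross u v != 0 ->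
  L (pt (u *m B)) -> L (pt (v *m B)) -> L = lset B (cross u v).
Proof.
move=> uB [l [hl l0 ->]] u0 v0 n0.
have [d dE] := homog1_linform (subst_homog B hl).
have lE : l = subst (invmx B) (linform d) by rewrite -dE substM mulVmx // subst1.
have d0 : d != 0.
  apply: contraNneq l0 => d0; rewrite lE d0 /linform big1 ?rmorph0 // => i _.
  by rewrite mxE scale0r.
rewrite lE -/(lset B d) !lset_pt // => ud vd.
have [c c0 ->] := cross_unique n0 d0 ud vd.
have cE w : linform (c *: w) = c *: linform w.
  by rewrite /linform scaler_sumr; apply: eq_bigr => i _; rewrite mxE scalerA.
rewrite /lset cE substZ; apply/seteqP; split=> P; rewrite /zeros /= mevalZ; last first.
  by move=> ->; rewrite mulr0.
by move/eqP; rewrite mulf_eq0 (negbTE c0) => /eqP.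
Qed.

End Lines.

Section Secants.
Variable k : closedFieldType.
Hypothesis char_k : 5%N \in [pchar k].
Variable r : k.
Hypothesis r2 : r ^+ 2 = 2%:R.
Variable G : 'M[k]_3.
Let F := hermitian G.
Local Notation emb := (embed r).
Local Notation embV := (emb_vec r).
Local Notation embM := (emb_mat r).
Local Notation frame := (is_frame char_k G).
Implicit Types (B : 'M[k]_3) (A X : m25).

Lemma dot25P u v : is0 (dot25 u v) <-> dot (embV u) (embV v) = 0.
Proof.
case: u v => [a b c] [d e f]; rewrite /dot /emb_vec !(vec3_0, vec3_1, vec3_2) /dot25.
rewrite -!(emb_mul char_k r2) -!(emb_add char_k).
by split=> [/(is0P char_k r2)|/(is0P char_k r2)].
Qed.

Lemma embV_cross u v : embV (cross25 u v) = cross (embV u) (embV v).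
Proof.
case: u v => [a b c] [d e f]; rewrite /cross /emb_vec !(vec3_0, vec3_1, vec3_2) /cross25.
by rewrite !(emb_sub char_k) !(emb_mul char_k r2).
Qed.

Lemma ln_neq0 e : (e < 15)%N -> embV (ln e) != 0.
Proof.
move=> e15; have /allP/(_ e) := check_lines; rewrite mem_iota e15 => /(_ isT).
by case: (nth _ _ e) => i j /andP[l0 _]; rewrite (embV_eq0 char_k r2).
Qed.

Lemma hitP A B e u : isU A -> frame B -> (u < 6)%N ->
  lset B (embV (ln e)) (pt (nvec k u *m (embM A *m B))) <-> hit A e u.
Proof.
move=> uA fB u6; rewrite mulmxA lset_pt ?(frame_unit fB) //; last first.
  by rewrite mulmx_unit_neq0 ?nvec_neq0 // (unitary_unit (isUP char_k r2 uA)).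
by rewrite /hit dot25P (embV_mul char_k r2) base25E.
Qed.

(** The tangency points of a frame are Weierstrass points, so any line joining two of them is a
    special secant. *)
Lemma secants_conicP B L : frame B -> secants_of F (conic B) L <->
  line L /\ exists u v, [/\ (u < 6)%N, (v < 6)%N, u <> v,
    L (pt (nvec k u *m B)) & L (pt (nvec k v *m B))].
Proof.
move=> fB; split.
  move=> [[lL _] [P [P' [PP' /(frame_nvec _ fB)[u u6 PE] /(frame_nvec _ fB)[v v6 PE'] LP LP']]]].
  split=> //; exists u, v; rewrite -PE -PE'; split=> // uv.
  by apply: PP'; rewrite PE PE' uv.
move=> [lL [u [v [u6 v6 uv Lu Lv]]]].
have Nu : (conic B `&` zeros F) (pt (nvec k u *m B)) by apply/(frame_nvec _ fB); exists u.
have Nv : (conic B `&` zeros F) (pt (nvec k v *m B)) by apply/(frame_nvec _ fB); exists v.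
have uvP : pt (nvec k u *m B) <> pt (nvec k v *m B) by move/(nvec_pt_inj fB u6 v6).
split; last by exists (pt (nvec k u *m B)), (pt (nvec k v *m B)); split.
split=> //; exists (pt (nvec k u *m B)), (pt (nvec k v *m B)).
by split=> //; apply: (frame_point_weierstrass fB).
Qed.

Lemma secants_card A B : isU A -> frame B ->
  secants_of F (conic B) `&` secants_of F (conic (embM A *m B)) #= `I_(nsec25 A).
Proof.
move=> uA fB; have uB := frame_unit fB; have fAB := frame_embM r2 uA fB.
have fB1 : frame (embM id25 *m B) by rewrite (embM_id r) mul1mx.
have [hp [-> hpP]] : exists hp : pred nat, nsec25 A = count hp (iota 0 15) /\ forall e,
    (hp e <-> exists u v, [/\ (u < 6)%N, (v < 6)%N, u <> v, hit A e u & hit A e v]).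
  exists (fun e => (1 < count (hit A e) (iota 0 6))%N); split;
    last by move=> e; exact: (iff_sym (rwP (count_gt1P 6 (hit A e)))).
  have lE : lines25 = mkseq ln 15 by [].
  have bE : base25 = mkseq bn 6 by [].
  rewrite /nsec25 lE /mkseq count_map; apply: eq_count => e.
  rewrite -[LHS]/(1 < count (fun P => is0 (dot25 P (ln e))) [seq vmul u A | u <- base25])%N.
  by rewrite bE /mkseq !count_map.
have lineP e : (e < 15)%N -> exists i j, [/\ nth (0%N, 0%N) pairs25 e = (i, j), (i < 6)%N, (j < 6)%N
    & embV (ln e) = cross (nvec k i) (nvec k j)].
  move=> e15; have /allP/(_ e) := check_lines; rewrite mem_iota e15 => /(_ isT).
  case: (nth _ _ e) => i j /and5P[_ /veqP -> i6 j6 _]; exists i, j; split=> //.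
  by rewrite embV_cross !base25E.
have inj e e' : (e < 15)%N -> (e' < 15)%N ->
    lset B (embV (ln e)) = lset B (embV (ln e')) -> e = e'.
  move=> e15 e15' E; have /allP/(_ e) := check_lines; rewrite mem_iota e15 => /(_ isT).
  case: (nth _ _ e) => i j /and5P[_ _ _ _ /allP/(_ e')]; rewrite mem_iota e15' => /(_ isT).
  case/orP=> [/eqP//|/hasP[u]]; rewrite mem_iota add0n => /andP[_ u6] /negP[].
  have he := hitP e (erefl : isU id25) fB u6.
  have he' := hitP e' (erefl : isU id25) fB u6.
  by apply/eqP; apply/idP/idP => h; [apply/he'; rewrite -E; apply/he|apply/he; rewrite E; apply/he'].
have := @card_image_count _ (fun e => lset B (embV (ln e))) 15 hp inj.
congr (is_true (_ #= _)); apply/seteqP; split=> L.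
  move=> [e [e15 /hpP[u [v [u6 v6 uv hu hv]]] ->]].
  have lL : line (lset B (embV (ln e))) by apply: lset_line => //; apply: ln_neq0.
  split; apply/secants_conicP => //; split=> //.
    have [i [j [ijE i6 j6 cE]]] := lineP e e15; exists i, j; split=> //.
    - move=> ij; have := ln_neq0 e15; rewrite cE ij.
      by rewrite crossvv eqxx.
    - by apply/lset_pt; rewrite ?nvec_neq0 // cE /dot /cross !(vec3_0, vec3_1, vec3_2); ring.
    - by apply/lset_pt; rewrite ?nvec_neq0 // cE /dot /cross !(vec3_0, vec3_1, vec3_2); ring.
  by exists u, v; split=> //; apply/(hitP e uA fB).
move=> [/(secants_conicP _ fB)[lL [i [j [i6 j6 ij Li Lj]]]]].
move=> /(secants_conicP _ fAB)[_ [u [v [u6 v6 uv Lu Lv]]]].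
wlog ltij : i j i6 j6 ij Li Lj / (i < j)%N.
  by move=> H; case: (ltngtP i j) => [lt|lt|//]; [apply: (H i j)|apply: (H j i) => // /esym].
have [e e15 eE] := pairs25P ltij j6; exists e.
have [i' [j' [ijE _ _ cE]]] := lineP e e15; move: ijE cE; rewrite eE => -[<- <-] cE.
have LE : L = lset B (embV (ln e)).
  rewrite cE; apply: line_lset => //; rewrite ?nvec_neq0 // -cE.
  exact: ln_neq0.
split=> //; apply/hpP; exists u, v.
by split=> //; apply/(hitP e uA fB) => //; rewrite -LE.
Qed.

End Secants.

(** * The components of G *)

Section Adjacency.
Variable k : closedFieldType.
Hypothesis char_k : 5%N \in [pchar k].
Variable r : k.
Hypothesis r2 : r ^+ 2 = 2%:R.
Variable G : 'M[k]_3.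
Let F := hermitian G.
Local Notation emb := (embed r).
Local Notation embV := (emb_vec r).
Local Notation embM := (emb_mat r).
Local Notation frame := (is_frame char_k G).
Implicit Types (B : 'M[k]_3) (A X : m25).

Definition cpt (t : k) B := pt (vec3 1 t (t ^+ 2) *m B).

Lemma cpt_inj B t t' : B \in unitmx -> cpt t B = cpt t' B -> t = t'.
Proof.
move=> uB /pt_inj; rewrite !mulmx_unit_neq0 ?vec3_eq0 ?oner_eq0 // => /(_ isT isT)[c c0].
rewrite scalemxAl => /(congr1 (mulmx^~ (invmx B))); rewrite !mulmxK // scale_vec3 => E.
have := congr1 (fun v : 'rV[k]_3 => v 0 o0) E; rewrite !vec3_0 mulr1 => c1.
by have := congr1 (fun v : 'rV[k]_3 => v 0 o1) E; rewrite !vec3_1 -c1 mul1r.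
Qed.

Lemma conic_points B P : B \in unitmx -> conic B P <->
  P = pt (vec3 0 0 1 *m B) \/ exists t, P = cpt t B.
Proof.
move=> uB; split; last first.
  move=> [->|[t ->]]; rewrite conic_pt ?vec3_eq0 ?oner_eq0 ?andbF // !mxE /= ?expr0n ?mul0r //.
  by rewrite mul1r.
have [v v0 ->] := pt_frame P uB; rewrite (vec3E v) in v0 *.
move: (v 0 o0) (v 0 o1) (v 0 o2) v0 => x y z v0.
rewrite conic_pt // !mxE /=.
have [x0|x0] := eqVneq x 0.
  rewrite x0 mul0r => /eqP; rewrite expf_eq0 /= => /eqP y0; left.
  move: v0; rewrite x0 y0 vec3_eq0 !eqxx /= => z0.
  have -> : vec3 0 0 z = z *: vec3 0 0 1 by rewrite scale_vec3; congr vec3; ring.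
  by rewrite -scalemxAl ptZ // mulmx_unit_neq0 // vec3_eq0 oner_eq0 !andbF.
move=> yxz; right; exists (y / x).
have -> : vec3 x y z = x *: vec3 1 (y / x) ((y / x) ^+ 2).
  rewrite scale_vec3 mulr1 mulrC divfK //; congr vec3.
  by apply: (mulfI x0); rewrite -yxz expr2 -[in LHS](divfK x0 y); ring.
by rewrite -scalemxAl ptZ // mulmx_unit_neq0 // vec3_eq0 oner_eq0.
Qed.

Lemma embV_qc u : (embV u) 0 o1 ^+ 2 - (embV u) 0 o0 * (embV u) 0 o2 = emb (qc25 u).
Proof.
by case: u => [a b c]; rewrite /emb_vec !(vec3_0, vec3_1, vec3_2) /qc25 (emb_sub char_k) !(emb_mul char_k r2) expr2.
Qed.

Lemma embV_polar u v : emb (polar25 u v) = 2%:R * ((embV u) 0 o1 * (embV v) 0 o1) -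
  ((embV u) 0 o0 * (embV v) 0 o2 + (embV u) 0 o2 * (embV v) 0 o0).
Proof.
case: u v => [a b c] [d e f]; rewrite /emb_vec !(vec3_0, vec3_1, vec3_2) /polar25.
by rewrite (emb_sub char_k) (emb_add char_k) !(emb_mul char_k r2) emb_two.
Qed.

Lemma conic_embM_pt A B v : isU A -> frame B -> v != 0 ->
  conic (embM A *m B) (pt (v *m B)) <-> (v *m embM (minv A)) 0 o1 ^+ 2 =
    (v *m embM (minv A)) 0 o0 * (v *m embM (minv A)) 0 o2.
Proof.
move=> uA fB v0; have uM := unitary_unit (isUP char_k r2 uA).
rewrite (embM_minvE char_k r2) //.
have -> : v *m B = v *m invmx (embM A) *m (embM A *m B) by rewrite mulmxA mulmxKV.
rewrite conic_pt ?mulmx_unit_neq0 ?unitmx_inv //.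
exact: frame_unit (frame_embM r2 uA fB).
Qed.

Lemma quartic_cpt A B t f0 f1 f2 f3 f4 : isU A -> frame B ->
  quartic25 A = (f0, f1, f2, f3, f4) ->
  conic (embM A *m B) (cpt t B) <->
  emb f0 + emb f1 * t + emb f2 * t ^+ 2 + emb f3 * t ^+ 3 + emb f4 * t ^+ 4 = 0.
Proof.
move=> uA fB fE; rewrite conic_embM_pt // ?vec3_eq0 ?oner_eq0 //.
move: fE; rewrite /quartic25; case: (minv A) => p q s [<- <- <- <- <-].
rewrite (emb_add char_k) !embV_polar -!embV_qc mulmx3 /emb_mat row_mat3_0 row_mat3_1 row_mat3_2.
rewrite vec3_0 vec3_1 vec3_2; move: (embV p) (embV q) (embV s) => {}p {}q {}s.
rewrite !mxE; split=> [/eqP|E]; last apply/eqP; rewrite -subr_eq0.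
  by move/eqP => E; rewrite -[RHS]E; ring.
by apply/eqP; rewrite -[RHS]E; ring.
Qed.

Lemma quartic_infty A B f0 f1 f2 f3 f4 : isU A -> frame B ->
  quartic25 A = (f0, f1, f2, f3, f4) ->
  conic (embM A *m B) (pt (vec3 0 0 1 *m B)) <-> emb f4 = 0.
Proof.
move=> uA fB fE; rewrite conic_embM_pt // ?vec3_eq0 ?oner_eq0 ?andbF //.
move: fE; rewrite /quartic25; case: (minv A) => p q s [_ _ _ _ <-].
rewrite -!embV_qc mulmx3 /emb_mat row_mat3_0 row_mat3_1 row_mat3_2.
rewrite vec3_0 vec3_1 vec3_2 !scale0r scale1r !add0r.
by split=> [->|/eqP]; rewrite ?subrr // subr_eq0 => /eqP.
Qed.

Lemma quad_roots (a b c : k) : c != 0 -> exists u v, forall t,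
  a + b * t + c * t ^+ 2 = 0 -> t = u \/ t = v.
Proof.
move=> c0; have two := two_neq0 char_k.
have [s sE] := @nth_root k 2 (b ^+ 2 - 4%:R * c * a) isT.
have c2 : 2%:R * c != 0 by rewrite mulf_neq0.
exists ((- b + s) / (2%:R * c)), ((- b - s) / (2%:R * c)) => t E.
have : (2%:R * c * t + b - s) * (2%:R * c * t + b + s) = 0.
  by rewrite -subr_sqr sE -[RHS](mulr0 (4%:R * c)) -E; ring.
move/eqP; rewrite mulf_eq0 => /orP[]/eqP E'; [left|right]; apply: (mulIf c2);
  rewrite divfK //; apply/eqP; rewrite -subr_eq0 -[X in _ == X]E'; apply/eqP; ring.
Qed.

(** At most two finite parameters satisfy the quartic; with the point at infinity this leaves at
    most three common points. *)
Lemma bad_inter A B : isU A -> frame B -> bad25 A ->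
  ~ (conic B `&` conic (embM A *m B) #= `I_4).
Proof.
move=> uA fB; rewrite /bad25; case fE: (quartic25 A) => [[[[f0 f1] f2] f3] f4] bad.
have uB := frame_unit fB.
have [u [v uvP]] : exists u v, forall t, conic (embM A *m B) (cpt t B) -> t = u \/ t = v.
  case/orP: bad => [/and3P[/(is0P char_k r2) z4 /(is0P char_k r2) z3 /(is0P char_k r2) z2]|].
    have [u [v uv]] := quad_roots (emb f0) (emb f1) (introN eqP z2).
    exists u, v => t /(quartic_cpt _ uA fB fE); rewrite z3 z4 !mul0r !addr0; exact: uv.
  set a := mul25 f3 _; set b := mul25 _ (inv25 two25).
  move=> /and5P[/(is0P char_k r2)/eqP z4 /eqP e3 /eqP e2 /eqP e1 /eqP e0].
  have [u [v uv]] := quad_roots (emb b) (emb a) (oner_neq0 k).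
  exists u, v => t /(quartic_cpt _ uA fB fE) ft; apply: uv.
  have : emb f4 * (emb b + emb a * t + 1 * t ^+ 2) ^+ 2 = 0.
    rewrite -[RHS]ft e3 e2 e1 e0 !(emb_mul char_k r2) (emb_add char_k) !(emb_mul char_k r2) emb_two.
    ring.
  by move/eqP; rewrite mulf_eq0 (negbTE z4) /= expf_eq0 /= => /eqP.
pose g n := nth (pt (vec3 0 0 1 *m B)) [:: cpt u B; cpt v B] n.
have sub : conic B `&` conic (embM A *m B) `<=` g @` `I_3.
  move=> P [/(conic_points _ uB)[->|[t ->]] h2]; first by exists 2%N.
  by case: (uvP t h2) => ->; [exists 0%N|exists 1%N].
move=> c4; have : `I_4 #<= `I_3.
  apply: card_le_trans (card_image_le g _).
  apply: card_le_trans (subset_card_le sub).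
  by move: c4; rewrite card_eq_le => /andP[].
by rewrite card_le_II.
Qed.

Lemma nonadjP A B : isU A -> frame B -> nonadj25 A -> ~ adjG F (conic B) (conic (embM A *m B)).
Proof.
move=> uA fB /orP[/eqP n3|bad] [_ c4 c3]; last by apply: (bad_inter uA fB bad).
by apply: n3; apply: card_I_uniq c3; apply: secants_card.
Qed.

Lemma good_adj A B : isU A -> frame B -> good25 A -> adjG F (conic B) (conic (embM A *m B)).
Proof.
move=> uA fB; rewrite /good25; case fE: (quartic25 A) => [[[[f0 f1] f2] f3] f4].
move=> /and5P[/eqP n3 /(is0P char_k r2) z1 /(is0P char_k r2) z3 /eqP e04 /andP[/(is0P char_k r2)/eqP z4 f2E]].
have uB := frame_unit fB; have two := two_neq0 char_k.
have [d d2 f2d] : exists2 d, d ^+ 2 = 2%:R & emb f2 = 2%:R * d * emb f0.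
  have rf : emb (mul25 (E F0 F2) f0) = 2%:R * r * emb f0.
    by rewrite (emb_mul char_k r2) /embed /emb5 /= add0r.
  case/orP: f2E => /eqP ->; first by exists r.
  by exists (- r); rewrite ?sqrrN // (emb_opp char_k) rf; ring.
have [a aE] := @nth_root k 2 (1 - d) isT.
have [b bE] := @nth_root k 2 (- 1 - d) isT.
(* The roots will be a, -a, b and -b; the relations (a b)^2 = d^2 - 1 = 1 and a^2 - b^2 = 2 make
   them nonzero and distinct. *)
have ab1 : (a * b) ^+ 2 = 1.
  rewrite exprMn aE bE; have -> : (1 - d) * (-1 - d) = d ^+ 2 - 1 by ring.
  by rewrite d2; ring.
have a0 : a != 0 by apply: contraTneq isT => a0; move/eqP: ab1; rewrite a0 mul0r expr0n eq_sym oner_eq0.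
have b0 : b != 0 by apply: contraTneq isT => b0; move/eqP: ab1; rewrite b0 mulr0 expr0n eq_sym oner_eq0.
have ab : a ^+ 2 - b ^+ 2 = 2%:R by rewrite aE bE; ring.
have roots t : conic (embM A *m B) (cpt t B) <-> t \in [:: a; - a; b; - b].
  rewrite (quartic_cpt _ uA fB fE) z1 z3 f2d e04 !mul0r !addr0.
  rewrite !inE; split.
    move=> ft; have : emb f4 * ((t - a) * (t + a) * ((t - b) * (t + b))) = 0.
      rewrite -!subr_sqr aE bE -[RHS]ft.
      have -> : t ^+ 2 - (1 - d) = t ^+ 2 + d - 1 by ring.
      have -> : t ^+ 2 - (-1 - d) = t ^+ 2 + d + 1 by ring.
      have -> : (t ^+ 2 + d - 1) * (t ^+ 2 + d + 1) = t ^+ 4 + 2%:R * d * t ^+ 2 + d ^+ 2 - 1 by ring.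
      by rewrite d2; ring.
    move/eqP; rewrite !mulf_eq0 (negbTE z4) /= !subr_eq0 !addr_eq0.
    by case/orP=> /orP[] -> //; rewrite ?orbT.
  have tE : t ^+ 2 = 1 - d \/ t ^+ 2 = - 1 - d -> emb f4 + 2%:R * d * emb f4 * t ^+ 2 + emb f4 * t ^+ 4 = 0.
    have -> : t ^+ 4 = (t ^+ 2) ^+ 2 by rewrite -exprM.
    have e x : x = 1 - d \/ x = -1 - d -> emb f4 + 2%:R * d * emb f4 * x + emb f4 * x ^+ 2 = emb f4 * (2%:R - d ^+ 2).
      by case=> ->; ring.
    by move/e => ->; rewrite d2 subrr mulr0.
  by case/or4P => /eqP tX; apply: tE; rewrite tX ?sqrrN ?aE ?bE; [left|left|right|right].
have ninf : ~ conic (embM A *m B) (pt (vec3 0 0 1 *m B)).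
  by rewrite (quartic_infty uA fB fE); apply/eqP.
have us : uniq [:: a; - a; b; - b].
  have nN (x : k) : x != 0 -> x != - x.
    move=> x0; apply/negP => /eqP xE; move: (mulf_neq0 two x0).
    by rewrite mulr_natl mulr2n {2}xE subrr eqxx.
  have aNb : a != b by apply: contraNneq two => E'; rewrite -ab E' subrr.
  have aNb' : a != - b by apply: contraNneq two => E'; rewrite -ab E' sqrrN subrr.
  rewrite /= !inE !negb_or !nN // aNb aNb' eqr_oppLR aNb' eqr_opp aNb //.
split.
- move=> QQ; apply: ninf; rewrite -QQ; apply/(conic_points _ uB); by left.
- pose s := [:: a; - a; b; - b].
  have := @card_image_count _ (fun n => cpt (nth 0 s n) B) 4 predT.
  have inj n m : (n < 4)%N -> (m < 4)%N -> cpt (nth 0 s n) B = cpt (nth 0 s m) B -> n = m.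
    by move=> n4 m4 /(cpt_inj uB)/eqP; rewrite nth_uniq // => /eqP.
  move/(_ inj); rewrite count_predT size_iota.
  congr (is_true (_ #= _)); apply/seteqP; split=> P.
    move=> [n [n4 _ ->]]; split; first by apply/(conic_points _ uB); right; exists (nth 0 s n).
    by apply/roots; apply: mem_nth.
  move=> [/(conic_points _ uB)[->|[t ->]] h]; first by case: ninf.
  move/roots: h => ts; exists (index t s); split; rewrite ?nth_index //.
  by rewrite -[4%N]/(size s) index_mem.
by have := secants_card r2 uA fB; rewrite n3.
Qed.

End Adjacency.

(** * The stabilizer of a component *)

Lemma conj_entry (k : fieldType) (S X : 'M[k]_3) i j :
  (X *m S *m X^T) i j = (row i X *m S *m (row j X)^T) 0 0.
Proof.
rewrite tr_row -row_mul [LHS]mxE [RHS]mxE; apply: eq_bigr => l _.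
by rewrite [row i _ 0 l]mxE [col j _ l 0]mxE.
Qed.

Lemma mat3_0 (k : fieldType) (p q s : 'rV[k]_3) j : mat3 p q s o0 j = p 0 j.
Proof. by rewrite mxE. Qed.
Lemma mat3_1 (k : fieldType) (p q s : 'rV[k]_3) j : mat3 p q s o1 j = q 0 j.
Proof. by rewrite mxE. Qed.
Lemma mat3_2 (k : fieldType) (p q s : 'rV[k]_3) j : mat3 p q s o2 j = s 0 j.
Proof. by rewrite mxE. Qed.

Section Stabilizer.
Variable k : closedFieldType.
Hypothesis char_k : 5%N \in [pchar k].
Variable r : k.
Hypothesis r2 : r ^+ 2 = 2%:R.
Variable G : 'M[k]_3.
Let F := hermitian G.
Local Notation frob := (frob char_k).
Local Notation emb := (embed r).
Local Notation embV := (emb_vec r).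
Local Notation embM := (emb_mat r).
Local Notation unitary := (is_unitary char_k).
Local Notation frame := (is_frame char_k G).
Local Notation DD := (DD r).
Implicit Types (B : 'M[k]_3) (A : m25) (X : 'M[k]_3).

(** The factor 3 is 1/2: the bilinear form of [Cq] is half the polar form. *)
Lemma Cq_polar (u v : 'rV[k]_3) : (u *m Cq k *m v^T) 0 0 =
  3%:R * (2%:R * (u 0 o1 * v 0 o1) - (u 0 o0 * v 0 o2 + u 0 o2 * v 0 o0)).
Proof.
rewrite [u]vec3E mulmx_mat3 mxE big_ord3 !mxE /=.
apply: (@eq_mod5 _ char_k _ _ (u 0 o0 * v 0 o2 + u 0 o2 * v 0 o0 - u 0 o1 * v 0 o1)); ring.
Qed.

Lemma qs25P A : qs25 A -> qsim (embM A).
Proof.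
case: A => p q s /and5P[/(is0P char_k r2) pp /(is0P char_k r2) ss /(is0P char_k r2) pq
  /(is0P char_k r2) qs /andP[/(is0P char_k r2) psq /(is0P char_k r2)/eqP qq]].
exists (emb (qc25 q)) => //.
have six (x : k) : 3%:R * (2%:R * x) = x.
  by apply: (@eq_mod5 _ char_k _ _ x); ring.
have e3 u : (embV u *m Cq k *m (embV u)^T) 0 0 = emb (qc25 u).
  rewrite Cq_polar -(embV_qc char_k r2) -[RHS]six; ring.
have e2 u v : (embV u *m Cq k *m (embV v)^T) 0 0 = 3%:R * emb (polar25 u v).
  by rewrite Cq_polar (embV_polar char_k r2).
have polC u v : emb (polar25 u v) = emb (polar25 v u).
  by rewrite !(embV_polar char_k r2); ring.
have ps : emb (polar25 p s) = - emb (qc25 q).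
  by apply/eqP; rewrite -addr_eq0 -(emb_add char_k) psq.
have m3 : 3%:R * - emb (qc25 q) = emb (qc25 q) * 2%:R.
  by apply: (@eq_mod5 _ char_k _ _ (- emb (qc25 q))); ring.
apply/matrixP => i j; rewrite conj_entry; move: i j; apply: ord3P; apply: ord3P;
  rewrite /emb_mat ?(row_mat3_0, row_mat3_1, row_mat3_2) [RHS]mxE [X in _ * X]mxE /= [X in _ * X]mxE /= ?mulr0 ?mulr1.
- by rewrite e3.
- by rewrite e2 pq mulr0.
- by rewrite e2 ps.
- by rewrite e2 polC pq mulr0.
- by rewrite e3.
- by rewrite e2 qs mulr0.
- by rewrite e2 polC ps.
- by rewrite e2 polC qs mulr0.
by rewrite e3.
Qed.

Lemma det_embM A : \det (embM A) = emb (det25 A).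
Proof.
case: A => [[a b c] [d e f] [g h i]]; rewrite /emb_mat /emb_vec det_mat3 /det25 /dot25 /cross25.
by rewrite !(emb_add char_k) !(emb_mul char_k r2) !(emb_sub char_k) !(emb_mul char_k r2); ring.
Qed.

Lemma sqdet1P A : sqdet1 A <-> \det (embM A) ^+ 2 = 1.
Proof.
rewrite /sqdet1 det_embM expr2 -(emb_mul char_k r2) -(emb1 r).
by split=> [/eqP->//|/(emb_inj char_k r2)/eqP].
Qed.

(** The determinant condition is carried along so that multiplying X by such elements on either side
    preserves its squared determinant. *)
Definition stab (a : 'M[k]_3) :=
  [/\ unitary a, forall B, frame B -> DD (a *m B) = DD B & \det a ^+ 2 = 1].

Lemma stabM a b : stab a -> stab b -> stab (a *m b).
Proof.
move=> [ua Da da] [ub Db db]; split; first exact: unitaryM.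
  by move=> B fB; rewrite -mulmxA Da ?Db //; apply: frameM.
by rewrite det_mulmx exprMn da db mulr1.
Qed.

Lemma stabV a : stab a -> stab (invmx a).
Proof.
move=> [ua Da da]; have ua' := unitary_unit ua; split; first exact: unitaryV.
  move=> B fB; rewrite -(Da (invmx a *m B)) ?mulKVmx //.
  by apply: frameM => //; apply: unitaryV.
by rewrite det_inv exprVn da invr1.
Qed.

Lemma stab1 : stab 1%:M.
Proof.
split; last by rewrite det1 expr1n.
  by rewrite /is_unitary map_mx1 trmx1 mul1mx mulmx1.
by move=> B _; rewrite mul1mx.
Qed.

Lemma stab25_sub a B : isU a -> stab25 a -> frame B -> DD (embM a *m B) `<=` DD B.
Proof.
move=> ua /(all_nthP id25) sa fB Q [n n21 ->].
have /(has_nthP id25)[m m21 qs] := sa n n21.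
exists m; first exact: m21.
have uDm := Dn_isU m; have uM := unitary_unit (isUP char_k r2 uDm).
rewrite mulmxA -(embM_mul char_k r2).
have <- : embM (mmul (mmul (Dn n) a) (minv (Dn m))) *m (embM (Dn m) *m B) =
    embM (mmul (Dn n) a) *m B.
  by rewrite (embM_mul char_k r2 _ (minv _)) (embM_minvE char_k r2) // mulmxA mulmxKV.
apply: (conic_qsim char_k); last exact: qs25P.
exact: frame_unit (frame_embM r2 uDm fB).
Qed.

Lemma stab_gen i : (i < 5)%N -> stab (embM (nth id25 gens25 i)).
Proof.
move=> i5; have /(all_nthP id25)/(_ i i5)/and4P[ug dg sg sg'] := check_stab.
set g := nth _ _ _ in ug dg sg sg' *; have uM := isUP char_k r2 ug.
split; [exact: uM| |exact/sqdet1P].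
move=> B fB; apply/seteqP; split; first exact: stab25_sub.
have fgB := frame_embM r2 ug fB.
have := stab25_sub (isU_minv char_k r2 ug) sg' fgB.
by rewrite (embM_minvE char_k r2 ug) (mulKmx (unitary_unit uM)).
Qed.

Lemma embM_tau : embM tau25 = tmat 1.
Proof.
rewrite /tau25 /emb_mat /emb_vec !emb0 !emb1 emb_two /tmat; apply: mat3_congr; split=> //; ring.
Qed.

Lemma embM_w : embM w25 = wmat k.
Proof. by rewrite /w25 /emb_mat /emb_vec !emb0 !emb1. Qed.

Lemma stab_tau : stab (tmat 1). Proof. by rewrite -embM_tau; apply: (stab_gen (i := 0)). Qed.
Lemma stab_w : stab (wmat k). Proof. by rewrite -embM_w; apply: (stab_gen (i := 2)). Qed.

Lemma embM_dl : embM dl25 = dmat 3%:R 1 2%:R.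
Proof.
rewrite /dl25 /emb_mat /emb_vec !emb0 !emb1 emb_two /dmat; apply: mat3_congr; split=> //.
by rewrite /= /emb5 mul0r addr0.
Qed.

Lemma stab_dl : stab (dmat 3%:R 1 2%:R).
Proof. by rewrite -embM_dl; apply: (stab_gen (i := 1)). Qed.

Lemma size_D25 : size D25 = 21. Proof. by []. Qed.

Lemma stab_Dn n : stab (embM (Dn n)).
Proof.
have [n21|n21] := ltnP n 21; last first.
  have -> : Dn n = id25 by apply: nth_default; rewrite size_D25.
  by rewrite (embM_id r); apply: stab1.
have /allP/(_ n) := check_Dn; rewrite mem_iota n21 => /(_ isT) /meqP ->.
have pow A m : stab (embM A) -> stab (embM (mpow A m)).
  move=> sA; elim: m => [|m IHm]; first by rewrite [mpow A 0]/(id25) (embM_id r); apply: stab1.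
  by rewrite /mpow iterS (embM_mul char_k r2); apply: stabM.
rewrite (embM_mul char_k r2); apply: stabM; apply: pow.
  exact: (stab_gen (i := 4)).
exact: (stab_gen (i := 3)).
Qed.

Lemma stab_scalar (e : k) : e ^+ 6 = 1 -> stab e%:M /\ qsim (e%:M : 'M[k]_3).
Proof.
move=> e6; have e0 : e != 0 by apply: contraTneq isT => e0; move/eqP: e6; rewrite e0 expr0n eq_sym oner_eq0.
have qe : qsim (e%:M : 'M[k]_3).
  exists (e ^+ 2); first by rewrite expf_neq0.
  by rewrite tr_scalar_mx mul_scalar_mx mul_mx_scalar scalerA.
have eC n B : frame B -> conic (embM (Dn n) *m (e%:M *m B)) = conic (embM (Dn n) *m B).
  move=> fB; rewrite mulmxA scalar_mxC -mulmxA (conic_qsim char_k) //.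
  exact: frame_unit (frame_embM r2 (Dn_isU n) fB).
split; first split; last exact: qe.
- rewrite /is_unitary map_scalar_mx tr_scalar_mx mul_scalar_mx mul_mx_scalar scalerA.
  by rewrite /= frobE -exprSr e6 scale1r.
- move=> B fB; apply/seteqP; split=> Q [n n21 ->].
    by exists n; [exact: n21|exact: eC].
  by exists n; [exact: n21|rewrite (eC n B fB)].
by rewrite det_scalar -exprM.
Qed.

Lemma nvec_stab n : exists2 s, stab s & nvec k n = vec3 0 0 1 *m s.
Proof.
rewrite /nvec; case: ifP => n5; last by exists 1%:M; [exact: stab1|rewrite mulmx1].
have [s ss sE] : exists2 s, stab s & vec3 1 n%:R (n%:R ^+ 2) = vec3 1 0 0 *m s.
  elim: (n) => [|m [s ss sE]]; first by exists 1%:M; [apply: stab1|rewrite mulmx1 expr0n].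
  exists (s *m tmat 1); first by apply: stabM stab_tau.
  by rewrite mulmxA -sE /tmat !mat3S -natr1; congr vec3; ring.
exists (wmat k *m s); first exact: stabM stab_w ss.
by rewrite sE mulmxA /wmat !mat3S; congr (vec3 _ _ _ *m _); ring.
Qed.

Lemma iso25P B u : frame B -> embV u != 0 -> zeros F (pt (embV u *m B)) -> iso25 u.
Proof.
move=> fB u0 /(herm_pt fB u0); case: u {u0} => [a b c].
rewrite /emb_vec !(vec3_0, vec3_1, vec3_2) => E.
apply/(is0P char_k r2); rewrite (emb_add char_k) (emb_sub char_k) !(emb_mul char_k r2) emb_two.
by rewrite !(emb_conj char_k r2) !frobE -exprS.
Qed.

Lemma cover B u : frame B -> embV u != 0 -> zeros F (pt (embV u *m B)) ->
  exists2 n, (n < 21)%N & conic (embM (Dn n) *m B) (pt (embV u *m B)).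
Proof.
move=> fB u0 Pu; case: u u0 Pu => [a b c] u0 Pu.
(* The table lists the points (1, b, c); an isotropic point with first coordinate 0 is (0, 0, 1),
   which lies on the standard conic. *)
have [a0|a0] := eqVneq (emb a) 0.
  have b0 : emb b = 0.
    have := iso25P fB u0 Pu; rewrite /iso25 => /(is0P char_k r2).
    rewrite (emb_add char_k) (emb_sub char_k) !(emb_mul char_k r2) !(emb_conj char_k r2) a0 rmorph0.
    rewrite mul0r mulr0 addr0 sub0r emb_two => /eqP; rewrite oppr_eq0 mulf_eq0 (negbTE (two_neq0 char_k)).
    by rewrite frobE -exprS expf_eq0 => /eqP.
  exists 0%N => //; rewrite (embM_id r) mul1mx conic_pt ?(frame_unit fB) //.
  by rewrite /emb_vec !mxE /= b0 a0 expr0n mul0r.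
pose v := V u25 (mul25 b (inv25 a)) (mul25 c (inv25 a)).
have uE : embV (V a b c) = emb a *: embV v.
  rewrite /v /emb_vec scale_vec3 !(emb_mul char_k r2) (emb_inv char_k r2) // emb1 mulr1.
  by congr vec3; rewrite mulrC divfK.
have v0 : embV v != 0 by rewrite /v /emb_vec vec3_eq0 emb1 oner_eq0.
have vB0 : embV v *m B != 0 by rewrite mulmx_unit_neq0 ?(frame_unit fB).
have PE : pt (embV (V a b c) *m B) = pt (embV v *m B) by rewrite uE -scalemxAl ptZ.
rewrite PE in Pu *.
have /all25P/(_ (mul25 b (inv25 a)))/all25P/(_ (mul25 c (inv25 a)))/implyP := check_cover.
move=> /(_ (iso25P fB v0 Pu))/(has_nthP id25)[n n21 On].
exists n; first exact: n21.
by apply/(on25P r2 (Dn_isU n) fB v0).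
Qed.

(** The point (0, 0, 1) X^-1 is isotropic, hence a tangency point of one of the 21 conics. Some
    [Dn n] carries the standard conic to that conic, and a projectivity of the standard conic
    adjusts the point. *)
Lemma red_flag B X : frame B -> unitary X ->
  exists a (c : k), [/\ stab a, c != 0 & vec3 0 0 1 *m (a *m X) = c *: vec3 0 0 1].
Proof.
move=> fB uX; have uX' := unitary_unit uX; have uB := frame_unit fB.
have [A uA XE] := unitary_emb r2 uX.
set e2 : 'rV[k]_3 := vec3 0 0 1.
have e20 : e2 != 0 by rewrite vec3_eq0 oner_eq0 !andbF.
have [u uE] : exists u, embV u = e2 *m invmx X.
  exists (vmul (V z25 z25 u25) (minv A)).
  by rewrite (embV_mul char_k r2) (embM_minvE char_k r2 uA) -XE /emb_vec !emb0 emb1.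
have fXB := frameM uX fB.
have PE : embV u *m (X *m B) = e2 *m B by rewrite uE mulmxA mulmxKV.
have u0 : embV u != 0 by rewrite uE mulmx_unit_neq0 ?unitmx_inv.
have Pz : zeros F (pt (embV u *m (X *m B))).
  rewrite PE; apply/(herm_pt fB e20).
  by rewrite /e2 !(vec3_0, vec3_1, vec3_2) !expr0n /= !(mulr0, mul0r, addr0, subr0).
have [n n21 Cn] := cover fXB u0 Pz.
have fn := frame_embM r2 (Dn_isU n) fXB.
have [m m6 Pm] : exists2 m, (m < 6)%N &
    pt (embV u *m (X *m B)) = pt (nvec k m *m (embM (Dn n) *m (X *m B))).
  by apply/(frame_nvec _ fn); split.
have [s ss sE] := nvec_stab m; rewrite PE sE in Pm.
have us : unitary s by case: ss.
have uY : s *m embM (Dn n) *m X \in unitmx.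
  rewrite !unitmx_mul (unitary_unit us) uX' (unitary_unit (isUP char_k r2 (Dn_isU n))).
  by [].
have E2 : vec3 0 0 1 *m s *m (embM (Dn n) *m (X *m B)) =
    vec3 0 0 1 *m (s *m embM (Dn n) *m X) *m B by rewrite !mulmxA.
rewrite E2 in Pm.
have e2Y : vec3 0 0 1 *m (s *m embM (Dn n) *m X) != 0 by rewrite mulmx_unit_neq0.
have [c c0 cE] := pt_inj (mulmx_unit_neq0 uB e20) (mulmx_unit_neq0 uB e2Y) Pm.
exists (s *m embM (Dn n)), c^-1; split; last 1 first.
- apply: (can_inj (mulmxK uB)); rewrite -scalemxAl cE scalerA mulVf // scale1r.
  by [].
- exact: stabM ss (stab_Dn n).
by rewrite invr_eq0.
Qed.

(* Upper triangular, normalized by a middle entry 1; [a] and [d] are the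
   parameters that remain to be reduced. *)
Definition tri (a d : k) (X : 'M[k]_3) :=
  exists g f h, X = mat3 (vec3 a d g) (vec3 0 1 f) (vec3 0 0 h).

Lemma tri_dl a d X : tri a d X -> tri (3%:R * a) (3%:R * d) (dmat 3%:R 1 2%:R *m X).
Proof.
move=> [g [f [h ->]]]; exists (3%:R * g), f, (2%:R * h).
by rewrite /dmat !mat3S; apply: mat3_congr; split; ring.
Qed.

Lemma tri_tau a d X : tri a d X -> tri a (1 + d) (tmat 1 *m X).
Proof.
move=> [g [f [h ->]]]; exists (g + f + h), (f + 2%:R * h), h.
by rewrite /tmat !mat3S; apply: mat3_congr; split; ring.
Qed.

Lemma tri_tau_r a d X : tri a d X -> tri a (a + d) (X *m tmat 1).
Proof.
move=> [g [f [h ->]]]; exists (a + 2%:R * d + g), (2%:R + f), h.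
by rewrite /tmat !mat3S; apply: mat3_congr; split; ring.
Qed.

Lemma H0_entries (X : 'M[k]_3) i j : (X *m H0 *m (map_mx frob X)^T) i j =
  X i o0 * X j o2 ^+ 5 - 2%:R * (X i o1 * X j o1 ^+ 5) + X i o2 * X j o0 ^+ 5.
Proof.
rewrite mxE big_ord3 ![(map_mx _ _)^T _ _]mxE ![map_mx _ _ _ _]mxE.
rewrite ![(X *m _) _ _]mxE !big_ord3 /H0 !(mat3_0, mat3_1, mat3_2) !(vec3_0, vec3_1, vec3_2) !frobE /=; ring.
Qed.

(** Orthogonality to the last row, which is c (0, 0, 1), makes the first entry of the middle row
    vanish. The middle entry x then satisfies x^6 = 1 and is removed by a unitary scalar. *)
Lemma unitary_tri X c : unitary X -> c != 0 -> vec3 0 0 1 *m X = c *: vec3 0 0 1 ->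
  exists e a d : k, [/\ e ^+ 6 = 1, a != 0 & tri a d (e%:M *m X)].
Proof.
move=> uX c0 cE.
have X2 j : X o2 j = (c *: vec3 0 0 1 : 'rV_3) 0 j.
  by rewrite -cE mxE big_ord3 vec3_0 vec3_1 vec3_2 /= !mul0r !add0r mul1r.
have X20 : X o2 o0 = 0 by rewrite X2 mxE vec3_0 mulr0.
have X21 : X o2 o1 = 0 by rewrite X2 mxE vec3_1 mulr0.
have X22 : X o2 o2 = c by rewrite X2 mxE vec3_2 mulr1.
have uE i j := congr1 (fun M : 'M[k]_3 => M i j) uX.
have X10 : X o1 o0 = 0.
  have := uE o1 o2; rewrite /= H0_entries X20 X21 X22 expr0n !mulr0 subr0 addr0.
  rewrite /H0 ?mat3_0 ?mat3_1 vec3_2 => /eqP; rewrite mulf_eq0 expf_eq0 (negbTE c0) orbF.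
  by move/eqP.
have X11 : X o1 o1 ^+ 6 = 1.
  have := uE o1 o1; rewrite /= H0_entries X10 expr0n mul0r mulr0 addr0 sub0r.
  rewrite /H0 mat3_1 vec3_1 -exprS => /oppr_inj.
  by rewrite -[RHS]mulr1 => /(mulfI (two_neq0 char_k)).
have X00 : X o0 o0 != 0.
  apply: contraTneq isT => X00; have := uE o0 o2; rewrite /= H0_entries X00 X20 X21 expr0n.
  by rewrite !(mul0r, mulr0) subr0 addr0 /H0 ?mat3_0 ?mat3_1 vec3_2 => /esym/eqP; rewrite oner_eq0.
have X11' : X o1 o1 != 0.
  by apply: contraTneq isT => z; move/eqP: X11; rewrite z expr0n eq_sym oner_eq0.
set e := (X o1 o1)^-1; have e0 : e != 0 by rewrite invr_eq0.
exists e, (e * X o0 o0), (e * X o0 o1); split.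
- by rewrite exprVn X11 invr1.
- by rewrite mulf_neq0.
exists (e * X o0 o2), (e * X o1 o2), (e * c).
apply/matrixP => i j; rewrite mul_scalar_mx mxE; move: i j; apply: ord3P; apply: ord3P;
  by rewrite !(mat3_0, mat3_1, mat3_2) ?(vec3_0, vec3_1, vec3_2) ?X20 ?X21 ?X22 ?X10 ?mulr0 ?mulVf.
Qed.

End Stabilizer.

(** * Reduction to upper triangular representatives *)

Section Reduction.
Variable k : closedFieldType.
Hypothesis char_k : 5%N \in [pchar k].
Variable r : k.
Hypothesis r2 : r ^+ 2 = 2%:R.
Variable G : 'M[k]_3.
Local Notation frob := (frob char_k).
Local Notation emb := (embed r).
Local Notation embM := (emb_mat r).
Local Notation unitary := (is_unitary char_k).
Local Notation frame := (is_frame char_k G).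
Local Notation stab := (stab char_k r G).

(** Unitarity gives a h^5 = 1 and a f^5 = 2 d, so h and f are determined by a and d. *)
Lemma tri_rep X a d : unitary X -> emb a != 0 -> tri (emb a) (emb d) X ->
  exists2 g, isU (rep25 a d g) & X = embM (rep25 a d g).
Proof.
move=> uX a0 [g [f [h XE]]]; have uE i j := congr1 (fun M : 'M[k]_3 => M i j) uX.
have ahE : emb a * h ^+ 5 = 1.
  have := uE o0 o2; rewrite /= H0_entries XE !(mat3_0, mat3_2) !(vec3_0, vec3_1, vec3_2).
  by rewrite expr0n !mulr0 subr0 addr0.
have afE : emb a * f ^+ 5 = 2%:R * emb d.
  have := uE o0 o1; rewrite /= H0_entries XE !(mat3_0, mat3_1) !(vec3_0, vec3_1, vec3_2).
  by rewrite expr0n !mulr0 addr0 expr1n mulr1 => /eqP; rewrite subr_eq0 => /eqP.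
have [A uA XA] := unitary_emb r2 uX.
have uA' : unitary (embM A) by rewrite -XA.
have frobK x : frob (frob (emb x)) = emb x.
  by rewrite -!(emb_conj char_k r2); congr (emb _); case: (x) => x1 [].
have AE i j := congr1 (fun M : 'M[k]_3 => M i j) (etrans (esym XA) XE).
case AA : A => [[a1 d1 g1] [b1 e1 f1] [p1 q1 h1]].
rewrite AA /emb_mat /emb_vec in AE.
have emb_inj x y : emb x = emb y -> x = y by move/(emb_inj char_k r2).
have ai : emb (inv25 a) = (emb a)^-1 by rewrite (emb_inv char_k r2).
have a1E : a1 = a by apply: emb_inj; have := AE o0 o0; rewrite !mat3_0 !vec3_0.
have d1E : d1 = d by apply: emb_inj; have := AE o0 o1; rewrite !mat3_0 !vec3_1.
have b1E : b1 = z25 by apply: emb_inj; have := AE o1 o0; rewrite !mat3_1 !vec3_0 emb0.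
have e1E : e1 = u25 by apply: emb_inj; have := AE o1 o1; rewrite !mat3_1 !vec3_1 emb1.
have p1E : p1 = z25 by apply: emb_inj; have := AE o2 o0; rewrite !mat3_2 !vec3_0 emb0.
have q1E : q1 = z25 by apply: emb_inj; have := AE o2 o1; rewrite !mat3_2 !vec3_1 emb0.
have f1E : f1 = conj25 (mul25 (mul25 two25 d) (inv25 a)).
  apply: emb_inj; rewrite (emb_conj char_k r2) !(emb_mul char_k r2) emb_two ai -afE.
  have := AE o1 o2; rewrite !mat3_1 !vec3_2 => <-.
  by rewrite [emb a * _]mulrC mulfK // -frobE frobK.
have h1E : h1 = conj25 (inv25 a).
  apply: emb_inj; rewrite (emb_conj char_k r2) ai.
  have := AE o2 o2; rewrite !mat3_2 !vec3_2 => h1E.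
  have -> : (emb a)^-1 = h ^+ 5 by apply: (mulfI a0); rewrite ahE mulfV.
  by rewrite -h1E -frobE frobK.
have AE' : A = rep25 a d g1 by rewrite AA a1E d1E b1E e1E p1E q1E f1E h1E.
by exists g1; rewrite -AE' // XA.
Qed.

Lemma iter_add x i y : emb (iter i (add25 x) y) = emb y + i%:R * emb x.
Proof.
elim: i => [|i IHi]; first by rewrite mul0r addr0.
by rewrite iterS (emb_add char_k) IHi -natr1 mulrDl mul1r addrC addrA.
Qed.

(** The two sides play different roles: [s] only permutes the conics of the target component, while
    [s'] changes the base frame. Being also a similitude of the conic, [s'] keeps the base conic
    itself, which the study of the edges of G requires. *)
Lemma reduction B X : frame B -> unitary X -> exists s s' R,
  [/\ stab s, stab s', qsim s', isU R & rep_ok R /\ X = s *m embM R *m s'].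
Proof.
move=> fB uX.
suff [s [s' [R [ss ss' qs uR [okR E]]]]] : exists s s' R,
    [/\ stab s, stab s', qsim s', isU R & rep_ok R /\ s *m X *m s' = embM R].
  have us : s \in unitmx by case: ss => /unitary_unit.
  have us' : s' \in unitmx by case: ss' => /unitary_unit.
  exists (invmx s), (invmx s'), R.
  split; [exact: stabV|exact: stabV|exact: qsimV|exact: uR|split; first exact: okR].
  by rewrite -E !mulmxA mulVmx // mul1mx mulmxK.
have [s1 [c [ss1 c0 cE]]] := red_flag r2 fB uX.
have us1 : unitary s1 by case: ss1.
have [e [a0 [d0 [e6 a00 tX]]]] := unitary_tri (unitaryM us1 uX) c0 cE.
have [se qe] := stab_scalar char_k r2 G e6.
have ue : unitary e%:M by case: se.
set X1 := _ *m _ in tX; have uX1 : unitary X1 by apply: unitaryM => //; apply: unitaryM.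
have [a [d [aE dE]]] : exists a d, a0 = emb a /\ d0 = emb d.
  have [A1 _ X1A] := unitary_emb r2 uX1; have [g [f [h tE]]] := tX.
  have E i := congr1 (fun M : 'M[k]_3 => M o0 i) (etrans (esym tE) X1A).
  case: A1 {X1A} E => [[a1 d1 g1] q1 p1] E; exists a1, d1.
  have := E o0; rewrite /emb_mat /emb_vec !mat3_0 !vec3_0 => ->.
  by have := E o1; rewrite /emb_mat /emb_vec !mat3_0 !vec3_1 => ->.
rewrite {}aE {}dE in a00 tX.
have [s2 [a' [d' [ss2 ra tX2]]]] : exists s a' d', [/\ stab s, a' \in ra25 &
    tri (emb a') (emb d') (s *m X1)].
  have /all25P/(_ a)/orP[/(is0P char_k r2) z|/hasP[n _ /hasP[a' ra /eqP aE]]] := check_ra.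
    by rewrite z eqxx in a00.
  have [s [d' [ss sX]]] : exists s d', stab s /\
      tri (emb (iter n (mul25 (E F3 F0)) a)) (emb d') (s *m X1).
    elim: (n) => [|m [s [d' [ss sX]]]].
      by exists 1%:M, d; split; [exact: stab1|rewrite mul1mx].
    exists (dmat 3%:R 1 2%:R *m s), (mul25 (E F3 F0) d').
    split; first by apply: stabM ss; apply: stab_dl.
    rewrite iterS !(emb_mul char_k r2) -mulmxA.
    have -> : emb (E F3 F0) = 3%:R by rewrite /= /emb5 mul0r addr0.
    exact: tri_dl.
  by exists s, a', d'; split; [exact: ss|exact: ra|rewrite -aE].
have a'0 : emb a' != 0 by apply: contraTneq ra => /(emb_eq0 char_k r2) ->.
have us2 : unitary s2 by case: ss2.
have [s3 [s4 [d3 [ss3 [ss4 qs4] rd tX3]]]] : exists s s' d3,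
    [/\ stab s, stab s' /\ qsim s', d3 \in rd25 a' &
    tri (emb a') (emb d3) (s *m (s2 *m X1) *m s')].
  have /allP/(_ a' ra)/all25P/(_ d')/hasP[n _ /hasP[m _ /hasP[d3 rd /eqP dE]]] := check_rd.
  move: tX2; set X2 := s2 *m X1 => tX2.
  have dE' : emb d3 = emb d' + n%:R + m%:R * emb a'.
    by rewrite -dE !iter_add emb1 mulr1.
  have [s [ss sX]] : exists s, stab s /\ tri (emb a') (emb d' + n%:R) (s *m X2).
    elim: (n) => [|i [s [ss sX]]]; first by exists 1%:M; rewrite mul1mx addr0; split; [exact: stab1|].
    exists (tmat 1 *m s); split; first exact: stabM (stab_tau char_k r2 G) ss.
    by rewrite -natr1 addrA addrC -mulmxA; apply: tri_tau.
  have [s' [ss' qs' s'X]] : exists s', [/\ stab s', qsim s' &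
      tri (emb a') (emb d' + n%:R + m%:R * emb a') (s *m X2 *m s')].
    elim: (m) => [|i [s' [ss' qs' s'X]]].
      exists 1%:M; rewrite mulmx1 mul0r addr0; split; [exact: stab1| |by []].
      by exists 1; rewrite ?oner_neq0 // mul1mx trmx1 mulmx1 scale1r.
    exists (s' *m tmat 1); split; first exact: stabM ss' (stab_tau char_k r2 G).
      by apply: qsimM => //; apply: qsim_tmat.
    by rewrite -natr1 mulrDl mul1r addrA addrC mulmxA; apply: tri_tau_r.
  by exists s, s', d3; split; [exact: ss| |exact: rd|rewrite dE'].
have us3 : unitary s3 by case: ss3.
have us4 : unitary s4 by case: ss4.
have uX3 : unitary (s3 *m (s2 *m X1) *m s4).
  by apply: unitaryM => //; apply: unitaryM => //; apply: unitaryM.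
have [g uR XR] := tri_rep uX3 a'0 tX3.
have /allP/(_ a' ra)/allP/(_ d3 rd)/all25P/(_ g)/implyP/(_ uR) okR := check_reps.
exists (s3 *m s2 *m e%:M *m s1), s4, (rep25 a' d3 g).
split; [|exact: ss4|exact: qs4|exact: uR|].
  by apply: stabM ss1; apply: stabM se; apply: stabM ss3 ss2.
by split; [exact: okR|rewrite -XR /X1 !mulmxA].
Qed.

End Reduction.

(** * Connected components of G and of H *)

Lemma det_ratio (k : fieldType) (U V : 'M[k]_3) : U \in unitmx ->
  (\det (V *m invmx U) ^+ 2 == 1) = (\det V ^+ 2 == \det U ^+ 2).
Proof.
rewrite unitmxE unitfE => dU; rewrite det_mulmx det_inv exprMn exprVn.
by rewrite -(inj_eq (mulIf (expf_neq0 2 dU))) divfK ?expf_neq0 // mul1r.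
Qed.

Section Components.
Variable k : closedFieldType.
Hypothesis char_k : 5%N \in [pchar k].
Variable r : k.
Hypothesis r2 : r ^+ 2 = 2%:R.
Variable G : 'M[k]_3.
Hypothesis uG : G \in unitmx.
Let F := hermitian G.
Local Notation embM := (emb_mat r).
Local Notation unitary := (is_unitary char_k).
Local Notation frame := (is_frame char_k G).
Local Notation stab := (stab char_k r G).
Local Notation DD := (DD r).

Lemma conic_in_DD B : DD B (conic B).
Proof. exists 0%N; first by [].
have -> : Dn 0 = id25 by [].
by rewrite (embM_id r) mul1mx. Qed.

Lemma frame_ratio B B' : frame B -> frame B' -> unitary (B' *m invmx B).
Proof.
move=> fB; set X := B' *m _; have -> : B' = X *m B by rewrite mulmxKV ?(frame_unit fB).
by rewrite /is_frame map_mxM trmx_mul !mulmxA -(mulmxA X) -(mulmxA X) fB.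
Qed.

Lemma DD_reduction X B s s' R : stab s -> stab s' -> isU R -> frame B ->
  X = s *m embM R *m s' -> DD (X *m B) = DD (embM R *m (s' *m B)).
Proof.
move=> [us Ds _] [us' Ds' _] uR fB ->; rewrite -!mulmxA Ds; first by [].
exact: (frame_embM r2 uR (frameM us' fB)).
Qed.

Lemma types_by_det X B : unitary X -> frame B ->
  if \det X ^+ 2 == 1 then
    [\/ DD (X *m B) = DD B, has_component_type F (DD B) (DD (X *m B)) gamma21 |
        has_component_type F (DD B) (DD (X *m B)) alpha15gamma6]
  else has_component_type F (DD B) (DD (X *m B)) beta21 \/
       has_component_type F (DD B) (DD (X *m B)) alpha3gamma18.
Proof.
move=> uX fB; have [s [s' [R [ss ss' _ uR [okR XE]]]]] := reduction r2 fB uX.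
rewrite (DD_reduction ss ss' uR fB XE); case: ss ss' => us _ ds [us' Ds' ds'].
have fB' := frameM us' fB; rewrite -(Ds' B fB).
have -> : (\det X ^+ 2 == 1) = sqdet1 R.
  rewrite XE !det_mulmx !exprMn ds ds' mul1r mulr1.
  by apply/eqP/idP => [/(sqdet1P char_k r2)|/(sqdet1P char_k r2)].
move: okR; rewrite /rep_ok; case: ifP => [/meqP -> _|_ /andP[_]].
  by apply: Or31; rewrite (embM_id r) mul1mx.
case cR: (comptype R) => [T|] /=; last by case: ifP.
have := component_typeP r2 uR fB' cR; case: ifP => _; case: T {cR} => // ty _.
- by apply: Or32.
- by apply: Or33.
- by left.
by right.
Qed.

(** For Q' = Q there are 6 common points on the sextic, a value that no type allows. *)
Lemma no_self_type B T : frame B -> ~ has_component_type F (DD B) (DD B) T.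
Proof.
move=> fB; have noself t : ~ has_conic_type F (conic B) (DD B) t.
  move=> /(_ 6); have -> : nth 0%N (value_counts t) 6 = 0%N by case: t.
  rewrite II0 card_eq0 => /eqP S0; suff : (set0 : set (set (point k))) (conic B) by []; rewrite -S0.
  by split; [exact: conic_in_DD|rewrite setIid; exact: frame_card].
have cB := conic_in_DD B.
case: T => /=.
- by move=> /(_ _ cB); apply: noself.
- by move=> /(_ _ cB); apply: noself.
- by move=> [_ _ /(_ _ cB)[]]; apply: noself.
by move=> [_ _ /(_ _ cB)[]]; apply: noself.
Qed.

Lemma alpha15_exclusive B D : has_component_type F (DD B) D alpha15gamma6 ->
  ~ (has_component_type F (DD B) D beta21 \/ has_component_type F (DD B) D alpha3gamma18).
Proof.
move=> [c15 _ ag] [bb|[c3 _ _]].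
  have cB := conic_in_DD B; have := bb _ cB.
  by case: (ag _ cB) => ty ty'; have := conic_type_uniq ty ty'.
by have := card_I_uniq c15 c3.
Qed.

Lemma adjG_sym Q Q' : adjG F Q Q' -> adjG F Q' Q.
Proof. by move=> [n c4 c3]; split; [exact: nesym|rewrite setIC|rewrite setIC]. Qed.

(** Replacing [B] by [s' *m B] does not move its conic, so the edge ends in the component of a
    representative [R]; the table forbids this unless [R] is the identity. *)
Lemma adjG_DD X B : unitary X -> frame B ->
  adjG F (conic B) (conic (X *m B)) -> DD B (conic (X *m B)).
Proof.
move=> uX fB adj; have [s [s' [R [ss ss' qs uR [okR XE]]]]] := reduction r2 fB uX.
have uB := frame_unit fB.
have := conic_in_DD (X *m B); rewrite (DD_reduction ss ss' uR fB XE).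
have us' : unitary s' by case: ss'.
have fB' := frameM us' fB.
move=> [n n21 E]; move: okR; rewrite /rep_ok; case: ifP => [/meqP RE _|_ /andP[nonadj _]].
  rewrite RE (embM_id r) mul1mx in E; case: ss' => _ Ds' _; rewrite -(Ds' B fB).
  by exists n; [exact: n21|exact: E].
have uDR := isU_mul char_k r2 (Dn_isU n) uR.
have bad : nonadj25 (mmul (Dn n) R) by move/(all_nthP id25): nonadj; apply; exact: n21.
case: (nonadjP r2 uDR fB' bad).
rewrite (embM_mul char_k r2) -mulmxA -E (conic_qsim char_k uB qs).
exact: adj.
Qed.

(** Edges never leave the 21 conics. Conversely the conic of any frame C is adjacent to those of x C
    and y C, so the conic of y^j x^i B is reached in i + j steps. *)
Lemma componentG_DD B : frame B ->
  [set Q | connected_in (totally_tangent_conics F) (adjG F) (conic B) Q] = DD B.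
Proof.
move=> fB; apply/seteqP; split=> Q /=.
  have step Q1 Q2 : totally_tangent_conics F Q2 -> adjG F Q1 Q2 -> DD B Q1 -> DD B Q2.
    move=> /(totally_tangent_frame char_k uG)[B2 fB2 ->] adj [n n21 Q1E].
    have fB1 := frame_embM r2 (Dn_isU n) fB; have uX := frame_ratio fB1 fB2.
    have B2E : B2 *m invmx (embM (Dn n) *m B) *m (embM (Dn n) *m B) = B2.
      by rewrite mulmxKV // (frame_unit fB1).
    have [_ DE _] := stab_Dn char_k r2 G n.
    by have := adjG_DD uX fB1; rewrite B2E (DE B fB) -Q1E; apply.
  move=> con; suff : DD B (conic B) <-> DD B Q by case=> + _; apply; exact: conic_in_DD.
  elim: con => [Q1 Q2 [V1 V2 adj]|Q1|Q1 Q2 _ [IH1 IH2]|Q1 Q2 Q3 _ [IH1 IH2] _ [IH3 IH4]].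
  - by split; apply: step => //; apply: adjG_sym.
  - by split.
  - by split.
  by split=> H; [apply: IH3; apply: IH1|apply: IH2; apply: IH4].
have chain A m C : isU A -> good25 A -> frame C -> frame (embM (mpow A m) *m C) /\
    connected_in (totally_tangent_conics F) (adjG F) (conic C) (conic (embM (mpow A m) *m C)).
  move=> uA gA fC; elim: m => [|m [fm cm]].
    by rewrite [mpow A 0]/(id25) (embM_id r) mul1mx; split; [exact: fC|exact: rst_refl].
  rewrite /mpow iterS -/(mpow A m) (embM_mul char_k r2) -mulmxA.
  have fm1 : frame (embM A *m (embM (mpow A m) *m C)) by apply: (frame_embM r2 uA).
  split; first exact: fm1.
  apply: (rst_trans _ _ _ _ _ cm); apply: rst_step; split.
  - exact: frame_totally_tangent fm.
  - exact: frame_totally_tangent fm1.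
  exact: (good_adj r2 uA fm gA).
have [ux uy] : isU x25 /\ isU y25 by split; vm_compute.
have /andP[gx gy] := check_adj.
move=> [n n21 ->].
have /allP/(_ n) := check_Dn; rewrite mem_iota n21 => /(_ isT) /meqP ->.
rewrite (embM_mul char_k r2) -mulmxA.
have [fx cx] := chain _ (n %% 7)%N _ ux gx fB.
have [_ cy] := chain _ (n %/ 7)%N _ uy gy fx.
exact: (rst_trans _ _ _ _ _ cx cy).
Qed.

Lemma componentsGP D : componentsG F D <-> exists2 B, frame B & D = DD B.
Proof.
split=> [[Q /(totally_tangent_frame char_k uG)[B fB ->] ->]|[B fB ->]].
  by exists B; [exact: fB|rewrite componentG_DD].
by exists (conic B); [exact: frame_totally_tangent fB|rewrite componentG_DD].
Qed.

Local Notation conH := (connected_in (componentsG F) (adjH F)).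

Lemma alpha15_conH A B : isU A -> frame B -> is_a15 (comptype A) -> conH (DD B) (DD (embM A *m B)).
Proof.
move=> uA fB; case cA: (comptype A) => [[]|] // _.
have ty := component_typeP r2 uA fB cA; apply: rst_step; split.
- by apply/componentsGP; exists B.
- by apply/componentsGP; exists (embM A *m B); first exact: (frame_embM r2 uA fB).
split; last exact: ty.
by move=> E; apply: (no_self_type fB (T := alpha15gamma6)); rewrite {2}E.
Qed.

Lemma square_det_conH X B : unitary X -> frame B -> \det X ^+ 2 = 1 -> conH (DD B) (DD (X *m B)).
Proof.
move=> uX fB dX; have [s [s' [R [ss ss' _ uR [okR XE]]]]] := reduction r2 fB uX.
rewrite (DD_reduction ss ss' uR fB XE); case: ss ss' => us _ ds [us' Ds' ds'].
have fB' := frameM us' fB; rewrite -(Ds' B fB).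
have sq : sqdet1 R.
  by apply/(sqdet1P char_k r2); rewrite -dX XE !det_mulmx !exprMn ds ds' mul1r mulr1.
move: okR; rewrite /rep_ok; case: ifP => [/meqP -> _|_ /andP[_]].
  by rewrite (embM_id r) mul1mx; apply: rst_refl.
rewrite sq => ok; have {ok} /orP[|/andP[_ /(has_nthP id25)[i i7 Rc15]]] : is_a15 (comptype R) ||
    is_g21 (comptype R) && has (fun c => is_a15 (comptype (mmul R (minv c)))) nbrs25 by exact: ok.
  exact: alpha15_conH.
(* In the case gamma^21 the matrix [R] factors as (R c^-1) c, which gives a path of two edges
   through the component of [c]. *)
have /(all_nthP id25)/(_ i i7)/andP[] := check_nbrs; move: (nth _ _ _) Rc15 => c Rc15 uc c15.
have fc := frame_embM r2 uc fB'; have uc' := unitary_unit (isUP char_k r2 uc).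
apply: (rst_trans _ _ _ _ _ (alpha15_conH uc fB' c15)).
have -> : embM R *m (s' *m B) = embM (mmul R (minv c)) *m (embM c *m (s' *m B)).
  by rewrite (embM_mul char_k r2) (embM_minvE char_k r2 uc) -mulmxA (mulKmx uc').
exact: (alpha15_conH (isU_mul char_k r2 uR (isU_minv char_k r2 uc)) fc Rc15).
Qed.

(** A path may follow an edge against the direction in which its type is known, so [types_by_det] is
    applied to the ratio of the two frames in either order; alpha^15 gamma^6 rules out the case of
    different squared determinants. *)
Lemma conH_det B B' : frame B -> frame B' -> conH (DD B) (DD B') ->
  exists2 B'', frame B'' & DD B' = DD B'' /\ \det B'' ^+ 2 = \det B ^+ 2.
Proof.
move=> fB fB' con; pose P D := exists2 C, frame C & D = DD C /\ \det C ^+ 2 = \det B ^+ 2.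
have step D1 D2 : componentsG F D2 -> has_component_type F D1 D2 alpha15gamma6 \/
    has_component_type F D2 D1 alpha15gamma6 -> P D1 -> P D2.
  move=> /componentsGP[C2 fC2 ->] ty [C1 fC1 [E1 d1]]; rewrite {}E1 in ty.
  exists C2; first exact: fC2.
  have unit1 := frame_unit fC1; have unit2 := frame_unit fC2.
  split=> //; rewrite -d1; case: ty => ty.
    have := types_by_det (frame_ratio fC1 fC2) fC1; rewrite (mulmxKV unit1) (det_ratio _ unit1).
    by case: eqP => [->|_ /(alpha15_exclusive ty)].
  have := types_by_det (frame_ratio fC2 fC1) fC2; rewrite (mulmxKV unit2) (det_ratio _ unit2).
  by case: eqP => [->|_ /(alpha15_exclusive ty)].
suff : P (DD B) <-> P (DD B') by case=> + _; apply; exists B.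
elim: con => [D1 D2 [V1 V2 [_ ty]]|D1|D1 D2 _ [IH1 IH2]|D1 D2 D3 _ [IH1 IH2] _ [IH3 IH4]].
- by split; apply: step => //; [left|right].
- by split.
- by split.
by split=> H; [apply: IH3; apply: IH1|apply: IH2; apply: IH4].
Qed.

End Components.

Theorem proposition1p9 (k : closedFieldType) (char_k : 5%N \in [pchar k])
    (F : {mpoly k[3]}) (hermF : hermitian_curve F)
    (D D' : set (set (point k)))
    (compD : componentsG F D) (compD' : componentsG F D') (neqD : D <> D') :
  (same_component (componentsG F) (adjH F) D D' ->
     has_component_type F D D' gamma21
     \/ has_component_type F D D' alpha15gamma6)
  /\
  (~ same_component (componentsG F) (adjH F) D D' ->
     has_component_type F D D' beta21
     \/ has_component_type F D D' alpha3gamma18).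
Proof.
have [g ug FE] := hermitian_curveE char_k hermF.
have [r r2] := nth_root (n := 2) (2%:R : k) isT.
pose G := gram char_k g; rewrite -/G in FE.
have uG : G \in unitmx by rewrite unitmx_mul ug unitmx_tr map_unitmx.
subst F; have [B fB DE] := (componentsGP char_k r2 uG D).1 compD.
have [B' fB' DE'] := (componentsGP char_k r2 uG D').1 compD'.
rewrite {}DE {}DE' {compD compD'} in neqD *; have uB := frame_unit fB.
split=> [[C [D0 D0E ->] [con con']]|disc].
  have {con con'} con := rst_trans _ _ _ _ _ (rst_sym _ _ _ _ con) con'.
  have [B2 fB2 [E d2]] := conH_det r2 uG fB fB' con.
  have := types_by_det r2 (frame_ratio fB fB2) fB.
  by rewrite (mulmxKV uB) -E (det_ratio _ uB) d2 eqxx => -[/esym/neqD [] |ty|ty]; [left; exact: ty|right; exact: ty].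
have := types_by_det r2 (frame_ratio fB fB') fB; rewrite (mulmxKV uB).
case: eqP => [d1|_ ty]; last exact: ty.
case: disc.
have := square_det_conH r2 uG (frame_ratio fB fB') fB d1; rewrite (mulmxKV uB) => con.
exists [set E | connected_in (componentsG (hermitian G)) (adjH (hermitian G)) (DD r B) E].
  by exists (DD r B); [apply/(componentsGP char_k r2 uG); exists B|].
by split; [exact: rst_refl|exact: con].
Qed.
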